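(* Let $G=[g_1,g_2,\ldots]$ be a transcendental semigroup. Under each of the following conditions, $J(G)\cup\{\infty\}$ is connected in the Riemann sphere $\widetilde{\mathbb{C}}$: (i) there is a curve $\Gamma$ tending to $\infty$ such that every generator $g_i$ of $G$ is bounded on $\Gamma$; (ii) $F(G)$ has an unbounded component; (iii) $F(G)$ has a domain (a nonempty connected open set $D\subset F(G)$) which is completely invariant under some $g_0\in G$.
   Context: A transcendental semigroup $G=[g_1,g_2,\ldots]$ is the set of all finite compositions (of length at least one) of members of a countable (finite or infinite) family $\{g_1,g_2,\ldots\}$ of transcendental entire functions (the generators). $\widetilde{\mathbb{C}}=\mathbb{C}\cup\{\infty\}$ is the Riemann sphere. The Fatou set $F(G)$ is the largest open subset of $\mathbb{C}$ on which the family $G$ is normal (every sequence in $G$ has a subsequence converging locally uniformly to a holomorphic function or to $\infty$). The Julia set is $J(G)=\widetilde{\mathbb{C}}\setminus F(G)$. A set $W$ is completely invariant under an entire function $g$ if $g(W)\subset W$ and $g^{-1}(W)=\{w\in\mathbb{C}: g(w)\in W\}\subset W$. *)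

(* Defs.v *)
From mathcomp Require Import all_boot all_order all_algebra.
From mathcomp Require Import all_classical all_reals all_analysis.
From mathcomp Require Import complex.

Set Implicit Arguments.
Unset Strict Implicit.
Unset Printing Implicit Defensive.

Import Order.TTheory GRing.Theory Num.Theory numFieldNormedType.Exports.

Local Open Scope classical_set_scope.
Local Open Scope ring_scope.
Local Open Scope complex_scope.

(* The bare type [R[i]] carries no topology; seen as a [numClosedFieldType] it
   inherits the one given by the modulus, through [numFieldNormedType]. *)
Definition CC (R : realType) : numClosedFieldType := R[i].

(* The point at infinity is [None]; a finite point [z] is [Some z]. *)
Definition sphere (R : realType) : topologicalType :=
  one_point_compactification (CC R).

(* [derivable h z 1] over the field [CC R] is complex differentiability. *)
Definition holomorphic_on (R : realType) (U : set (CC R)) (h : CC R -> CC R) :=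
  forall z, U z -> derivable h z 1.

Definition entire (R : realType) (f : CC R -> CC R) := holomorphic_on setT f.

Definition transcendental_entire (R : realType) (f : CC R -> CC R) :=
  entire f /\ ~ (exists p : {poly CC R}, forall z, f z = p.[z]).

Inductive semigroup (T : Type) (gens : set (T -> T)) : set (T -> T) :=
| semigroup_gen g : gens g -> semigroup gens g
| semigroup_comp g h : gens g -> semigroup gens h -> semigroup gens (g \o h).

Definition cvg_locally_uniformly (R : realType) (U : set (CC R))
    (f : nat -> CC R -> CC R) (h : CC R -> CC R) :=
  forall z, U z -> exists2 V, nbhs z V & {uniform V, f @ \oo --> h}.

Definition cvg_locally_uniformly_infty (R : realType) (U : set (CC R))
    (f : nat -> CC R -> CC R) :=
  forall z, U z -> exists2 V, nbhs z V &
    forall M : R, \forall n \near \oo, forall w, V w -> M%:C <= `|f n w|.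

Definition normal_on (R : realType) (G : set (CC R -> CC R))
    (U : set (CC R)) :=
  forall f : nat -> CC R -> CC R, (forall n, G (f n)) ->
  exists2 phi : nat -> nat, {homo phi : m n / (m < n)%N} &
    (exists2 h, holomorphic_on U h & cvg_locally_uniformly U (f \o phi) h)
    \/ cvg_locally_uniformly_infty U (f \o phi).

(* Normality is a local property: the limit of a subsequence may be holomorphic
   on one component of the Fatou set and infinite on another.  Since [normal_on]
   imposes a single alternative on all of [U], the largest open set of normality
   is the union of the open sets on which [normal_on] holds. *)
Definition fatou_set (R : realType) (G : set (CC R -> CC R)) : set (CC R) :=
  \bigcup_(U in [set U | open U /\ normal_on G U]) U.

Definition julia_set (R : realType) (G : set (CC R -> CC R)) : set (sphere R) :=
  ~` (Some @` fatou_set G).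

Definition curve_to_infty (R : realType) (Gamma : set (CC R)) :=
  exists gamma : R -> CC R,
    [/\ {within `[0, +oo[, continuous gamma},
        forall M : R, \forall t \near +oo, M%:C <= `|gamma t|
      & Gamma = gamma @` `[0, +oo[].

Definition completely_invariant (T : Type) (g : T -> T) (W : set T) :=
  g @` W `<=` W /\ g @^-1` W `<=` W.

(* Main.v *)
(* Only max/min modulus principles for functions that are merely complex differentiable at
   every point are needed.  They follow from Goursat's lemma for trapezoid sums over squares
   (no integral is used): the sums of (f z - f a) / (z - a) over a square centered at a tend
   to 0, which bounds |f a| by the maximum of |f| on an annulus, up to a constant that is
   removed by passing to powers of f.

   If J(G) with infinity is disconnected, a bounded open set V meeting J(G) has its boundary
   inside one component of F(G).  There the family is comparable: functions large at a point
   of the boundary of V are large on all of it, with moduli comparable up to a power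
   (Harnack).  Non-normality on V yields f in G with |f| arbitrarily large on the boundary of
   V and with a zero in V, so that f(V) contains arbitrarily large discs.
   - A curve to infinity on which a generator g is bounded meets f(boundary of V), so g o f
     is bounded on V independently of f, and g is bounded on the plane.
   - An unbounded component U of F(G) meets the images of the boundary of V under f and its
     iterates.  Harnack in U compares |f^m| and |f^(m+1)| on the boundary of V, so f has
     polynomial growth.
   - A completely invariant domain is unbounded by the Casorati-Weierstrass theorem. *)
Require Import Defs.
From mathcomp Require Import all_boot all_order all_algebra.
From mathcomp Require Import all_classical all_reals all_analysis.
From mathcomp Require Import complex ring lra zify.
Import Order.TTheory GRing.Theory Num.Theory numFieldNormedType.Exports.
Local Open Scope classical_set_scope.
Local Open Scope ring_scope.
Local Open Scope complex_scope.
Set Implicit Arguments.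
Unset Strict Implicit.
Unset Printing Implicit Defensive.

(** * Modulus and complex differentiability *)

(** The obstacle in the topological step: a neighbourhood of the compact piece of the Julia set has
    its boundary in F(G), but perhaps spread over many components, while moduli can be compared only
    within one. A cutoff function, 1 on that piece and 0 far out, is therefore split along the
    components of F(G). Each share of its variation is locally additive, so it sums to a function
    that vanishes on the rim of a large disc and is an integer off its component; a level 1/2 of
    this function then lies in one component.

    The obstacle in the analytic step: without integrals and logarithms, difference quotients take
    the place of power series (they are again differentiable, and the annulus estimate bounds them),
    and roots of order 2^k take the place of the logarithm in Harnack's inequality.

    Polynomial growth comes from a covering: if t is the minimum of |f^m| on the boundary of V, then
    f^m(V) contains the disc of radius t/3, and |f^(m+1)| <= t^k on V with k independent of m; so
    |f| <= t^k on that disc, for arbitrarily large t. *)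

(* The norm of [CC R] takes its values in [CC R]; [nm] is the real-valued modulus. *)
Definition nm (R : realType) (z : CC R) : R := Normc.normc z.
Definition rc (R : realType) (x : R) : CC R := x%:C.
Definition re (R : realType) (z : CC R) : R := complex.Re z.
Definition im (R : realType) (z : CC R) : R := complex.Im z.

Section Modulus.
Variable R : realType.
Local Notation C := (CC R).
Implicit Types (z w a b : C) (x y e : R).

Lemma nm_norm z : `|z| = (nm z)%:C :> C. Proof. by []. Qed.
Lemma nm_ge0 z : 0 <= nm z.
Proof. by case: z => a b; rewrite /nm /= sqrtr_ge0. Qed.
Lemma nm0 : nm (0 : C) = 0. Proof. exact: Normc.normc0. Qed.
Lemma nm1 : nm (1 : C) = 1. Proof. exact: Normc.normc1. Qed.
Lemma nmM z w : nm (z * w) = nm z * nm w. Proof. exact: Normc.normcM. Qed.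
Lemma nmV z : nm z^-1 = (nm z)^-1. Proof. exact: Normc.normcV. Qed.
Lemma nmN z : nm (- z) = nm z.
Proof. by apply: complexI; rewrite -!nm_norm normrN. Qed.
Lemma nmD z w : nm (z + w) <= nm z + nm w.
Proof. by rewrite -lecR rmorphD /= -!nm_norm ler_normD. Qed.
Lemma nmB z w : nm (z - w) <= nm z + nm w.
Proof. by rewrite -(nmN w) nmD. Qed.
Lemma nm_sub z w : nm (z - w) = nm (w - z).
Proof. by rewrite -nmN opprB. Qed.
Lemma nm_tri b z w : nm (z - w) <= nm (z - b) + nm (b - w).
Proof. by rewrite (_ : z - w = (z - b) + (b - w)) ?nmD //; ring. Qed.
Lemma nm_lesub z w : nm z - nm w <= nm (z - w).
Proof. by have := nmD (z - w) w; rewrite subrK; lra. Qed.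
Lemma nmX z n : nm (z ^+ n) = nm z ^+ n.
Proof. by elim: n => [|n IH]; rewrite ?expr0 ?nm1 // !exprS nmM IH. Qed.
Lemma nm_eq0 z : (nm z == 0) = (z == 0).
Proof.
apply/eqP/eqP => [h|->]; last exact: nm0.
exact: Normc.eq0_normc.
Qed.
Lemma nm_gt0 z : (0 < nm z) = (z != 0).
Proof. by rewrite lt_neqAle nm_ge0 andbT eq_sym nm_eq0. Qed.
Lemma nm_rc x : nm (rc x) = `|x|.
Proof. by rewrite /nm /= expr0n /= addr0 sqrtr_sqr. Qed.
Lemma nm_sqr z : nm z ^+ 2 = re z ^+ 2 + im z ^+ 2.
Proof. by case: z => a b; rewrite /nm /= sqr_sqrtr // addr_ge0 ?sqr_ge0. Qed.
Lemma nm_re z : `|re z| <= nm z.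
Proof.
by rewrite -(@ler_pXn2r _ 2) ?nnegrE ?nm_ge0 // nm_sqr real_normK ?num_real // lerDl sqr_ge0.
Qed.
Lemma nm_im z : `|im z| <= nm z.
Proof.
by rewrite -(@ler_pXn2r _ 2) ?nnegrE ?nm_ge0 // nm_sqr real_normK ?num_real // lerDr sqr_ge0.
Qed.
Lemma nm_ReIm z : nm z <= `|re z| + `|im z|.
Proof.
rewrite -(@ler_pXn2r _ 2) ?nnegrE ?nm_ge0 ?addr_ge0 // nm_sqr sqrrD.
by rewrite !real_normK ?num_real // lerD2r lerDl mulrn_wge0 // mulr_ge0.
Qed.

Lemma reD z w : re (z + w) = re z + re w. Proof. by case: z w => ? ? []. Qed.
Lemma imD z w : im (z + w) = im z + im w. Proof. by case: z w => ? ? []. Qed.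
Lemma reN z : re (- z) = - re z. Proof. by case: z. Qed.
Lemma imN z : im (- z) = - im z. Proof. by case: z. Qed.
Lemma reM z w : re (z * w) = re z * re w - im z * im w.
Proof. by case: z w => ? ? []. Qed.
Lemma imM z w : im (z * w) = re z * im w + im z * re w.
Proof. by case: z w => ? ? []. Qed.
Lemma rcD x y : rc (x + y) = rc x + rc y. Proof. exact: rmorphD. Qed.
Lemma rcM x y : rc (x * y) = rc x * rc y. Proof. exact: rmorphM. Qed.
Lemma rcN x : rc (- x) = - rc x. Proof. exact: rmorphN. Qed.
Lemma rcV x : rc x^-1 = (rc x)^-1. Proof. exact: fmorphV. Qed.
Lemma rc_nat n : rc (n%:R : R) = n%:R. Proof. exact: rmorph_nat. Qed.
Lemma re_rc x : re (rc x) = x. Proof. by []. Qed.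
Lemma im_rc x : im (rc x) = 0. Proof. by []. Qed.

Lemma nbhsCP z (A : set C) :
  nbhs z A <-> exists2 e, 0 < e & forall w, nm (w - z) < e -> A w.
Proof.
split.
  move/(@nbhs_ballP C C) => [e /= e0 h].
  have eR : e = (re e)%:C by rewrite RRe_real // gtr0_real.
  exists (re e) => [|w hw]; first by rewrite -ltcR -eR.
  by apply: h; rewrite -ball_normE /= nm_norm eR nm_sub ltcR.
move=> [e e0 h]; apply/(@nbhs_ballP C C); exists (e%:C) => /=; first by rewrite ltcR.
by move=> w; rewrite -ball_normE /= nm_norm ltcR nm_sub; exact: h.
Qed.

Definition cont_at (f : C -> C) a :=
  forall e, 0 < e -> exists2 d, 0 < d & forall z, nm (z - a) < d -> nm (f z - f a) < e.

Lemma contP (f : C -> C) a : {for a, continuous f} <-> cont_at f a.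
Proof.
split.
  move=> cf e e0; apply/(nbhsCP a [set z | nm (f z - f a) < e]).
  have /cf : nbhs (f a) [set w | nm (w - f a) < e] by apply/nbhsCP; exists e.
  by [].
move=> h A /nbhsCP[e e0 he]; have [d d0 hd] := h e e0.
by apply/nbhsCP; exists d => // w /hd /he.
Qed.

Lemma openCP (A : set C) : open A <->
  forall z, A z -> exists2 e, 0 < e & forall w, nm (w - z) < e -> A w.
Proof.
by rewrite openE; split => h z /h => [/nbhsCP|hz]; [|apply/nbhsCP].
Qed.

Lemma cont_cst (c : C) a : cont_at (fun=> c) a.
Proof. by move=> e e0; exists 1 => // z _; rewrite subrr nm0. Qed.
Lemma cont_id a : cont_at (fun z => z) a.
Proof. by move=> e e0; exists e. Qed.
Lemma contD (f g : C -> C) a : cont_at f a -> cont_at g a -> cont_at (fun z => f z + g z) a.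
Proof. by move=> /contP cf /contP cg; apply/contP; exact: (cvgD cf cg). Qed.
Lemma contN (f : C -> C) a : cont_at f a -> cont_at (fun z => - f z) a.
Proof. by move=> /contP cf; apply/contP; exact: (cvgN cf). Qed.
Lemma contM (f g : C -> C) a : cont_at f a -> cont_at g a -> cont_at (fun z => f z * g z) a.
Proof. by move=> /contP cf /contP cg; apply/contP; exact: (cvgM cf cg). Qed.
Lemma contV (f : C -> C) a : f a != 0 -> cont_at f a -> cont_at (fun z => (f z)^-1) a.
Proof. by move=> f0 /contP cf; apply/contP; exact: (cvgV f0 cf). Qed.
Lemma cont_comp (f g : C -> C) a : cont_at f a -> cont_at g (f a) -> cont_at (fun z => g (f z)) a.
Proof.
move=> cf cg e /cg[d /cf [d' d'0 h] hg]; exists d' => // z hz; exact/hg/h.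
Qed.

(** Carathéodory's form of differentiability. It turns the difference quotient, completed at [a] by
    the derivative, into a function [q] to which the later estimates are applied. *)
Definition cdiff (f : C -> C) a :=
  exists2 q : C -> C, cont_at q a & forall z, f z = f a + q z * (z - a).

Lemma derivable_cdiff (f : C -> C) a : derivable f a 1 <-> cdiff f a.
Proof.
split.
  rewrite /derivable => /cvg_ex [l hl].
  pose q z := if z == a then l else (f z - f a) / (z - a).
  exists q => [|z]; last first.
    rewrite /q; case: eqP => [->|/eqP za]; first by rewrite subrr mulr0 addr0.
    by rewrite divfK ?subr_eq0 // addrC subrK.
  move=> e e0.
  have : nbhs l [set w | nm (w - l) < e] by apply/nbhsCP; exists e.
  move/hl; rewrite /= nbhs_simpl /= => /nbhsCP [d d0 hd].
  exists d => // z hz; rewrite /q eqxx; case: eqP => [_|/eqP za]; first by rewrite subrr nm0.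
  have := hd (z - a); rewrite subr0 subr_eq0 => /(_ hz za) /=.
  by rewrite /GRing.scale /= mulr1 subrK mulrC.
move=> [q cq fq]; apply/cvg_ex; exists (q a) => A /nbhsCP [e e0 he].
have [d d0 hd] := cq e e0.
apply/nbhsCP; exists d => // h; rewrite subr0 => hh h0 /=; apply: he.
have -> : h^-1 *: (f (h *: (1 : C) + a) - f a) = q (h + a).
  rewrite /GRing.scale /= mulr1 fq addrK addrC addKr mulrC mulfK //.
by apply: hd; rewrite addrK.
Qed.

Lemma cdiff_cont f a : cdiff f a -> cont_at f a.
Proof.
move=> [q cq fq].
have -> : f = (fun z => f a + q z * (z + - a)) by apply/funext.
apply: (@contD (fun=> f a) (fun z => q z * (z + - a))); first exact: cont_cst.
apply: (@contM q (fun z => z + - a)) => //.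
by apply: (@contD (fun z => z) (fun=> - a)); [exact: cont_id|exact: cont_cst].
Qed.

Lemma cdiff_cst c a : cdiff (fun=> c) a.
Proof. by exists (fun=> 0) => [|z]; [exact: cont_cst|rewrite mul0r addr0]. Qed.
Lemma cdiff_id a : cdiff (fun z => z) a.
Proof. by exists (fun=> 1) => [|z]; [exact: cont_cst|rewrite mul1r addrC subrK]. Qed.
Lemma cdiffD f g a : cdiff f a -> cdiff g a -> cdiff (fun z => f z + g z) a.
Proof.
move=> [q cq fq] [p cp gp]; exists (fun z => q z + p z); first exact: (@contD q p).
by move=> z; rewrite fq gp; ring.
Qed.
Lemma cdiffM f g a : cdiff f a -> cdiff g a -> cdiff (fun z => f z * g z) a.
Proof.
move=> df [p cp gp]; have [q cq fq] := df.
exists (fun z => q z * g a + f z * p z).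
  apply: (@contD (fun z => q z * g a) (fun z => f z * p z)).
    by apply: (@contM q (fun=> g a)) => //; exact: cont_cst.
  by apply: (@contM f p) => //; exact: cdiff_cont.
by move=> z; rewrite gp mulrDr {1}(fq z); ring.
Qed.
Lemma cdiffN f a : cdiff f a -> cdiff (fun z => - f z) a.
Proof.
move=> /(cdiffM (cdiff_cst (-1) a)).
by rewrite (_ : (fun z => -1 * f z) = (fun z => - f z)) //; apply/funext => z; rewrite mulN1r.
Qed.
Lemma cdiffB f g a : cdiff f a -> cdiff g a -> cdiff (fun z => f z - g z) a.
Proof. by move=> df dg; apply: cdiffD => //; exact: cdiffN. Qed.

Lemma cdiffBc f (c : C) a : cdiff f a -> cdiff (fun z => f z - c) a.
Proof. by move=> df; apply: (cdiffB df); exact: cdiff_cst. Qed.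
Lemma cdiff_sub (c : C) a : cdiff (fun z => z - c) a.
Proof. exact/cdiffBc/cdiff_id. Qed.

Lemma cdiff_eq f g a e : 0 < e -> (forall z, nm (z - a) < e -> f z = g z) ->
  cdiff f a -> cdiff g a.
Proof.
move=> e0 fg [q cq fq].
have fga : f a = g a by apply: fg; rewrite subrr nm0.
exists (fun z => if nm (z - a) < e then q z else (g z - g a) / (z - a)).
  move=> x x0; have [d d0 hd] := cq x x0.
  exists (Num.min d e) => [|z]; first by rewrite lt_min d0.
  rewrite lt_min => /andP[hz ->]; rewrite subrr nm0 e0; exact: hd.
move=> z; case: ifP => h; first by rewrite -fg // fq -fga.
have za : z - a != 0.
  by apply/negP => /eqP h0; move: h; rewrite h0 nm0 e0.
by rewrite divfK // addrC subrK.
Qed.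

Lemma cont_neq0 (f : C -> C) a : cont_at f a -> f a != 0 ->
  exists2 e, 0 < e & forall z, nm (z - a) < e -> f z != 0.
Proof.
move=> cf f0; have [d d0 hd] := cf (nm (f a)) (eqbRL (nm_gt0 _) f0).
exists d => // z /hd h; apply/negP => /eqP fz; move: h.
by rewrite fz sub0r nmN ltxx.
Qed.

Lemma cdiffV f a : cdiff f a -> f a != 0 -> cdiff (fun z => (f z)^-1) a.
Proof.
move=> df f0; have [q cq fq] := df.
have [e e0 he] := cont_neq0 (cdiff_cont df) f0.
pose g z := (f a)^-1 + (- q z / (f z * f a)) * (z - a).
apply: (@cdiff_eq g _ a e) => //.
  move=> z hz; rewrite /g.
  have -> : - q z / (f z * f a) * (z - a) = (f a - f z) / (f z * f a).
    have -> : f a - f z = - (q z * (z - a)) by rewrite (fq z) opprD addNKr.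
    by ring.
  by field; rewrite f0 he.
exists (fun z => - q z / (f z * f a)).
  apply: (@contM (fun z => - q z) (fun z => (f z * f a)^-1)); first exact: contN.
  apply: (@contV (fun z => f z * f a)); first by rewrite mulf_neq0.
  by apply: (@contM f (fun=> f a)); [exact: cdiff_cont|exact: cont_cst].
by move=> z; rewrite /g subrr mulr0 addr0.
Qed.

Lemma cdiff_comp f g a : cdiff f a -> cdiff g (f a) -> cdiff (fun z => g (f z)) a.
Proof.
move=> df [p cp gp]; have [q cq fq] := df.
exists (fun z => p (f z) * q z).
  apply: (@contM (fun z => p (f z)) q) => //.
  by apply: (@cont_comp f p) => //; exact: cdiff_cont.
move=> z; rewrite gp; have -> : f z - f a = q z * (z - a) by rewrite (fq z) addrC addKr.
by rewrite mulrA.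
Qed.

Lemma cdiffX f a n : cdiff f a -> cdiff (fun z => f z ^+ n) a.
Proof.
move=> df; elim: n => [|n IH]; first exact: cdiff_cst.
rewrite (_ : (fun z => _) = (fun z => f z * f z ^+ n)); first exact: cdiffM.
by apply/funext => z; rewrite exprS.
Qed.

Lemma cdiff_prod (s : seq C) (F : C -> C -> C) a : (forall p, cdiff (F p) a) ->
  cdiff (fun z => \prod_(p <- s) F p z) a.
Proof.
move=> h; elim: s => [|p s IH].
  rewrite (_ : (fun z => _) = (fun=> 1)); first exact: cdiff_cst.
  by apply/funext => z; rewrite big_nil.
rewrite (_ : (fun z => _) = (fun z => F p z * \prod_(p <- s) F p z)); first exact: cdiffM.
by apply/funext => z; rewrite big_cons.
Qed.

End Modulus.
#[export] Hint Extern 0 (is_true (0 <= nm _)%R) => exact: nm_ge0 : core.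

(** * Trapezoid sums and Goursat's lemma *)

Section Goursat.
Variable R : realType.
Local Notation C := (CC R).
Implicit Types (f g : C -> C) (p q z w a : C) (x y s t e M : R).

Lemma cC_eq z w : re z = re w -> im z = im w -> z = w.
Proof. by case: z w => a b [c d] /= -> ->. Qed.

(** A finite stand-in for the contour integral along a segment. Cutting into three rather than two
    parts makes the middle one of the nine subsquares concentric with the square, which isolates a
    singular centre in [ring_step]. *)
Fixpoint trapezoid n f p q : C :=
  if n is n'.+1 then
    let d := (q - p) / 3 in
    trapezoid n' f p (p + d) + trapezoid n' f (p + d) (p + d + d) + trapezoid n' f (p + d + d) q
  else (f p + f q) / 2 * (q - p).

Definition in_segment p q z := exists2 t, 0 <= t <= 1 & z = p + rc t * (q - p).

Lemma rc3 : rc (3 : R) = 3. Proof. exact: rc_nat. Qed.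
Lemma seg1 p q z : let d := (q - p) / 3 in in_segment p (p + d) z -> in_segment p q z.
Proof.
move=> d [t /andP[t0 t1] ->]; exists (t / 3); first by apply/andP; split; lra.
by rewrite rcM rcV rc3 /d; field.
Qed.
Lemma seg2 p q z : let d := (q - p) / 3 in in_segment (p + d) (p + d + d) z -> in_segment p q z.
Proof.
move=> d [t /andP[t0 t1] ->]; exists ((1 + t) / 3); first by apply/andP; split; lra.
by rewrite rcM rcV rc3 rcD /d (_ : rc 1 = 1) //; field.
Qed.
Lemma seg3 p q z : let d := (q - p) / 3 in in_segment (p + d + d) q z -> in_segment p q z.
Proof.
move=> d [t /andP[t0 t1] ->]; exists ((2 + t) / 3); first by apply/andP; split; lra.
by rewrite rcM rcV rc3 rcD /d (_ : rc 2 = 2) ?rc_nat //; field.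
Qed.
Lemma segl p q : in_segment p q p.
Proof. by exists 0; [lra|rewrite (_ : rc 0 = 0) // mul0r addr0]. Qed.
Lemma segr p q : in_segment p q q.
Proof. by exists 1; [lra|rewrite (_ : rc 1 = 1) // mul1r addrC subrK]. Qed.

Lemma tz_step n f p d : trapezoid n.+1 f p (p + d + d + d) =
  trapezoid n f p (p + d) + trapezoid n f (p + d) (p + d + d) + trapezoid n f (p + d + d) (p + d + d + d).
Proof.
rewrite [LHS]/=; have -> : (p + d + d + d - p) / 3 = d by field.
by [].
Qed.

Lemma tz_anti n f p q : trapezoid n f q p = - trapezoid n f p q.
Proof.
elim: n p q => [|n IH] p q /=; first by field.
have -> : q + (p - q) / 3 = p + (q - p) / 3 + (q - p) / 3 by field.
have -> : p + (q - p) / 3 + (q - p) / 3 + (p - q) / 3 = p + (q - p) / 3 by field.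
by rewrite (IH (p + (q - p) / 3 + (q - p) / 3) q) (IH p) (IH (p + (q - p) / 3)); ring.
Qed.

Lemma tzD n f g p q : trapezoid n (fun z => f z + g z) p q = trapezoid n f p q + trapezoid n g p q.
Proof.
elim: n p q => [|n IH] p q; first by rewrite /=; ring.
by rewrite /= !IH; ring.
Qed.
Lemma tzZ n k f p q : trapezoid n (fun z => k * f z) p q = k * trapezoid n f p q.
Proof.
elim: n p q => [|n IH] p q; first by rewrite /=; ring.
by rewrite /= !IH; ring.
Qed.
Lemma eq_tz n f g p q : (forall z, in_segment p q z -> f z = g z) ->
  trapezoid n f p q = trapezoid n g p q.
Proof.
elim: n p q => [|n IH] p q h /=; first by rewrite !h //; [exact: segr|exact: segl].
by rewrite !IH // => z hz; apply: h; [exact: seg3|exact: seg2|exact: seg1].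
Qed.
(** The trapezoid rule is exact on affine functions, so the affine part of a function contributes
    exactly 0 around a square ([bd_lin]). *)
Lemma tz_lin n k l p q : trapezoid n (fun z => k + l * z) p q = (k + l * (p + q) / 2) * (q - p).
Proof.
elim: n p q => [|n IH] p q; first by rewrite /=; field.
by rewrite /= !IH; field.
Qed.

Lemma tz_bound n f p q M : (forall z, in_segment p q z -> nm (f z) <= M) ->
  nm (trapezoid n f p q) <= M * nm (q - p).
Proof.
elim: n p q => [|n IH] p q h /=.
  rewrite nmM; apply: ler_wpM2r => //.
  have -> : nm ((f p + f q) / 2) = nm (f p + f q) / 2.
    by rewrite nmM nmV -rc_nat nm_rc normr_nat.
  have := nmD (f p) (f q); have := h _ (segl p q); have := h _ (segr p q); lra.
set d := (q - p) / 3.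
have d3 : nm d = nm (q - p) / 3.
  by rewrite /d nmM nmV -rc3 nm_rc normr_nat.
have h1 := IH p (p + d) (fun z hz => h z (seg1 hz)).
have h2 := IH (p + d) (p + d + d) (fun z hz => h z (seg2 hz)).
have h3 := IH (p + d + d) q (fun z hz => h z (seg3 hz)).
have e1 : p + d - p = d by ring.
have e2 : p + d + d - (p + d) = d by ring.
have e3 : q - (p + d + d) = d by rewrite /d; field.
rewrite e1 d3 in h1; rewrite e2 d3 in h2; rewrite e3 d3 in h3.
have := nmD (trapezoid n f p (p + d) + trapezoid n f (p + d) (p + d + d)) (trapezoid n f (p + d + d) q).
have := nmD (trapezoid n f p (p + d)) (trapezoid n f (p + d) (p + d + d)).
lra.
Qed.

(** The sum is a convex combination of values of [(q - p) * f] on the segment. This gives the lower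
    bound for the winding sum in [kernel_im]. *)
Lemma tz_im n f p q M : (forall z, in_segment p q z -> M <= im ((q - p) * f z)) ->
  M <= im (trapezoid n f p q).
Proof.
elim: n p q M => [|n IH] p q M h.
  rewrite /=.
  have -> : (f p + f q) / 2 * (q - p) = rc (2^-1) * ((q - p) * f p + (q - p) * f q).
    by rewrite rcV rc_nat; field.
  rewrite imM re_rc im_rc imD; have := h _ (segl p q); have := h _ (segr p q); lra.
rewrite /=; set d := (q - p) / 3.
have hd z : M <= im ((q - p) * f z) -> M / 3 <= im (d * f z).
  have -> : d * f z = rc (3^-1) * ((q - p) * f z) by rewrite rcV rc3 /d; field.
  by rewrite [im (rc _ * _)]imM re_rc im_rc; lra.
have e1 : p + d - p = d by ring.
have e2 : p + d + d - (p + d) = d by ring.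
have e3 : q - (p + d + d) = d by rewrite /d; field.
have h1 : M / 3 <= im (trapezoid n f p (p + d)).
  by apply: IH => z hz; rewrite e1; apply/hd/h/seg1.
have h2 : M / 3 <= im (trapezoid n f (p + d) (p + d + d)).
  by apply: IH => z hz; rewrite e2; apply/hd/h/seg2.
have h3 : M / 3 <= im (trapezoid n f (p + d + d) q).
  by apply: IH => z hz; rewrite e3; apply/hd/h/seg3.
by rewrite !imD; lra.
Qed.

Definition pt x y : C := Complex x y.
Lemma ptD x y s t : pt x y + pt s t = pt (x + s) (y + t). Proof. by []. Qed.

Definition square_sum n f x y s : C :=
  trapezoid n f (pt x y) (pt (x + s) y) + trapezoid n f (pt (x + s) y) (pt (x + s) (y + s)) +
  trapezoid n f (pt (x + s) (y + s)) (pt x (y + s)) + trapezoid n f (pt x (y + s)) (pt x y).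

Lemma tz_stepH n f x y t : trapezoid n.+1 f (pt x y) (pt (x + t + t + t) y) =
  trapezoid n f (pt x y) (pt (x + t) y) + trapezoid n f (pt (x + t) y) (pt (x + t + t) y) +
  trapezoid n f (pt (x + t + t) y) (pt (x + t + t + t) y).
Proof.
have h u : pt (u + t) y = pt u y + pt t 0 by rewrite ptD addr0.
by rewrite !h tz_step.
Qed.
Lemma tz_stepV n f x y t : trapezoid n.+1 f (pt x y) (pt x (y + t + t + t)) =
  trapezoid n f (pt x y) (pt x (y + t)) + trapezoid n f (pt x (y + t)) (pt x (y + t + t)) +
  trapezoid n f (pt x (y + t + t)) (pt x (y + t + t + t)).
Proof.
have h u : pt x (u + t) = pt x u + pt 0 t by rewrite ptD addr0.
by rewrite !h tz_step.
Qed.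

(** Inner edges are run through twice in opposite directions and cancel exactly by [tz_anti]; the
    depth drops by one because each outer edge is itself cut into three. *)
Lemma bd_step n f x y t : square_sum n.+1 f x y (t + t + t) =
  square_sum n f x y t + square_sum n f (x + t) y t + square_sum n f (x + t + t) y t +
  square_sum n f x (y + t) t + square_sum n f (x + t) (y + t) t + square_sum n f (x + t + t) (y + t) t +
  square_sum n f x (y + t + t) t + square_sum n f (x + t) (y + t + t) t + square_sum n f (x + t + t) (y + t + t) t.
Proof.
have A m (u a b : R) : trapezoid m f (pt (a + u) b) (pt a b) = - trapezoid m f (pt a b) (pt (a + u) b).
  exact: tz_anti.
have B m (u a b : R) : trapezoid m f (pt a (b + u)) (pt a b) = - trapezoid m f (pt a b) (pt a (b + u)).
  exact: tz_anti.
have D (u : R) : u + (t + t + t) = u + t + t + t by rewrite !addrA.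
rewrite /square_sum (A n.+1) (B n.+1) !D !tz_stepH !tz_stepV !(A n t) !(B n t).
move: (trapezoid n f) => T; ring.
Qed.

Definition in_square x y s z := (x <= re z <= x + s) /\ (y <= im z <= y + s).

Lemma seg_re p q z : in_segment p q z -> forall l u, l <= re p <= u -> l <= re q <= u -> l <= re z <= u.
Proof.
move=> [t /andP[t0 t1] ->] l u /andP[a b] /andP[c d].
rewrite reD reM re_rc im_rc mul0r subr0 reD reN; apply/andP; split; nra.
Qed.
Lemma seg_im p q z : in_segment p q z -> forall l u, l <= im p <= u -> l <= im q <= u -> l <= im z <= u.
Proof.
move=> [t /andP[t0 t1] ->] l u /andP[a b] /andP[c d].
rewrite imD imM re_rc im_rc mul0r addr0 imD imN; apply/andP; split; nra.
Qed.
Lemma seg_sq p q z x y s : in_square x y s p -> in_square x y s q -> in_segment p q z -> in_square x y s z.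
Proof.
by move=> [a b] [c d] h; split; [exact: (seg_re h)|exact: (seg_im h)].
Qed.

Lemma nm_ptH x y s : 0 <= s -> nm (pt (x + s) y - pt x y) = s.
Proof.
move=> s0; have -> : pt (x + s) y - pt x y = rc s.
  by apply: cC_eq; rewrite ?reD ?imD ?reN ?imN /=; ring.
by rewrite nm_rc ger0_norm.
Qed.
Lemma nm_ptV x y s : 0 <= s -> nm (pt x (y + s) - pt x y) = s.
Proof.
move=> s0; have -> : pt x (y + s) - pt x y = pt 0 1 * rc s.
  by apply: cC_eq; rewrite ?reD ?imD ?reN ?imN ?reM ?imM /=; ring.
by rewrite nmM nm_rc ger0_norm // (_ : nm (pt 0 1) = 1) ?mul1r // /nm /= expr0n expr1n add0r sqrtr1.
Qed.

Definition on_square x y s z := in_segment (pt x y) (pt (x + s) y) z \/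
  in_segment (pt (x + s) y) (pt (x + s) (y + s)) z \/
  in_segment (pt (x + s) (y + s)) (pt x (y + s)) z \/ in_segment (pt x (y + s)) (pt x y) z.

Lemma bdry_sq x y s z : 0 <= s -> on_square x y s z -> in_square x y s z.
Proof. by move=> s0 [|[|[|]]]; apply: seg_sq; split=> /=; lra. Qed.

Lemma bd_bound n f x y s M : 0 <= s -> (forall z, on_square x y s z -> nm (f z) <= M) ->
  nm (square_sum n f x y s) <= 4 * s * M.
Proof.
move=> s0 h; rewrite /square_sum.
have h1 := @tz_bound n f _ _ M (fun z hz => h z (or_introl hz)).
have h2 := @tz_bound n f _ _ M (fun z hz => h z (or_intror (or_introl hz))).
have h3 := @tz_bound n f _ _ M (fun z hz => h z (or_intror (or_intror (or_introl hz)))).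
have h4 := @tz_bound n f _ _ M (fun z hz => h z (or_intror (or_intror (or_intror hz)))).
rewrite nm_ptH // in h1; rewrite nm_ptV // in h2.
rewrite nm_sub nm_ptH // in h3; rewrite nm_sub nm_ptV // in h4.
move: h1 h2 h3 h4; set a1 := trapezoid _ _ _ _; set a2 := trapezoid _ _ _ _.
set a3 := trapezoid _ _ _ _; set a4 := trapezoid _ _ _ _ => h1 h2 h3 h4.
have := nmD (a1 + a2 + a3) a4; have := nmD (a1 + a2) a3; have := nmD a1 a2; lra.
Qed.
End Goursat.

(** * Goursat's lemma by nested squares *)

Section Cauchy.
Variable R : realType.
Local Notation C := (CC R).
Implicit Types (f g : C -> C) (p q z w a : C) (x y s t e M : R).

Lemma pow_unbounded (r M : R) : 1 < r -> exists n, M < r ^+ n.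
Proof.
move=> r1.
have B n : 1 + n%:R * (r - 1) <= r ^+ n.
  elim: n => [|n IH]; first by rewrite mul0r addr0 expr0.
  rewrite exprS -natr1; have : 0 <= n%:R * (r - 1) by rewrite mulr_ge0 //; lra.
  move: IH; set u := r ^+ n; set v := n%:R => IH h; nra.
exists (Num.bound (`|M| / (r - 1))).
have h := archi_boundP (_ : 0 <= `|M| / (r - 1)).
apply: (lt_le_trans _ (B _)); move: (Num.bound _) h => n h.
have : `|M| / (r - 1) < n%:R by apply: h; rewrite divr_ge0 //; lra.
rewrite ltr_pdivrMr; last by lra.
have := ler_norm M; lra.
Qed.


Lemma nested_reals (a b : nat -> R) : (forall k, a k <= a k.+1) ->
  (forall k, b k.+1 <= b k) -> (forall k, a k <= b k) ->
  exists x, forall k, a k <= x <= b k.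
Proof.
move=> ha hb hab.
have am j k : a j <= a (j + k)%N.
  by elim: k => [|k IH]; rewrite ?addn0 // addnS (le_trans IH).
have bm j k : b (j + k)%N <= b j.
  by elim: k => [|k IH]; rewrite ?addn0 // addnS (le_trans _ IH).
have ab j k : a j <= b k.
  by apply: (le_trans (am j k)); apply: (le_trans (hab _)); rewrite addnC.
exists (sup (range a)) => k; apply/andP; split.
  apply: sup_upper_bound; last by exists k.
  by split; [exists (a 0%N), 0%N|exists (b 0%N) => _ [j _ <-]].
by apply: ge_sup; [exists (a 0%N), 0%N|move=> _ [j _ <-]].
Qed.

Lemma bdD n f g x y s : square_sum n (fun z => f z + g z) x y s = square_sum n f x y s + square_sum n g x y s.
Proof. by rewrite /square_sum !tzD; ring. Qed.
Lemma bdZ n (k : C) f x y s : square_sum n (fun z => k * f z) x y s = k * square_sum n f x y s.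
Proof. by rewrite /square_sum !tzZ; ring. Qed.
Lemma bd_lin n (k l : C) x y s : square_sum n (fun z => k + l * z) x y s = 0.
Proof. by rewrite /square_sum !tz_lin; field. Qed.

Lemma nm_sq x y s z w : in_square x y s z -> in_square x y s w -> nm (z - w) <= 2 * s.
Proof.
move=> [/andP[a b] /andP[c d]] [/andP[a' b'] /andP[c' d']].
apply: (le_trans (nm_ReIm _)); rewrite reD reN imD imN.
have : `|re z - re w| <= s by rewrite ler_norml; apply/andP; split; lra.
have : `|im z - im w| <= s by rewrite ler_norml; apply/andP; split; lra.
lra.
Qed.

Lemma sum9_le (a b c d e' f g h i n : nat) : (a + b + c + d + e' + f + g + h + i <= n)%N ->
  [/\ (a <= n)%N, (b <= n)%N, (c <= n)%N, (d <= n)%N & (e' <= n)%N] /\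
  [/\ (f <= n)%N, (g <= n)%N, (h <= n)%N & (i <= n)%N].
Proof. by move=> H; split; split; lia. Qed.

Lemma goursat f x y s : 0 < s -> (forall z, in_square x y s z -> cdiff f z) ->
  forall e, 0 < e -> exists N, forall n, (N <= n)%N -> nm (square_sum n f x y s) <= e.
Proof.
move=> s0 df e e0; apply: contrapT => nex.
pose S k := s / 3 ^+ k.
have S0 k : 0 < S k by rewrite divr_gt0 // exprn_gt0.
have S3 k : S k = S k.+1 + S k.+1 + S k.+1.
  by rewrite /S exprS; field; rewrite expf_neq0.
(* The sum must be large for arbitrarily large depths n, since passing to a subsquare lowers the
   depth by one. *)
pose bad k (c : R * R) := forall N, exists2 n, (N <= n)%N & e / 9 ^+ k < nm (square_sum n f c.1 c.2 (S k)).
pose sub k (c c' : R * R) := [/\ c.1 <= c'.1, c'.1 + S k.+1 <= c.1 + S k,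
  c.2 <= c'.2 & c'.2 + S k.+1 <= c.2 + S k].
(* The implication under the existential lets [choice] produce a total successor function. *)
have stp (kc : nat * (R * R)) : exists c', bad kc.1 kc.2 -> bad kc.1.+1 c' /\ sub kc.1 kc.2 c'.
  case: kc => k c /=; have [bk|nb] := pselect (bad k c); last by exists c.
  apply: contrapT => nc.
  have H c' : sub k c c' -> exists N, forall n, (N <= n)%N -> nm (square_sum n f c'.1 c'.2 (S k.+1)) <= e / 9 ^+ k.+1.
    move=> sc; apply: contrapT => h; apply: nc; exists c' => _; split => // N.
    apply: contrapT => h'; apply: h; exists N => n Nn.
    rewrite leNgt; apply/negP => lt; apply: h'; by exists n.
  have t0 := S0 k.+1; set t := S k.+1 in H t0.
  have sb u v : 0 <= u <= t + t -> 0 <= v <= t + t -> sub k c (c.1 + u, c.2 + v).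
    by move=> h1 h2; rewrite /sub (S3 k) -/t /=; split; lra.
  have [N1 H1] := H _ (sb 0 0 ltac:(lra) ltac:(lra)).
  have [N2 H2] := H _ (sb t 0 ltac:(lra) ltac:(lra)).
  have [N3 H3] := H _ (sb (t + t) 0 ltac:(lra) ltac:(lra)).
  have [N4 H4] := H _ (sb 0 t ltac:(lra) ltac:(lra)).
  have [N5 H5] := H _ (sb t t ltac:(lra) ltac:(lra)).
  have [N6 H6] := H _ (sb (t + t) t ltac:(lra) ltac:(lra)).
  have [N7 H7] := H _ (sb 0 (t + t) ltac:(lra) ltac:(lra)).
  have [N8 H8] := H _ (sb t (t + t) ltac:(lra) ltac:(lra)).
  have [N9 H9] := H _ (sb (t + t) (t + t) ltac:(lra) ltac:(lra)).
  have [[//|n]] := bk (N1 + N2 + N3 + N4 + N5 + N6 + N7 + N8 + N9).+1.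
  rewrite ltnS => hn.
  have [[/H1{}H1 /H2{}H2 /H3{}H3 /H4{}H4 /H5{}H5] [/H6{}H6 /H7{}H7 /H8{}H8 /H9{}H9]] := sum9_le hn.
  rewrite (S3 k) -/t bd_step => hh; move: H1 H2 H3 H4 H5 H6 H7 H8 H9 hh.
  move: (square_sum n f) => B; rewrite /= !addr0 !addrA.
  have -> : e / 9 ^+ k = 9 * (e / 9 ^+ k.+1) by rewrite exprS; field; rewrite expf_neq0.
  move: (e / 9 ^+ k.+1) => E.
  set b1 := B _ _ _; set b2 := B _ _ _; set b3 := B _ _ _; set b4 := B _ _ _; set b5 := B _ _ _.
  set b6 := B _ _ _; set b7 := B _ _ _; set b8 := B _ _ _; set b9 := B _ _ _.
  move=> H1 H2 H3 H4 H5 H6 H7 H8 H9.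
  have := nmD (b1 + b2 + b3 + b4 + b5 + b6 + b7 + b8) b9.
  have := nmD (b1 + b2 + b3 + b4 + b5 + b6 + b7) b8.
  have := nmD (b1 + b2 + b3 + b4 + b5 + b6) b7.
  have := nmD (b1 + b2 + b3 + b4 + b5) b6.
  have := nmD (b1 + b2 + b3 + b4) b5.
  have := nmD (b1 + b2 + b3) b4.
  have := nmD (b1 + b2) b3.
  have := nmD b1 b2; lra.
have [nx hnx] := choice stp.
pose c := fix c k := if k is k'.+1 then nx (k', c k') else (x, y).
have bad0 : bad 0%N (x, y).
  move=> N; apply: contrapT => h; apply: nex; exists N => n Nn.
  rewrite leNgt; apply/negP => lt; apply: h; exists n => //.
  by rewrite /= /S !expr0 !divr1.
have badc k : bad k (c k) by elim: k => [//|k IH]; have [] := hnx (k, c k) IH.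
have subc k : sub k (c k) (c k.+1) by have [] := hnx (k, c k) (badc k).
have [X hX] : exists X, forall k, (c k).1 <= X <= (c k).1 + S k.
  apply: (@nested_reals (fun k => (c k).1) (fun k => (c k).1 + S k)) => k; [by have [] := subc k|by have [] := subc k|].
  by rewrite lerDl ltW.
have [Y hY] : exists Y, forall k, (c k).2 <= Y <= (c k).2 + S k.
  apply: (@nested_reals (fun k => (c k).2) (fun k => (c k).2 + S k)) => k; [by have [] := subc k|by have [] := subc k|].
  by rewrite lerDl ltW.
pose z0 := pt X Y.
have z0sq k : in_square (c k).1 (c k).2 (S k) z0 by split; [exact: hX|exact: hY].
have [q cq fq] : cdiff f z0.
  by apply: df; have := z0sq 0%N; rewrite /S expr0 divr1.
(* At side [S k], perimeter [4 * S k] times remainder [e' * (2 * S k)] is half of [e / 9 ^+ k]. *)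
pose e' := e / (16 * s ^+ 2).
have e'0 : 0 < e' by rewrite divr_gt0 // mulr_gt0 // exprn_gt0.
have [d d0 hd] := cq _ e'0.
have [k hk] : exists k, 2 * S k < d.
  have [k hk] := @pow_unbounded 3 (2 * s / d) ltac:(lra).
  exists k; rewrite /S mulrA ltr_pdivrMr ?exprn_gt0 //.
  by move: hk; rewrite ltr_pdivrMr //; lra.
have [n _] := badc k 0%N; rewrite ltNge => /negP; apply.
have -> : f = (fun z => (f z0 - q z0 * z0 + q z0 * z) + (q z - q z0) * (z - z0)).
  by apply/funext => z; rewrite {1}fq; ring.
rewrite bdD bd_lin add0r.
have -> : e / 9 ^+ k = 4 * S k * (e' * (2 * S k)) * 2.
  have -> : 9 ^+ k = (3 ^+ k) ^+ 2 :> R by rewrite -exprM mulnC exprM; congr (_ ^+ _); lra.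
  by rewrite /S /e'; field; rewrite expf_neq0 //= gt_eqF.
have A : nm (square_sum n (fun z => (q z - q z0) * (z - z0)) (c k).1 (c k).2 (S k)) <= 4 * S k * (e' * (2 * S k)).
  apply: bd_bound; first exact: ltW.
  move=> z /(bdry_sq (ltW (S0 k))) hz.
  have h := nm_sq hz (z0sq k); rewrite nmM ler_pM //.
  by apply/ltW/hd/(le_lt_trans h).
have : 0 <= 4 * S k * (e' * (2 * S k)) by have Sk := S0 k; apply: mulr_ge0; [lra|apply: mulr_ge0; lra].
move: A; set a := nm _; set b := 4 * _ * _; lra.
Qed.

End Cauchy.

(** * Estimates from the values on an annulus *)

Section Center.
Variable R : realType.
Local Notation C := (CC R).
Implicit Types (f g q : C -> C) (p z w a b : C) (x y s t e M : R).

(** The n-th root of the constant [c] tends to 1. Applied to powers of a function, this sharpens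
    crude bounds to exact ones. *)
Lemma pow_trick (x M c : R) : 0 <= x -> 0 <= M -> (forall n, x ^+ n <= c * M ^+ n) -> x <= M.
Proof.
move=> x0 M0 h; rewrite leNgt; apply/negP => Mx.
have [M00|Mn] := eqVneq M 0.
  by have := h 1%N; rewrite M00 expr1 expr1 mulr0; lra.
have Mp : 0 < M by rewrite lt_def Mn.
have [|n hn] := @pow_unbounded R (x / M) c; first by rewrite ltr_pdivlMr // mul1r.
have := h n; rewrite leNgt => /negP; apply.
by rewrite -ltr_pdivlMr ?exprn_gt0 // -expr_div_n.
Qed.

Lemma quot_neq f q b z : (forall w, f w = f b + q w * (w - b)) -> z != b ->
  q z = (f z - f b) / (z - b).
Proof. by move=> -> zb; rewrite addrC addKr mulfK // subr_eq0. Qed.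

Lemma nm_sub_gt0 z b : (0 < nm (z - b)) = (z != b).
Proof. by rewrite nm_gt0 subr_eq0. Qed.

Lemma quot_cdiff f q b z : (forall w, f w = f b + q w * (w - b)) -> z != b ->
  cdiff f z -> cdiff q z.
Proof.
move=> fq zb df.
apply: (@cdiff_eq _ (fun w => (f w - f b) * (w - b)^-1) q z (nm (z - b))).
- by rewrite nm_sub_gt0.
- move=> w hw; rewrite (quot_neq fq) //; apply/eqP => wb; move: hw.
  by rewrite wb nm_sub ltxx.
apply: cdiffM; first exact: cdiffBc.
by apply: cdiffV; [exact: cdiff_sub|rewrite subr_eq0].
Qed.

Lemma cts_eq f g a e : 0 < e -> (forall z, nm (z - a) < e -> f z = g z) -> cont_at f a -> cont_at g a.
Proof.
move=> e0 fg cf x /cf [d d0 hd]; exists (Num.min d e) => [|z]; first by rewrite lt_min d0.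
rewrite lt_min => /andP[h1 h2]; rewrite -!fg ?subrr ?nm0 //; exact: hd.
Qed.

Lemma quot_cts f q b z : (forall w, f w = f b + q w * (w - b)) -> z != b ->
  cont_at f z -> cont_at q z.
Proof.
move=> fq zb df.
apply: (@cts_eq (fun w => (f w - f b) * (w - b)^-1) q z (nm (z - b))).
- by rewrite nm_sub_gt0.
- move=> w hw; rewrite (quot_neq fq) //; apply/eqP => wb; move: hw.
  by rewrite wb nm_sub ltxx.
apply: contM; first by apply: (@contD _ f (fun=> - f b)) => //; exact: cont_cst.
apply: contV; first by rewrite subr_eq0.
exact/cdiff_cont/cdiff_sub.
Qed.

Lemma eq_bd n f g x y s : (forall z, on_square x y s z -> f z = g z) ->
  square_sum n f x y s = square_sum n g x y s.
Proof.
by move=> h; rewrite /square_sum; congr (_ + _ + _ + _); apply: eq_tz => z hz; apply: h; rewrite /on_square; tauto.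
Qed.

(** Eight of the nine subsquares avoid the centre, so Goursat's lemma makes each of their sums at
    most e/8; only the middle square remains. *)
Lemma ring_step q x y t e : 0 < t -> 0 < e ->
  (forall z, in_square x y (t + t + t) z -> z <> pt (x + t + t / 2) (y + t + t / 2) -> cdiff q z) ->
  exists N, forall n, (N <= n)%N ->
    nm (square_sum n.+1 q x y (t + t + t)) <= nm (square_sum n q (x + t) (y + t) t) + e.
Proof.
move=> t0 e0 dq.
have e80 : 0 < e / 8 by lra.
have H u v : 0 <= u <= t + t -> 0 <= v <= t + t ->
    (u + t < t + t / 2 \/ t + t / 2 < u) \/ (v + t < t + t / 2 \/ t + t / 2 < v) ->
    exists N, forall n, (N <= n)%N -> nm (square_sum n q (x + u) (y + v) t) <= e / 8.
  move=> hu hv hn; apply: goursat => // z [/andP[z1 z2] /andP[z3 z4]].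
  apply: dq; first by split; apply/andP; split; lra.
  by move=> zz; move: z1 z2 z3 z4; rewrite zz /=; case: hn => [[]|[]]; lra.
have [N1 H1] := H 0 0 ltac:(lra) ltac:(lra) ltac:(lra).
have [N2 H2] := H t 0 ltac:(lra) ltac:(lra) ltac:(lra).
have [N3 H3] := H (t + t) 0 ltac:(lra) ltac:(lra) ltac:(lra).
have [N4 H4] := H 0 t ltac:(lra) ltac:(lra) ltac:(lra).
have [N6 H6] := H (t + t) t ltac:(lra) ltac:(lra) ltac:(lra).
have [N7 H7] := H 0 (t + t) ltac:(lra) ltac:(lra) ltac:(lra).
have [N8 H8] := H t (t + t) ltac:(lra) ltac:(lra) ltac:(lra).
have [N9 H9] := H (t + t) (t + t) ltac:(lra) ltac:(lra) ltac:(lra).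
exists (N1 + N2 + N3 + N4 + 0 + N6 + N7 + N8 + N9)%N => n hn.
have [[/H1{}H1 /H2{}H2 /H3{}H3 /H4{}H4 _] [/H6{}H6 /H7{}H7 /H8{}H8 /H9{}H9]] := sum9_le hn.
rewrite bd_step; move: H1 H2 H3 H4 H6 H7 H8 H9; move: (square_sum n q) => B.
rewrite !addr0 !addrA.
set b1 := B _ _ _; set b2 := B _ _ _; set b3 := B _ _ _; set b4 := B _ _ _.
set b6 := B _ _ _; set b7 := B _ _ _; set b8 := B _ _ _; set b9 := B _ _ _; set b5 := B _ _ _.
move=> H1 H2 H3 H4 H6 H7 H8 H9.
have := nmD (b1 + b2 + b3 + b4 + b5 + b6 + b7 + b8) b9.
have := nmD (b1 + b2 + b3 + b4 + b5 + b6 + b7) b8.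
have := nmD (b1 + b2 + b3 + b4 + b5 + b6) b7.
have := nmD (b1 + b2 + b3 + b4 + b5) b6.
have := nmD (b1 + b2 + b3 + b4) b5.
have := nmD (b1 + b2 + b3) b4.
have := nmD (b1 + b2) b3.
have := nmD b1 b2; lra.
Qed.

Definition centered_sum n q a s := square_sum n q (re a - s / 2) (im a - s / 2) s.

Lemma bdc_ring q a s B k : 0 < s ->
  (forall z, in_square (re a - s / 2) (im a - s / 2) s z -> z <> a -> cdiff q z) ->
  (exists N, forall n, (N <= n)%N -> nm (centered_sum n q a (s / 3 ^+ k)) <= B) ->
  forall e, 0 < e -> exists N, forall n, (N <= n)%N -> nm (centered_sum n q a s) <= B + e.
Proof.
move=> s0 dq; elim: k B => [|k IH] B [N hN] e e0.
  by exists N => n /hN; rewrite expr0 divr1; lra.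
have -> : B + e = (B + e / 2) + e / 2 by field.
apply: IH; last by lra.
set t := s / 3 ^+ k.+1 in hN.
have t3 : s / 3 ^+ k = t + t + t by rewrite /t exprS; field; rewrite expf_neq0.
have t0 : 0 < t by rewrite divr_gt0 // exprn_gt0.
have ts : t + t + t <= s.
  by rewrite -t3 ler_pdivrMr ?exprn_gt0 // ler_peMr ?(ltW s0) // exprn_ege1 //; lra.
have [|z hz za|M hM] := @ring_step q (re a - (t + t + t) / 2) (im a - (t + t + t) / 2) t (e / 2) t0.
- by lra.
- apply: dq.
    by case: hz => /andP[z1 z2] /andP[z3 z4]; split; apply/andP; split; lra.
  by move=> zz; apply: za; rewrite zz; apply: cC_eq => /=; field.
exists (N + M).+1 => -[//|n]; rewrite ltnS => hn.
have := hM n ltac:(lia); have := hN n ltac:(lia); rewrite /centered_sum t3.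
have -> : re a - (t + t + t) / 2 + t = re a - t / 2 by field.
have -> : im a - (t + t + t) / 2 + t = im a - t / 2 by field.
by set A := nm _; set D := nm _; lra.
Qed.

Lemma sq_center a s z : 0 < s -> in_square (re a - s / 2) (im a - s / 2) s z -> nm (z - a) <= s.
Proof.
move=> s0 [/andP[z1 z2] /andP[z3 z4]]; apply: (le_trans (nm_ReIm _)).
rewrite reD reN imD imN.
have : `|re z - re a| <= s / 2 by rewrite ler_norml; apply/andP; split; lra.
have : `|im z - im a| <= s / 2 by rewrite ler_norml; apply/andP; split; lra.
lra.
Qed.

(** Goursat's lemma with a centre at which [q] is merely continuous: shrink to a middle square so
    small that its perimeter times a local bound of [q] is at most e/2. *)
Lemma bdc_small q a s e : 0 < s -> 0 < e ->
  (forall z, in_square (re a - s / 2) (im a - s / 2) s z -> z <> a -> cdiff q z) ->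
  cont_at q a -> exists N, forall n, (N <= n)%N -> nm (centered_sum n q a s) <= e.
Proof.
move=> s0 e0 dq cq.
have [d d0 hd] := cq 1 ltr01.
pose B := nm (q a) + 1; have B0 : 0 < B by rewrite /B; have := nm_ge0 (q a); lra.
have m0 : 0 < Num.min d (e / (8 * B)) by rewrite lt_min d0 divr_gt0 //; lra.
have [k hk] := @pow_unbounded R 3 (s / Num.min d (e / (8 * B))) ltac:(lra).
rewrite ltr_pdivrMr // mulrC -ltr_pdivrMr ?exprn_gt0 // lt_min in hk.
have s'0 : 0 < s / 3 ^+ k by rewrite divr_gt0 // exprn_gt0.
have -> : e = e / 2 + e / 2 by field.
apply: (@bdc_ring q a s _ k) => //; last by lra.
exists 0%N => n _; move: hk s'0; set t := s / _ => /andP[td tB] t0.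
have : nm (centered_sum n q a t) <= 4 * t * B.
  apply: bd_bound; first exact: ltW.
  move=> z /(bdry_sq (ltW t0)) /(sq_center t0) hz.
  have := hd z (le_lt_trans hz td); have := nm_lesub (q z) (q a); rewrite /B; lra.
move=> /le_trans; apply.
by move: tB; rewrite ltr_pdivlMr; [lra|lra].
Qed.

Lemma invpt x y : (pt x y)^-1 = pt (x / (x ^+ 2 + y ^+ 2)) (- y / (x ^+ 2 + y ^+ 2)) :> C.
Proof. by rewrite mulNr. Qed.

Lemma im_quot p z : z != 0 -> im (p * z^-1) =
  (im p * re z - re p * im z) / (re z ^+ 2 + im z ^+ 2).
Proof. by case: z p => x y [u v] _; rewrite imM (invpt x y) /=; ring. Qed.

(** A discrete winding number, 4 standing for 2 pi. On each side the imaginary part of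
    [(q - p) / (z - a)] is [s ^+ 2 / 2] divided by the squared distance to [a], and that squared
    distance is at most [s ^+ 2 / 2]. *)
Lemma kernel_im n a s : 0 < s -> 4 <= im (centered_sum n (fun z => (z - a)^-1) a s).
Proof.
move=> s0; rewrite /centered_sum /square_sum !imD.
have H (p q0 : C) : (forall z, in_segment p q0 z ->
    [/\ `|re (z - a)| <= s / 2, `|im (z - a)| <= s / 2, z != a &
     s ^+ 2 / 2 = im (q0 - p) * re (z - a) - re (q0 - p) * im (z - a)]) ->
    1 <= im (trapezoid n (fun z => (z - a)^-1) p q0).
  move=> h; apply: tz_im => z /h [hx hy za E].
  rewrite im_quot ?subr_eq0 // -E.
  have nz : 0 < re (z - a) ^+ 2 + im (z - a) ^+ 2.
    by rewrite -nm_sqr exprn_gt0 // nm_sub_gt0.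
  rewrite ler_pdivlMr // mul1r -(real_normK (num_real (re _))) -(real_normK (num_real (im _))).
  have := normr_ge0 (re (z - a)); have := normr_ge0 (im (z - a)); nra.
have nza z : re z != re a \/ im z != im a -> z != a.
  by case => /eqP h; apply/eqP => za; apply: h; rewrite za.
have h1 : 1 <= im (trapezoid n (fun z => (z - a)^-1) (pt (re a - s / 2) (im a - s / 2))
  (pt (re a - s / 2 + s) (im a - s / 2))).
  apply: H => z [t /andP[t0 t1] ->]; rewrite !(reD, imD, reN, imN, reM, imM) /=; split.
  - by rewrite ler_norml; apply/andP; split; nra.
  - by rewrite ler_norml; apply/andP; split; nra.
  - by apply: nza; right; rewrite !(imD, imM, imN) /=; apply/eqP; nra.
  - by field.
have h2 : 1 <= im (trapezoid n (fun z => (z - a)^-1) (pt (re a - s / 2 + s) (im a - s / 2))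
  (pt (re a - s / 2 + s) (im a - s / 2 + s))).
  apply: H => z [t /andP[t0 t1] ->]; rewrite !(reD, imD, reN, imN, reM, imM) /=; split.
  - by rewrite ler_norml; apply/andP; split; nra.
  - by rewrite ler_norml; apply/andP; split; nra.
  - by apply: nza; left; rewrite !(reD, reM, reN) /=; apply/eqP; nra.
  - by field.
have h3 : 1 <= im (trapezoid n (fun z => (z - a)^-1) (pt (re a - s / 2 + s) (im a - s / 2 + s))
  (pt (re a - s / 2) (im a - s / 2 + s))).
  apply: H => z [t /andP[t0 t1] ->]; rewrite !(reD, imD, reN, imN, reM, imM) /=; split.
  - by rewrite ler_norml; apply/andP; split; nra.
  - by rewrite ler_norml; apply/andP; split; nra.
  - by apply: nza; right; rewrite !(imD, imM, imN) /=; apply/eqP; nra.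
  - by field.
have h4 : 1 <= im (trapezoid n (fun z => (z - a)^-1) (pt (re a - s / 2) (im a - s / 2 + s))
  (pt (re a - s / 2) (im a - s / 2))).
  apply: H => z [t /andP[t0 t1] ->]; rewrite !(reD, imD, reN, imN, reM, imM) /=; split.
  - by rewrite ler_norml; apply/andP; split; nra.
  - by rewrite ler_norml; apply/andP; split; nra.
  - by apply: nza; left; rewrite !(reD, reM, reN) /=; apply/eqP; nra.
  - by field.
lra.
Qed.

Lemma bdry_far a s z : 0 < s -> on_square (re a - s / 2) (im a - s / 2) s z -> s / 2 <= nm (z - a).
Proof.
move=> s0 h.
have : s / 2 <= `|re (z - a)| \/ s / 2 <= `|im (z - a)|.
  case: h => [|[|[|]]] [t /andP[t0 t1] ->]; rewrite !(reD, imD, reN, imN, reM, imM) /= !ler_normr.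
  - by right; apply/orP; right; nra.
  - by left; apply/orP; left; nra.
  - by right; apply/orP; left; nra.
  - by left; apply/orP; right; nra.
by case=> /le_trans; apply; [exact: nm_re|exact: nm_im].
Qed.

(** Cauchy's formula as an inequality. The sums of (f z - f a) / (z - a) over the square of side 2 s
    tend to 0, so [nm (f a)] times the winding sum, at least 4, is at most the sum of f z / (z - a),
    at most 8 M. The square's boundary lies in the annulus of radii s and 2 s. *)
Lemma center_crude f a s M : 0 < s -> 0 <= M ->
  (forall z, nm (z - a) <= 2 * s -> cdiff f z) ->
  (forall z, s <= nm (z - a) <= 2 * s -> nm (f z) <= M) -> nm (f a) <= 2 * M.
Proof.
move=> s0 M0 df hM.
have [q cq fq] : cdiff f a by apply: df; rewrite subrr nm0; lra.
have s20 : 0 < 2 * s by lra.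
have bn z : on_square (re a - 2 * s / 2) (im a - 2 * s / 2) (2 * s) z -> s <= nm (z - a) <= 2 * s.
  move=> hz; have := bdry_far s20 hz; have := sq_center s20 (bdry_sq (ltW s20) hz).
  by move=> h1 h2; apply/andP; split; lra.
suff : forall e, 0 < e -> 4 * nm (f a) <= 8 * M + e.
  move=> h; rewrite leNgt; apply/negP => lt.
  have := h (2 * (nm (f a) - 2 * M)) ltac:(lra); lra.
move=> e e0.
have [z hz /eqP za|N hN] := @bdc_small q a (2 * s) e s20 e0 _ cq.
  by apply: (quot_cdiff fq za); apply: df; exact: sq_center.
have := hN N (leqnn N).
have Kim := kernel_im N a s20.
have -> : centered_sum N q a (2 * s) = centered_sum N (fun z => f z * (z - a)^-1) a (2 * s) + (- f a) * centered_sum N (fun z => (z - a)^-1) a (2 * s).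
  rewrite /centered_sum -bdZ -bdD; apply: eq_bd => z /bn /andP[hz _].
  by rewrite (quot_neq fq) ?mulrDl // -nm_sub_gt0; lra.
set A := centered_sum N (fun z => f z * _) _ _; set K := centered_sum N _ _ _ => h.
have hA : nm A <= 4 * (2 * s) * (M / s).
  apply: bd_bound; first exact: ltW.
  move=> z /bn /[dup] hz /andP[h1 h2].
  rewrite nmM nmV ler_pM ?invr_ge0 // ?hM // lef_pV2 ?posrE //; lra.
have hK : 4 <= nm K by apply: (le_trans Kim); apply: (le_trans _ (nm_im K)); exact: ler_norm.
have e1 : 4 * (2 * s) * (M / s) = 8 * M by field; lra.
have := nm_lesub (- f a * K) (- A); rewrite opprK nmN nmM nmN.
have := nm_ge0 (f a); rewrite [_ + A]addrC; nra.
Qed.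

Lemma center_est f a s M : 0 < s -> 0 <= M ->
  (forall z, nm (z - a) <= 2 * s -> cdiff f z) ->
  (forall z, s <= nm (z - a) <= 2 * s -> nm (f z) <= M) -> nm (f a) <= M.
Proof.
move=> s0 M0 df hM; apply: (@pow_trick _ _ 2) => // n.
rewrite -nmX; apply: (@center_crude (fun z => f z ^+ n) a s) => //.
- by rewrite exprn_ge0.
- by move=> z /df; exact: cdiffX.
- by move=> z /hM h; rewrite nmX lerXn2r ?nnegrE.
Qed.

Lemma layer_est f a r M : 0 < r ->
  (forall z, nm (z - a) <= r -> cdiff f z) ->
  (forall z, r / 5 <= nm (z - a) <= r -> nm (f z) <= M) ->
  forall w, nm (w - a) <= r -> nm (f w) <= M.
Proof.
move=> r0 df hM w wr; have [wr5|wr5] := lerP (r / 5) (nm (w - a)).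
  by apply: hM; rewrite wr5.
(* A point w with |w - a| < r/5 is the centre of the annulus of radii 2r/5 and 4r/5, which stays
   inside the annulus of radii r/5 and r about a. *)
have inl z : 2 * r / 5 <= nm (z - w) <= 2 * (2 * r / 5) -> r / 5 <= nm (z - a) <= r.
  move=> /andP[h1 h2]; have := nm_tri w z a; have := nm_tri a z w.
  by rewrite (nm_sub a w) => h3 h4; apply/andP; split; lra.
apply: (@center_est f w (2 * r / 5)); first by lra.
- apply: (le_trans (nm_ge0 (f (a + rc r)))); apply: hM.
  rewrite addrC addKr nm_rc gtr0_norm //; lra.
- by move=> z hz; apply: df; have := nm_tri w z a; lra.
- by move=> z /inl; exact: hM.
Qed.

Lemma ball_infinite w e (s : seq C) : 0 < e -> exists2 z, nm (z - w) < e & z \notin s.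
Proof.
move=> e0; apply: contrapT => h.
pose F (k : nat) : C := w + rc (e / (k.+2)%:R).
have Finj : injective F.
  move=> j k /addrI /complexI /(mulfI (lt0r_neq0 e0)) /invr_inj /eqP.
  by rewrite eqr_nat => /eqP [].
have : (size (map F (iota 0 (size s).+1)) <= size s)%N.
  apply: uniq_leq_size; first by rewrite map_inj_uniq ?iota_uniq.
  move=> _ /mapP[k _ ->]; apply/negPn/negP => hk; apply: h; exists (F k) => //.
  rewrite /F addrC addKr nm_rc ger0_norm; last by rewrite divr_ge0 // ltW.
  by rewrite ltr_pdivrMr // ltr_pMr // ltr1n.
by rewrite size_map size_iota ltnn.
Qed.

Lemma nm_prod (s : seq C) z : nm (\prod_(p <- s) (z - p)) = \prod_(p <- s) nm (z - p).
Proof.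
by elim: s => [|p s IH]; rewrite ?big_nil ?nm1 // !big_cons nmM IH.
Qed.

Lemma prod_sub_neq0 (s : seq C) z : z \notin s -> \prod_(p <- s) (z - p) != 0.
Proof.
elim: s => [|p s IH]; first by rewrite big_nil oner_neq0.
rewrite in_cons negb_or => /andP[zp /IH zs].
by rewrite big_cons mulf_neq0 // subr_eq0.
Qed.

(** Multiplying [f ^+ n] by a polynomial vanishing on [s] restores differentiability there. The
    polynomial is the same for all n, so [pow_trick] removes its contribution; the points of [s]
    themselves follow by continuity. *)
Lemma layer_est_except f a r M (s : seq C) : 0 < r ->
  (forall z, nm (z - a) <= r -> cont_at f z) ->
  (forall z, nm (z - a) <= r -> z \notin s -> cdiff f z) ->
  (forall z, r / 5 <= nm (z - a) <= r -> nm (f z) <= M) ->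
  forall w, nm (w - a) <= r -> nm (f w) <= M.
Proof.
move=> r0 cf df hM.
have M0 : 0 <= M.
  apply: (le_trans (nm_ge0 (f (a + rc r)))); apply: hM.
  rewrite addrC addKr nm_rc gtr0_norm //; lra.
have H w : nm (w - a) <= r -> w \notin s -> nm (f w) <= M.
  move=> wr ws.
  pose D := \prod_(p <- s) (r + nm (a - p)).
  pose P z : C := \prod_(p <- s) (z - p).
  have nmP z : nm (P z) = \prod_(p <- s) nm (z - p).
    exact: nm_prod.
  have Pw : 0 < nm (P w).
    by rewrite nm_gt0 prod_sub_neq0.
  apply: (@pow_trick _ _ (D / nm (P w))) => // n.
  rewrite mulrAC ler_pdivlMr // -nmX -nmM [_ * P w]mulrC.
  apply: (@layer_est (fun z => P z * f z ^+ n) a r) => //.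
    move=> z zr; have [zs|zs] := boolP (z \in s); last first.
      by apply: cdiffM; [apply: cdiff_prod => p; exact: cdiff_sub|exact/cdiffX/df].
    (* At a point of [s] the product vanishes, and its difference quotient is [Q], which is
       continuous because [f] is. *)
    pose Q w : C := (\prod_(p <- rem z s) (w - p)) * f w ^+ n.
    have E w' : P w' * f w' ^+ n = Q w' * (w' - z).
      by rewrite /P /Q (big_rem z zs) /=; ring.
    exists Q => [|w']; last by rewrite !E subrr mulr0 add0r.
    apply: contM; first by apply/cdiff_cont/cdiff_prod => p; exact: cdiff_sub.
    by elim: n {E Q} => [|n IH]; [exact: cont_cst|under eq_fun do rewrite exprS; apply: contM => //; exact: cf].
  move=> z hz; rewrite nmM nmX ler_pM ?exprn_ge0 //.
    rewrite nmP /D; case/andP: hz => _ hz; apply: ler_prod => p _.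
    by rewrite nm_ge0 /=; have := nm_tri a z p; lra.
  by rewrite lerXn2r ?nnegrE // hM.
move=> w wr; have [wr5|wr5] := lerP (r / 5) (nm (w - a)); first by apply: hM; rewrite wr5.
rewrite leNgt; apply/negP => lt.
have [d d0 hd] := cf w wr (nm (f w) - M) ltac:(lra).
have [z] := @ball_infinite w (Num.min d (r / 2)) s ltac:(by rewrite lt_min d0; lra).
rewrite lt_min => /andP[zd zr] zs.
have := H z; have := nm_tri w z a; have := hd z zd.
have := nm_lesub (f w) (f z); rewrite nm_sub => h1 h2 h3 h4.
have := h4 ltac:(lra) zs; lra.
Qed.

End Center.

(** * Compactness in the complex plane *)

Section Compactness.
Variable R : realType.
Local Notation C := (CC R).
Implicit Types (f g q : C -> C) (z w a b : C) (x y r s t e M : R).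

Lemma compact_cball a r : compact [set z : C | nm (z - a) <= r].
Proof.
pose F (p : R * R) : C := pt p.1 p.2.
have cF : continuous F.
  move=> [x y] A /nbhsCP [e e0 he].
  apply/nbhs_ballP; exists (e / 2) => /=; first by lra.
  move=> [u v] [/= hu hv]; apply: he; apply: (le_lt_trans (nm_ReIm _)).
  by rewrite reD reN imD imN /= distrC (distrC v); move: hu hv; rewrite /ball /=; lra.
apply: (@subclosed_compact _ _ (F @` (`[re a - r, re a + r] `*` `[im a - r, im a + r]))).
- rewrite closedE /= => z hz; apply: contrapT => /negP; rewrite -ltNge => lt.
  apply: hz; apply/nbhsCP; exists (nm (z - a) - r) => [|w]; first by lra.
  move=> hw /= hwa; have := nm_tri w z a; rewrite nm_sub in hw; lra.
- apply: continuous_compact; first exact: continuous_subspaceT.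
  by apply: compact_setX; exact: segment_compact.
- move=> z /= hz; exists (re z, im z); last by case: z {hz}.
  have := nm_re (z - a); have := nm_im (z - a); rewrite reD imD reN imN !ler_norml.
  move=> /andP[h1 h2] /andP[h3 h4].
  by split; rewrite /= in_itv /=; apply/andP; split; lra.
Qed.

Lemma compact_unif (K : set C) (P : nat -> C -> Prop) : compact K ->
  (forall z, K z -> exists N, exists2 d, 0 < d &
     forall n w, (N <= n)%N -> nm (w - z) < d -> P n w) ->
  exists N, forall n, (N <= n)%N -> forall z, K z -> P n z.
Proof.
move=> /compact_near_coveringP cK h.
have [|N _ hN] := cK nat \oo P _ _.
  move=> z /h [N [d d0 hd]].
  exists ([set w | nm (w - z) < d], [set n | (N <= n)%N]).
    by split; [apply/nbhsCP; exists d|exists N].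
  by move=> [w n] [/= h1 h2]; exact: hd.
by exists N => n nN; exact: (hN n nN).
Qed.

Lemma nat_above x : exists n : nat, x <= n%:R.
Proof.
exists (Num.bound `|x|); apply/ltW/(le_lt_trans (ler_norm x)).
exact: archi_boundP.
Qed.

Lemma compact_bounded_fun (K : set C) f : compact K -> (forall z, K z -> cont_at f z) ->
  exists2 M, 0 < M & forall z, K z -> nm (f z) <= M.
Proof.
move=> cK cf.
have [|N hN] := @compact_unif K (fun n z => nm (f z) <= n%:R) cK.
  move=> z /cf /(_ 1 ltr01) [d d0 hd]; have [N hN] := nat_above (nm (f z) + 1).
  exists N, d => // n w; rewrite -(ler_nat R) => nN /hd.
  have := nm_lesub (f w) (f z); lra.
exists (N%:R + 1) => [|z Kz]; first by rewrite ltr_wpDl.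
by have := hN N (leqnn N) z Kz; lra.
Qed.

Lemma inv_small e : 0 < e -> exists N : nat, forall n, (N <= n)%N -> n.+1%:R^-1 < e.
Proof.
move=> e0; have [N hN] := nat_above e^-1.
exists N => n nN; rewrite invf_plt ?posrE //.
by apply: (le_lt_trans hN); rewrite ltr_nat ltnS.
Qed.

Lemma compact_max_modulus (K : set C) f : compact K -> K !=set0 ->
  (forall z, K z -> cont_at f z) ->
  exists2 z0, K z0 & forall z, K z -> nm (f z) <= nm (f z0).
Proof.
move=> cK [k0 Kk0] cf; have [B B0 hB] := compact_bounded_fun cK cf.
pose A := [set nm (f z) | z in K]; pose S := sup A.
have hA : has_sup A by split; [exists (nm (f k0)), k0|exists B => _ [z Kz <-]; exact: hB].
have AS z : K z -> nm (f z) <= S.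
  by move=> Kz; apply: sup_upper_bound => //; exists z.
have leS x : (forall z, K z -> nm (f z) <= x) -> S <= x.
  by move=> hx; apply: ge_sup; [exists (nm (f k0)), k0|move=> _ [z Kz <-]; exact: hx].
clearbody S; apply: contrapT => h.
have lt z : K z -> nm (f z) < S.
  move=> Kz; rewrite ltNge; apply/negP => Sz; apply: h; exists z => // w /AS; lra.
have [|N hN] := @compact_unif K (fun n z => nm (f z) <= S - n.+1%:R^-1) cK.
  move=> z Kz; have g0 : 0 < (S - nm (f z)) / 2 by rewrite divr_gt0 // subr_gt0 lt.
  have [d d0 hd] := cf z Kz _ g0; have [N hN] := inv_small g0.
  exists N, d => // n w /hN + /hd; have := nm_lesub (f w) (f z); move: (n.+1%:R^-1) => i; lra.
have : S <= S - N.+1%:R^-1.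
  by apply: leS; exact: hN.
have : 0 < N.+1%:R^-1 :> R by rewrite invr_gt0.
move: (N.+1%:R^-1) => i.
lra.
Qed.

Lemma closureCP (V : set C) z : closure V z <->
  forall e, 0 < e -> exists2 w, V w & nm (w - z) < e.
Proof.
split => h.
  move=> e e0; have [|w [Vw hw]] := h [set w | nm (w - z) < e]; first by apply/nbhsCP; exists e.
  by exists w.
move=> A /nbhsCP [e e0 he]; have [w Vw hw] := h e e0; exists w; split => //.
exact: he.
Qed.

Lemma closedCP (V : set C) : (forall z, (forall e, 0 < e -> exists2 w, V w & nm (w - z) < e) -> V z) ->
  closed V.
Proof. by move=> h z /closureCP /h. Qed.

Definition nbounded (V : set C) := exists B, forall z, V z -> nm z <= B.

Lemma closure_nbounded V : nbounded V -> nbounded (closure V).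
Proof.
move=> [B hB]; exists (B + 1) => z /closureCP /(_ 1 ltr01) [w /hB h1 h2].
have := nm_lesub z w; rewrite nm_sub in h2; lra.
Qed.

Lemma closed_nbounded_compact V : closed V -> nbounded V -> compact V.
Proof.
move=> cV [B hB]; apply: (@subclosed_compact _ _ [set z | nm (z - 0) <= B]) => //.
- exact: compact_cball.
- by move=> z /= /hB; rewrite subr0.
Qed.

Lemma closure_compact V : nbounded V -> compact (closure V).
Proof.
by move=> /closure_nbounded bV; apply: closed_nbounded_compact => //; exact: closed_closure.
Qed.

Definition frontier (V : set C) : set C := closure V `\` V.

Lemma fr_compact V : open V -> nbounded V -> compact (frontier V).
Proof.
move=> oV bV; apply: (subclosed_compact _ (closure_compact bV)); last by move=> z [].
by rewrite /frontier setDE; apply: closedI; [exact: closed_closure|exact: open_closedC].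
Qed.

Lemma real_cauchy (u : nat -> R) :
  (forall e, 0 < e -> exists N, forall m n, (N <= m)%N -> (N <= n)%N -> `|u m - u n| <= e) ->
  exists l, forall e, 0 < e -> exists N, forall n, (N <= n)%N -> `|u n - l| <= e.
Proof.
(* The limit is the supremum of the eventual lower bounds of the sequence. *)
move=> hu; pose A := [set x | exists N, forall n, (N <= n)%N -> x <= u n].
have hN e : 0 < e -> exists N, [/\ A (u N - e), forall x, A x -> x <= u N + e &
    forall n, (N <= n)%N -> `|u n - u N| <= e].
  move=> /hu [N hN]; exists N; split => [|x [M hM]|n nN]; last exact: hN.
    by exists N => n nN; have := hN n N nN (leqnn N); rewrite ler_norml; lra.
  have := hM (maxn M N) (leq_maxl _ _); have := hN (maxn M N) N (leq_maxr _ _) (leqnn N).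
  rewrite ler_norml; lra.
exists (sup A) => e e0; have [|N [h1 h2 h3]] := hN (e / 2); first by lra.
exists N => n /h3; have hl : u N - e / 2 <= sup A.
  by apply: sup_upper_bound => //; split; [exists (u N - e / 2)|exists (u N + e / 2) => x /h2].
have hr : sup A <= u N + e / 2 by apply: ge_sup; [exists (u N - e / 2)|].
by rewrite !ler_norml => /andP[h4 h5]; apply/andP; split; lra.
Qed.

Lemma complex_cauchy (u : nat -> C) :
  (forall e, 0 < e -> exists N, forall m n, (N <= m)%N -> (N <= n)%N -> nm (u m - u n) <= e) ->
  exists l, forall e, 0 < e -> exists N, forall n, (N <= n)%N -> nm (u n - l) <= e.
Proof.
move=> hu.
have [|x hx] := @real_cauchy (fun n => re (u n)).
  move=> e /hu [N hN]; exists N => m n hm hn.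
  by have := nm_re (u m - u n); rewrite reD reN; move=> /le_trans; apply; exact: hN.
have [|y hy] := @real_cauchy (fun n => im (u n)).
  move=> e /hu [N hN]; exists N => m n hm hn.
  by have := nm_im (u m - u n); rewrite imD imN; move=> /le_trans; apply; exact: hN.
exists (pt x y) => e e0.
have [|N hN] := hx (e / 2); first by lra.
have [|N' hN'] := hy (e / 2); first by lra.
exists (maxn N N') => n; rewrite geq_max => /andP[/hN h1 /hN' h2].
by apply: (le_trans (nm_ReIm _)); rewrite reD reN imD imN /=; lra.
Qed.

End Compactness.

(** * Removable singularities and uniform limits *)

Section Removable.
Variable R : realType.
Local Notation C := (CC R).
Implicit Types (f g q h u : C -> C) (z w a b : C) (x y r s t e M : R).

Lemma punctured_limit (phi : C -> C) a :
  (forall e, 0 < e -> exists2 d, 0 < d & forall b b', 0 < nm (b - a) < d ->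
    0 < nm (b' - a) < d -> nm (phi b - phi b') <= e) ->
  exists l, forall e, 0 < e -> exists2 d, 0 < d & forall b, 0 < nm (b - a) < d ->
    nm (phi b - l) <= e.
Proof.
move=> h; pose u n : C := a + rc (n.+1%:R^-1).
have hu n : nm (u n - a) = n.+1%:R^-1.
  by rewrite /u addrC addKr nm_rc ger0_norm // invr_ge0.
have hu0 n : 0 < nm (u n - a) by rewrite hu invr_gt0.
have [|l hl] := @complex_cauchy R (fun n => phi (u n)).
  move=> e /h [d d0 hd]; have [N hN] := inv_small d0.
  by exists N => m n /hN hm /hN hn; apply: hd; rewrite hu0 hu.
exists l => e e0; have [|d d0 hd] := h (e / 2); first by lra.
exists d => // b hb; have [|N hN] := hl (e / 2); first by lra.
have [N' hN'] := inv_small d0.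
have h1 := hN (maxn N N') (leq_maxl _ _).
have h2 : nm (phi b - phi (u (maxn N N'))) <= e / 2.
  by apply: hd => //; rewrite hu0 hu hN' // leq_maxr.
have := nm_tri (phi (u (maxn N N'))) (phi b) l; lra.
Qed.

Lemma cdiff_of_limit g a l :
  (forall e, 0 < e -> exists2 d, 0 < d & forall b, 0 < nm (b - a) < d ->
    nm ((g b - g a) / (b - a) - l) <= e) -> cdiff g a.
Proof.
move=> h; exists (fun z => if z == a then l else (g z - g a) / (z - a)) => [|z]; last first.
  case: eqP => [->|/eqP za]; first by rewrite subrr mulr0 addr0.
  by rewrite divfK ?subr_eq0 // addrC subrK.
move=> e e0; have [|d d0 hd] := h (e / 2); first by lra.
exists d => // z hz; rewrite eqxx; case: eqP => [_|/eqP za]; first by rewrite subrr nm0.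
by have := hd z; rewrite hz nm_sub_gt0 za => /(_ isT); lra.
Qed.

Lemma cball_bounded f a r : (forall z, nm (z - a) <= r -> cont_at f z) ->
  exists2 M, 0 < M & forall z, nm (z - a) <= r -> nm (f z) <= M.
Proof. by move=> cf; exact: compact_bounded_fun (@compact_cball R a r) cf. Qed.

(* The difference quotients based at nearby points b are uniformly close to each
   other away from a, hence also at a, where they are the quotients of g. *)
Lemma removable g a r : 0 < r -> cont_at g a ->
  (forall z, 0 < nm (z - a) <= r -> cdiff g z) -> cdiff g a.
Proof.
move=> r0 cga dg.
have cg z : nm (z - a) <= r -> cont_at g z.
  have [->//|za zr] := eqVneq z a; apply/cdiff_cont/dg.
  by rewrite nm_sub_gt0 za.
have [M M0 hM] := cball_bounded cg.
have [|l hl] := @punctured_limit (fun b => (g b - g a) / (b - a)) a; last first.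
  exact: (cdiff_of_limit hl).
move=> e e0.
have er1 : 0 < e * r by rewrite mulr_gt0.
(* For z on the annulus, |z - c| |z - a| is at least r^2 / 50. The constants [om] and [d2] make each
   of the two terms of the numerator at most e r^2 / 200. *)
pose om := e * r / 200; have om0 : 0 < om by rewrite /om; lra.
have [d1 d10 hd1] := cga om om0.
have er : 0 < e * r ^+ 2 by rewrite mulr_gt0 ?exprn_gt0.
pose d2 := e * r ^+ 2 / 400 / M; have d20 : 0 < d2 by apply: divr_gt0; [lra|exact: M0].
pose d := Num.min d1 (Num.min d2 (r / 10)).
have d0 : 0 < d by rewrite !lt_min d10 d20 divr_gt0.
exists d => // b b' /andP[b0 b_lt] /andP[b'0 b'd].
have near c q : 0 < nm (c - a) -> nm (c - a) < d ->
    (forall z, g z = g c + q z * (z - c)) ->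
    forall z, r / 5 <= nm (z - a) <= r -> nm (q z - (g z - g a) / (z - a)) <= e / 2.
  move=> c0 cd gq z /andP[z1 z2].
  move: cd; rewrite !lt_min => /andP[cd1 /andP[cd2 cd3]].
  have zc : r / 10 <= nm (z - c) by have := nm_tri c z a; lra.
  have zc0 : z - c != 0 by rewrite -nm_gt0; lra.
  have za0 : z - a != 0 by rewrite -nm_gt0; lra.
  have zc' : z != c by rewrite -subr_eq0.
  rewrite (quot_neq gq zc').
  have -> : (g z - g c) / (z - c) - (g z - g a) / (z - a) =
     ((g z - g a) * (c - a) + (g a - g c) * (z - a)) / ((z - c) * (z - a)).
    by field; rewrite zc0 za0.
  rewrite nmM nmV ler_pdivrMr ?nm_gt0 ?mulf_neq0 // nmM.
  apply: (le_trans (nmD _ _)); rewrite !nmM.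
  have h1 : nm (g z - g a) <= 2 * M.
    have := nmB (g z) (g a); have := hM z z2; have := hM a; rewrite subrr nm0 => /(_ (ltW r0)); lra.
  have h2 : nm (g a - g c) <= om by rewrite nm_sub; exact/ltW/hd1.
  have h3 : nm (g z - g a) * nm (c - a) <= e * r ^+ 2 / 200.
    have -> : e * r ^+ 2 / 200 = 2 * M * d2 by rewrite /d2; field; rewrite gt_eqF.
    by rewrite ler_pM // ltW.
  have h4 : nm (g a - g c) * nm (z - a) <= e * r ^+ 2 / 200.
    have -> : e * r ^+ 2 / 200 = om * r by rewrite /om; field.
    by rewrite ler_pM.
  have h5 : r / 10 * (r / 5) <= nm (z - c) * nm (z - a).
    by rewrite ler_pM //; lra.
  have : e / 2 * (r / 10 * (r / 5)) <= e / 2 * (nm (z - c) * nm (z - a)).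
    by rewrite ler_wpM2l //; lra.
  have -> : e / 2 * (r / 10 * (r / 5)) = e * r ^+ 2 / 200 + e * r ^+ 2 / 200 by field.
  move: h3 h4; set A := nm _ * _; set B := nm _ * _; lra.
have [q cq gq] : cdiff g b by apply: dg; move: b_lt; rewrite !lt_min; lra.
have [q' cq' gq'] : cdiff g b' by apply: dg; move: b'd; rewrite !lt_min; lra.
have ctsq c p : cont_at p c -> (forall z, g z = g c + p z * (z - c)) ->
    forall z, nm (z - a) <= r -> cont_at p z.
  move=> cp gp z zr; have [->//|zc] := eqVneq z c.
  exact: (quot_cts gp zc (cg z zr)).
have := @layer_est_except R (fun z => q z - q' z) a r e [:: a; b; b'] r0.
have qa c p : 0 < nm (c - a) -> (forall z, g z = g c + p z * (z - c)) ->
   p a = (g c - g a) / (c - a).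
  move=> c0 gp; have ac : a != c by rewrite -nm_sub_gt0 nm_sub.
  rewrite (quot_neq gp ac).
  have ca : c - a != 0 by rewrite -nm_gt0.
  by field; rewrite ca -opprB oppr_eq0.
rewrite -(qa b q) // -(qa b' q') //; apply.
- move=> z zr; apply: contD; first exact: (ctsq b).
  exact/contN/(ctsq b').
- move=> z zr; rewrite !inE !negb_or => /and3P[za zb zb'].
  have dz : cdiff g z by apply: dg; rewrite nm_sub_gt0 za.
  by apply: cdiffB; [exact: (quot_cdiff gq)|exact: (quot_cdiff gq')].
- move=> z hz; have := near b q b0 b_lt gq z hz; have := near b' q' b'0 b'd gq' z hz.
  rewrite [nm (q' z - _)]nm_sub.
  have := nm_tri ((g z - g a) / (z - a)) (q z) (q' z); lra.
- by rewrite subrr nm0 ltW.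
Qed.

(** Dividing by [z - a] stays within differentiable functions, also at the base point. This is what
    replaces Taylor expansions when zeros are divided out. *)
Lemma quot_cdiff_ball f q a r : 0 < r -> (forall z, nm (z - a) <= r -> cdiff f z) ->
  cont_at q a -> (forall z, f z = f a + q z * (z - a)) ->
  forall z, nm (z - a) <= r -> cdiff q z.
Proof.
move=> r0 df cq fq z zr; have [->|za] := eqVneq z a; last exact: (quot_cdiff fq za (df z zr)).
apply: (@removable q a r) => // w /andP[wa wr].
by apply: (quot_cdiff fq _ (df w wr)); rewrite -nm_sub_gt0.
Qed.

(** Cauchy's estimate: for |z - a| >= r/5 the quotient is at most 2 M / (r / 5), and [layer_est]
    carries this bound to the whole disc. *)
Lemma quot_bound f q a r M : 0 < r -> (forall z, nm (z - a) <= r -> cdiff f z) ->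
  cont_at q a -> (forall z, f z = f a + q z * (z - a)) ->
  (forall z, nm (z - a) <= r -> nm (f z) <= M) ->
  forall z, nm (z - a) <= r -> nm (q z) <= 10 * M / r.
Proof.
move=> r0 df cq fq hM; apply: layer_est => //; first exact: (quot_cdiff_ball r0 df cq fq).
move=> z /andP[z1 z2]; have za : 0 < nm (z - a) by lra.
have za' : z != a by rewrite -nm_sub_gt0.
rewrite (quot_neq fq za') nmM nmV ler_pdivrMr //.
have M0 : 0 <= M by apply: (le_trans (nm_ge0 (f z)) (hM z z2)).
have h : nm (f z - f a) <= 2 * M.
  have := nmB (f z) (f a); have := hM z z2; have := hM a; rewrite subrr nm0 => /(_ (ltW r0)); lra.
apply: (le_trans h); have -> : 2 * M = 10 * M / r * (r / 5) by field; rewrite gt_eqF.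
by rewrite ler_wpM2l // divr_ge0 ?(ltW r0) //; lra.
Qed.

Lemma cdiff_lipschitz f a r M : 0 < r -> (forall z, nm (z - a) <= r -> cdiff f z) ->
  (forall z, nm (z - a) <= r -> nm (f z) <= M) ->
  forall z, nm (z - a) <= r -> nm (f z - f a) <= 10 * M / r * nm (z - a).
Proof.
move=> r0 df hM z zr; have [q cq fq] : cdiff f a by apply: df; rewrite subrr nm0 ltW.
have -> : f z - f a = q z * (z - a) by rewrite (fq z) addrC addKr.
by rewrite nmM ler_wpM2r //; exact: (quot_bound r0 df cq fq hM).
Qed.

(** Weierstrass's theorem. By [quot_bound] the difference quotients at [a] are uniformly Cauchy,
    including at [a] itself, so limit and quotient may be exchanged. *)
Lemma uniform_limit_cdiff (F : nat -> C -> C) f a r : 0 < r ->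
  (forall n z, nm (z - a) <= r -> cdiff (F n) z) ->
  (forall e, 0 < e -> exists N, forall n, (N <= n)%N ->
     forall z, nm (z - a) <= r -> nm (F n z - f z) <= e) -> cdiff f a.
Proof.
move=> r0 dF hF.
have a0 : nm (a - a) <= r by rewrite subrr nm0 ltW.
have /choice [q hq] n : exists q, cont_at q a /\ forall z, F n z = F n a + q z * (z - a).
  by have [q] := dF n a a0; exists q.
have cau e : 0 < e -> exists N, forall m n, (N <= m)%N -> (N <= n)%N ->
    forall z, nm (z - a) <= r -> nm (q m z - q n z) <= e.
  move=> e0; have [|N hN] := hF (e * r / 20); first by rewrite divr_gt0 ?mulr_gt0.
  exists N => m n hm hn z zr.
  have -> : e = 10 * (e * r / 10) / r by field; rewrite gt_eqF.
  apply: (@quot_bound (fun z => F m z - F n z) (fun z => q m z - q n z) a r) => //.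
  - by move=> w wr; apply: cdiffB; exact: dF.
  - by apply: contD; [case: (hq m)|apply: contN; case: (hq n)].
  - by move=> w; case: (hq m) => _ ->; case: (hq n) => _ ->; ring.
  - move=> w wr; have := hN m hm w wr; have := hN n hn w wr; rewrite (nm_sub (F n w)).
    by have := nm_tri (f w) (F m w) (F n w); lra.
have [|l hl] := @complex_cauchy R (fun n => q n a).
  by move=> e /cau [N hN]; exists N => m n hm hn; exact: hN.
apply: (@cdiff_of_limit _ _ l) => e e0.
have [|N hN] := cau (e / 5); first by lra.
have [|N' hN'] := hl (e / 5); first by lra.
pose n := maxn N N'; have [cqn Fqn] := hq n.
have [|d d0 hd] := cqn (e / 5); first by lra.
exists (Num.min d r) => [|z]; first by rewrite lt_min d0.
rewrite lt_min => /andP[z0 /andP[zd zr]].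
(* This index depends on z: the accuracy is proportional to |z - a| to survive the division by z -
   a. *)
have [|K hK] := hF (e * nm (z - a) / 10); first by rewrite divr_gt0 ?mulr_gt0.
pose m := maxn N K.
have h1 : nm ((f z - f a) / (z - a) - q m z) <= e / 5.
  have za : z - a != 0 by rewrite -nm_gt0.
  have za' : z != a by rewrite -nm_sub_gt0.
  have [_ Fqm] := hq m; rewrite (quot_neq Fqm za').
  rewrite -mulrBl nmM nmV ler_pdivrMr //.
  have -> : f z - f a - (F m z - F m a) = (F m a - f a) - (F m z - f z) by ring.
  have := hK m (leq_maxr _ _) a a0; have := hK m (leq_maxr _ _) z (ltW zr).
  by have := nmB (F m a - f a) (F m z - f z); lra.
have h2 := hN m n (leq_maxl _ _) (leq_maxl _ _) z (ltW zr).
have h3 := ltW (hd z zd).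
have h4 := hN' n (leq_maxr _ _).
have := nm_tri (q m z) ((f z - f a) / (z - a)) l.
have := nm_tri (q n z) (q m z) l.
have := nm_tri (q n a) (q n z) l.
lra.
Qed.

End Removable.

(** * Maximum modulus *)

Section MaximumModulus.
Variable R : realType.
Local Notation C := (CC R).
Implicit Types (f g q h u : C -> C) (z w a b : C) (x y r s t e M : R) (V S : set C).

Definition conj_pt z : C := pt (re z) (- im z).
Lemma nm_cj z : nm (conj_pt z) = nm z.
Proof.
apply/eqP; rewrite -(@eqrXn2 _ 2) ?nm_ge0 // !nm_sqr /= sqrrN //.
Qed.

(** The Cayley transform [psi] maps the right half-plane into the unit disc and vanishes at [a]. The
    Lipschitz bound gives |psi| <= 1/2 on the disc of radius r/20, and solving for [h] yields the
    factor 3. *)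
Lemma harnack_re h a r : 0 < r -> (forall z, nm (z - a) <= r -> cdiff h z) ->
  (forall z, nm (z - a) <= r -> 0 < re (h z)) ->
  forall z, nm (z - a) <= r / 20 -> nm (h z) <= 3 * nm (h a).
Proof.
move=> r0 dh hre z zr.
have h0 : 0 < re (h a) by apply: hre; rewrite subrr nm0 ltW.
have den w : nm (w - a) <= r -> h w + conj_pt (h a) != 0.
  move=> /hre hw; apply/eqP => /(congr1 (@re R)); rewrite reD /=; lra.
pose psi w := (h w - h a) * (h w + conj_pt (h a))^-1.
have lt1 w : nm (w - a) <= r -> nm (psi w) <= 1.
  move=> wr; rewrite nmM nmV ler_pdivrMr ?nm_gt0 ?den // mul1r.
  rewrite -(@ler_pXn2r _ 2) ?nnegrE ?nm_ge0 // !nm_sqr !(reD, imD, reN, imN) /=.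
  have := hre w wr; nra.
have dpsi w : nm (w - a) <= r -> cdiff psi w.
  move=> wr; apply: cdiffM; first by apply: cdiffBc; exact: dh.
  apply: cdiffV; last exact: den.
  by apply: cdiffD; [exact: dh|exact: cdiff_cst].
have zr' : nm (z - a) <= r by lra.
have := cdiff_lipschitz r0 dpsi lt1 zr'.
rewrite {2}/psi subrr mul0r subr0 mulr1 => h1.
have h2 : nm (psi z) <= 1 / 2.
  apply: (le_trans h1); have -> : 1 / 2 = 10 / r * (r / 20) by field; rewrite gt_eqF.
  by rewrite ler_wpM2l // divr_ge0 // ltW.
move: h2; rewrite /psi nmM nmV ler_pdivrMr ?nm_gt0 ?den // => h2.
have := nm_lesub (h z) (h a); have := nmD (h z) (conj_pt (h a)); rewrite nm_cj; lra.
Qed.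

Lemma rotate_to_norm z : exists2 om : C, nm om = 1 & om * z = rc (nm z).
Proof.
have [->|z0] := eqVneq z 0; first by exists 1; rewrite ?nm1 // mulr0 nm0.
exists (rc (nm z) / z); last by rewrite divfK.
by rewrite nmM nmV nm_rc ger0_norm // divff // nm_eq0.
Qed.

(** A quantitative maximum principle: after a rotation making f a real and nonnegative, s + e - f
    has positive real part and is small at a, so [harnack_re] keeps it small nearby. The excess e is
    there for strict positivity. *)
Lemma near_const f a r s : 0 < r -> (forall z, nm (z - a) <= r -> cdiff f z) ->
  (forall z, nm (z - a) <= r -> nm (f z) <= s) ->
  forall z, nm (z - a) <= r / 20 -> nm (f z - f a) <= 4 * (s - nm (f a)).
Proof.
move=> r0 df hs z zr; rewrite leNgt; apply/negP => lt.
have hsa : nm (f a) <= s by apply: hs; rewrite subrr nm0 ltW.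
pose e := (nm (f z - f a) - 4 * (s - nm (f a))) / 8.
have e0 : 0 < e by rewrite /e; lra.
have [om om1 oma] := rotate_to_norm (f a).
pose h w := rc (s + e) - om * f w.
have ha : h a = rc (s + e - nm (f a)) by rewrite /h oma rcD (rcD (s + e)) rcN rcD.
have := @harnack_re h a r r0 _ _ z zr.
have -> : nm (h z) <= 3 * nm (h a) = (nm (h z) <= 3 * (s + e - nm (f a))).
  by rewrite ha nm_rc ger0_norm //; lra.
have dd w : nm (w - a) <= r -> cdiff h w.
  move=> wr; apply: cdiffB; first exact: cdiff_cst.
  by apply: cdiffM; [exact: cdiff_cst|exact: df].
have pp w : nm (w - a) <= r -> 0 < re (h w).
  move=> wr; rewrite /h reD reN re_rc.
  have := nm_re (om * f w); rewrite nmM om1 mul1r; have := hs w wr.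
  have := ler_norm (re (om * f w)); lra.
move=> /(_ dd pp) h1.
have : nm (f z - f a) = nm (h z - h a).
  rewrite /h (_ : _ - _ - _ = om * (f a - f z)); last by ring.
  by rewrite nmM om1 mul1r nm_sub.
have := nmB (h z) (h a); rewrite ha nm_rc ger0_norm; last by lra.
move: lt h1; rewrite /e; set A := nm (f z - f a); set B := nm (h z - _); set D := nm (h z).
lra.
Qed.

Lemma max_modulus V f M : open V -> nbounded V ->
  (forall z, closure V z -> cont_at f z) -> (forall z, V z -> cdiff f z) ->
  (forall z, frontier V z -> nm (f z) <= M) -> forall z, V z -> nm (f z) <= M.
Proof.
move=> oV bV cf df hM v Vv.
have cV := closure_compact bV.
have [||z0 z0V hz0] := @compact_max_modulus R (closure V) f cV; [|exact: cf|].
  by exists v; exact: subset_closure.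
apply: (le_trans (hz0 v (subset_closure Vv))); rewrite leNgt; apply/negP => lt.
(* Among the points of the closure where f takes its extremal value, the one of largest modulus is
   chosen. By [near_const] f is constant around it, so a point slightly farther out on the same ray
   contradicts the choice; V need not be connected. *)
pose Z := [set z | closure V z /\ f z = f z0].
have cZ : compact Z.
  apply: (subclosed_compact _ cV); last by move=> z [].
  apply: closedCP => z hz; have clz : closure V z.
    apply/closureCP => e e0; have [|w [/closureCP /(_ (e / 2)) clw _] hw] := hz (e / 2); first by lra.
    have [|w' Vw' hw'] := clw; first by lra.
    by exists w' => //; have := nm_tri w w' z; lra.
  split => //; apply/eqP; rewrite -subr_eq0 -nm_eq0 eq_le nm_ge0 andbT.
  rewrite leNgt; apply/negP => /[dup] lt' /(cf z clz) [d d0 hd].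
  have [w [_ fw] wz] := hz d d0.
  by have := hd w wz; rewrite fw nm_sub ltxx.
have [||z1 [clz1 fz1] hz1] := @compact_max_modulus R Z (fun z => z) cZ.
- by exists z0.
- by move=> z _; exact: cont_id.
have Vz1 : V z1.
  apply: contrapT => nV; have := hM z1 (conj clz1 nV); rewrite fz1; lra.
have [r r0 hr] := (openCP V).1 oV z1 Vz1.
have Vb z : nm (z - z1) <= r / 2 -> V z by move=> hz; apply: hr; lra.
have r20 : 0 < r / 2 by lra.
have cst z : nm (z - z1) <= r / 2 / 20 -> f z = f z1.
  move=> hz; apply/eqP; rewrite -subr_eq0 -nm_eq0 eq_le nm_ge0 andbT.
  have := @near_const f z1 (r / 2) (nm (f z1)) r20 _ _ z hz; rewrite subrr mulr0.
  apply => w hw; first by apply: df; exact: Vb.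
  by rewrite fz1; apply: hz0; apply: subset_closure; exact: Vb.
have [om om1 omz] := rotate_to_norm z1.
have omV : om != 0 by rewrite -nm_gt0 om1.
pose z2 := om^-1 * rc (nm z1 + r / 40).
have z2n : nm z2 = nm z1 + r / 40.
  rewrite nmM nmV om1 invr1 mul1r nm_rc ger0_norm //; have := nm_ge0 z1; lra.
have z2z1 : nm (z2 - z1) <= r / 2 / 20.
  have -> : z2 - z1 = om^-1 * rc (r / 40).
    by rewrite /z2 rcD -omz; field.
  by rewrite nmM nmV om1 invr1 mul1r nm_rc ger0_norm //; lra.
have : nm z2 <= nm z1.
  apply: hz1; split; last by rewrite cst.
  by apply: subset_closure; apply: Vb; lra.
lra.
Qed.

Lemma fr_nonempty V v : open V -> nbounded V -> V v -> exists k0, frontier V k0.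
Proof.
move=> oV bV Vv; apply: contrapT => h.
have := @max_modulus V (fun=> 1) 0 oV bV _ _ _ v Vv; rewrite nm1 ler10 => /(_ _ _ _).
move=> H; suff : false by []. apply: H.
- by move=> z _; exact: cont_cst.
- by move=> z _; exact: cdiff_cst.
- by move=> z hz; case: h; exists z.
Qed.

Lemma min_modulus V f M : 0 < M -> open V -> nbounded V ->
  (forall z, closure V z -> cont_at f z) -> (forall z, V z -> cdiff f z) ->
  (forall z, V z -> f z != 0) ->
  (forall z, frontier V z -> M <= nm (f z)) -> forall z, V z -> M <= nm (f z).
Proof.
move=> M0 oV bV cf df f0 hM z Vz.
have f0c w : closure V w -> f w != 0.
  move=> cw; have [Vw|nw] := pselect (V w); first exact: f0.
  by rewrite -nm_gt0; apply: (lt_le_trans M0); apply: hM.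
have := @max_modulus V (fun z => (f z)^-1) M^-1 oV bV _ _ _ z Vz.
rewrite nmV lef_pV2 ?posrE ?nm_gt0 ?f0 //; apply => w hw.
- by apply: contV; [exact: f0c|exact: cf].
- by apply: cdiffV; [exact: df|exact: f0].
- by rewrite nmV lef_pV2 ?posrE ?hM // nm_gt0 f0c //; case: hw.
Qed.

Definition cdiff_everywhere f := forall z, cdiff f z.

Lemma compact_away K f w : compact K -> (forall z, K z -> cont_at f z) -> (forall z, K z -> f z != w) ->
  exists2 d, 0 < d & forall z, K z -> d <= nm (f z - w).
Proof.
move=> cK cf fw; have [|M M0 hM] := @compact_bounded_fun R K (fun z => (f z - w)^-1) cK.
  move=> z Kz; apply: (@contV R (fun z => f z - w)); first by rewrite subr_eq0 fw.
  by apply: contD; [exact: cf|exact: cont_cst].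
exists M^-1 => [|z Kz]; first by rewrite invr_gt0.
have := hM z Kz; rewrite nmV => h; have n0 : 0 < nm (f z - w) by rewrite nm_sub_gt0 fw.
by rewrite invf_ple ?posrE.
Qed.

(** S meets f(V) in a relatively open and closed set. Closedness uses compactness of the closure of
    V and that f maps no frontier point into S; openness uses the minimum principle in place of the
    open mapping theorem. *)
Lemma covering V f S v : open V -> nbounded V -> cdiff_everywhere f -> connected S ->
  (forall z, frontier V z -> ~ S (f z)) -> V v -> S (f v) -> S `<=` f @` V.
Proof.
move=> oV bV ef conS Sfr Vv Sv.
have cfr := fr_compact oV bV; have cV := closure_compact bV.
suff <- : S `&` f @` V = S by move=> z [].
apply: conS.
- by exists (f v); split => //; exists v.
- exists (f @` V `\` f @` (frontier V)); last first.
    apply/seteqP; split=> w [Sw]; last by case.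
    move=> [z Vz fz]; split => //; split; first by exists z.
    by move=> [z' frz' fz']; apply: (Sfr z') => //; rewrite fz'.
  apply/openCP => w [[z Vz <-] nfr].
  have [||d d0 hd] := @compact_away (frontier V) f (f z) cfr.
  + by move=> z' _; exact/cdiff_cont/ef.
  + by move=> z' hz'; apply/eqP => E; apply: nfr; exists z'.
  (* If such a w' were omitted, f - w' would be zero-free on V, of modulus at least d/2 on the
     frontier and less than d/2 at z. *)
  exists (d / 2) => [|w' hw']; first by lra.
  have away z' : frontier V z' -> d / 2 <= nm (f z' - w').
    move=> /hd h1; have := nm_tri w' (f z') (f z); lra.
  split; last first.
    by move=> [z' /away h1 E]; move: h1; rewrite E subrr nm0; lra.
  apply: contrapT => nV.
  have := @min_modulus V (fun z => f z - w') (d / 2) ltac:(lra) oV bV _ _ _ away z Vz.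
  rewrite nm_sub leNgt hw' => /(_ _ _ _)/negP; apply=> //.
  + by move=> z' _; apply/cdiff_cont/cdiffBc/ef.
  + by move=> z' _; apply/cdiffBc/ef.
  + by move=> z' Vz'; rewrite subr_eq0; apply/eqP => E; apply: nV; exists z'.
- exists (f @` closure V); last first.
    apply/seteqP; split=> w [Sw [z hz fz]]; split => //.
      by exists z => //; exact: subset_closure.
    exists z => //; apply: contrapT => nV; apply: (Sfr z) => //; rewrite fz //.
  apply: closedCP => w hw; apply: contrapT => nw.
  have [||d d0 hd] := @compact_away (closure V) f w cV.
  + by move=> z' _; exact/cdiff_cont/ef.
  + by move=> z' hz'; apply/eqP => E; apply: nw; exists z'.
  have [_ [z hz <-]] := hw d d0; have := hd z hz; lra.
Qed.

Lemma disc_covering V f r v : open V -> nbounded V -> cdiff_everywhere f ->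
  (forall z, frontier V z -> 2 * r <= nm (f z)) -> V v -> f v = 0 ->
  forall w, nm w < r -> exists2 z, V z & f z = w.
Proof.
move=> oV bV ef hr Vv fv w wr; apply: contrapT => nV.
have r0 : 0 < r by have := nm_ge0 w; lra.
have := @min_modulus V (fun z => f z - w) r r0 oV bV _ _ _ _ v Vv.
rewrite fv sub0r nmN leNgt wr => /(_ _ _ _ _)/negP; apply=> //.
- by move=> z' _; apply/cdiff_cont/cdiffBc/ef.
- by move=> z' _; apply/cdiffBc/ef.
- by move=> z' Vz'; rewrite subr_eq0; apply/eqP => E; apply: nV; exists z'.
- by move=> z /hr h; have := nm_lesub (f z) w; lra.
Qed.

End MaximumModulus.

(** * Entire functions of polynomial growth *)

Section Entire.
Variable R : realType.
Local Notation C := (CC R).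
Implicit Types (f g q h u v : C -> C) (z w a b : C) (x y r s t e M L : R).

Lemma ent_div f a : cdiff_everywhere f -> exists2 q, cdiff_everywhere q & forall z, f z = f a + q z * (z - a).
Proof.
move=> ef; have [q cq fq] := ef a; exists q => // z.
have r0 : 0 < nm (z - a) + 1 by have := nm_ge0 (z - a); lra.
by apply: (@quot_cdiff_ball R f q a _ r0) => //; lra.
Qed.

Definition polynomial f := exists p : {poly C}, forall z, f z = p.[z].

(** Liouville's theorem and induction: the quotient by z lowers the exponent by one. The bound is
    asked only on some arbitrarily large discs, since the dynamics supplies no more. *)
Lemma growth_polynomial d f A : cdiff_everywhere f ->
  (forall L, exists2 r, L < r & forall z, nm z <= r -> nm (f z) <= A * r ^+ d) ->
  polynomial f.
Proof.
elim: d f A => [|d IH] f A ef hA.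
  exists (f 0)%:P => z; rewrite hornerC; apply/eqP; rewrite -subr_eq0 -nm_eq0.
  apply/negPn/negP => n0; have {}n0 : 0 < nm (f z - f 0) by rewrite lt_def n0 nm_ge0.
  have [r rL hr] := hA (nm z + 10 * `|A| * nm z / nm (f z - f 0)).
  have p0 : 0 <= 10 * `|A| * nm z / nm (f z - f 0).
    by rewrite divr_ge0 // mulr_ge0 // mulr_ge0 //; lra.
  have r0 : 0 < r by have := nm_ge0 z; lra.
  have := @cdiff_lipschitz R f 0 r A r0 _ _ z; rewrite subr0.
  move=> /(_ (fun w _ => ef w)) h.
  have {h} h : nm (f z - f 0) <= 10 * A / r * nm z.
    by apply: h => [w|]; [rewrite subr0 => /hr; rewrite expr0 mulr1|lra].
  have h2 : 10 * `|A| * nm z / nm (f z - f 0) < r by have := nm_ge0 z; lra.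
  rewrite ltr_pdivrMr // in h2.
  have h3 : 10 * A / r * nm z * r = 10 * A * nm z by field; rewrite gt_eqF.
  have h4 : nm (f z - f 0) * r <= 10 * A / r * nm z * r by rewrite ler_wpM2r // ltW.
  have h5 : A * nm z <= `|A| * nm z by rewrite ler_wpM2r // ler_norm.
  lra.
have [q eq fq] := ent_div 0 ef.
have [|p hp] := IH q (10 * A) eq.
  move=> L; have [r rL hr] := hA (`|L| + 1); exists r; first by have := ler_norm L; lra.
  have r0 : 0 < r by have := normr_ge0 L; lra.
  move=> z zr; have -> : 10 * A * r ^+ d = 10 * (A * r ^+ d.+1) / r.
    by rewrite exprS; field; rewrite gt_eqF.
  apply: (@quot_bound R f q 0 r) => //; try by rewrite subr0.
  - exact: cdiff_cont.
  - by move=> w; rewrite subr0; exact: hr.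
exists ((f 0)%:P + p * 'X) => z.
by rewrite hornerD hornerC hornerM hornerX fq hp subr0.
Qed.

(** The form in which transcendence is used: unlike not being a polynomial, it passes to
    compositions at once ([dense_comp]), hence to the whole semigroup. *)
Definition dense_at_infty f := forall w e L, 0 < e -> exists2 z, L < nm z & nm (f z - w) < e.

Lemma poly_infty (p : {poly C}) : (exists c, p = c%:P) \/
  forall M, exists L, forall z, L < nm z -> M < nm p.[z].
Proof.
elim/poly_ind: p => [|p c IH]; first by left; exists 0.
have [p0|p0] := eqVneq p 0; first by left; exists c; rewrite p0 mul0r add0r.
right => M; case: IH => [[d pd]|hp].
  have d0 : 0 < nm d by rewrite nm_gt0; apply: contraNneq p0 => d0; rewrite pd d0.
  exists ((M + nm c) / nm d) => z; rewrite ltr_pdivrMr // => h.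
  rewrite hornerD hornerC hornerM hornerX pd hornerC.
  have := nm_lesub (d * z) (- c); rewrite opprK nmN nmM; lra.
have [L hL] := hp (`|M| + nm c); exists (Num.max L 1) => z; rewrite gt_max => /andP[/hL h1 h2].
rewrite hornerD hornerC hornerM hornerX.
have := nm_lesub (p.[z] * z) (- c); rewrite opprK nmN nmM.
have : nm p.[z] <= nm p.[z] * nm z by rewrite ler_peMr // ltW.
have := ler_norm M; lra.
Qed.

Lemma dense_not_polynomial f : dense_at_infty f -> ~ polynomial f.
Proof.
move=> df [p fp]; case: (poly_infty p) => [[c pc]|hp].
  have [z _] := df (c + 1) 1 0 ltr01; rewrite fp pc hornerC.
  by rewrite (_ : c - (c + 1) = -1) ?nmN ?nm1 ?ltxx //; ring.
have [L hL] := hp 1; have [z /hL h1] := df 0 1 L ltr01.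
by rewrite subr0 fp; lra.
Qed.

Lemma zerofree_polynomial_cst (p : {poly C}) : (forall z, p.[z] != 0) ->
  exists2 c, c != 0 & p = c%:P.
Proof.
move=> hp; have s1 : size p = 1%N.
  apply/eqP/negPn/negP => /(@closed_rootP C) [x].
  by rewrite rootE (negbTE (hp x)).
exists p`_0; last by rewrite [LHS]size1_polyC ?s1.
apply/eqP => p0; have := hp 0; rewrite [p]size1_polyC ?s1 // p0 hornerC eqxx //.
Qed.

(** If f stays away from w near infinity, g = f - w has all its zeros in a disc. They are finitely
    many; dividing them out leaves a zero-free u whose inverse has polynomial growth, so 1/u is a
    zero-free polynomial, a constant, and g is a polynomial. *)
Lemma casorati_weierstrass f : cdiff_everywhere f -> ~ polynomial f -> dense_at_infty f.
Proof.
move=> ef nf w e L0 e0; apply: contrapT => nz; apply: nf.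
pose L := `|L0|; have L00 : 0 <= L by exact: normr_ge0.
pose g z := f z - w.
have far z : L < nm z -> e <= nm (g z).
  move=> Lz; rewrite leNgt; apply/negP => lt; apply: nz; exists z => //.
  by have := ler_norm L0; rewrite -/L; lra.
clearbody L.
have eg : cdiff_everywhere g by move=> z; exact: cdiffBc.
pose fact n := exists s : seq C, exists u, [/\ size s = n, (forall p, p \in s -> nm p <= L),
  cdiff_everywhere u & forall z, g z = \prod_(p <- s) (z - p) * u z].
have fact0 : fact 0%N by exists [::], g; split => // z; rewrite big_nil mul1r.
(* A crude Jensen bound on the number of zeros. The product of the factors is at least (2 D)^n on
   the annulus r/5 <= |z| <= r and at most D^n at the point L + 1, so n zeros would give |g| <= B /
   2^n < e there, against [far]. *)
have [n0 nfact] : exists n0, ~ fact n0.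
  pose D := 2 * L + 2; have D0 : 0 < D by rewrite /D; lra.
  pose r := 5 * (L + 2 * D); have r0 : 0 < r by rewrite /r; lra.
  have [B B0 hB] := @cball_bounded R g 0 r (fun z _ => cdiff_cont (eg z)).
  have [n hn] := @pow_unbounded R 2 (B / e) ltac:(lra).
  exists n => -[s [u [sn hs eu gu]]].
  have prod_ge (m : R) z : 0 <= m -> (forall p, p \in s -> m <= nm (z - p)) ->
      m ^+ n <= nm (\prod_(p <- s) (z - p)).
    rewrite -sn; elim: (s) => [|p t IH] m0 hm; first by rewrite big_nil nm1.
    rewrite big_cons nmM exprS ler_pM ?exprn_ge0 //; first by apply: hm; rewrite mem_head.
    by apply: IH => // p' hp'; apply: hm; rewrite in_cons hp' orbT.
  have prod_le (m : R) z : (forall p, p \in s -> nm (z - p) <= m) ->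
      nm (\prod_(p <- s) (z - p)) <= m ^+ n.
    rewrite -sn; elim: (s) => [|p t IH] hm; first by rewrite big_nil nm1.
    rewrite big_cons nmM exprS ler_pM //; first by apply: hm; rewrite mem_head.
    by apply: IH => // p' hp'; apply: hm; rewrite in_cons hp' orbT.
  have ub : forall z, nm (z - 0) <= r -> nm (u z) <= B / (2 * D) ^+ n.
    apply: layer_est => // z /andP[z1 z2].
    rewrite ler_pdivlMr ?exprn_gt0 //; last by lra.
    apply: (le_trans _ (hB z z2)); rewrite gu nmM mulrC ler_wpM2r //.
    apply: prod_ge; first by lra.
    move=> p /hs hp; have := nm_lesub z p; rewrite subr0 in z1; rewrite /r in z1; lra.
  have z0n : nm (rc (L + 1)) = L + 1 by rewrite nm_rc ger0_norm //; lra.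
  have := far (rc (L + 1)); rewrite z0n => /(_ ltac:(lra)); rewrite gu nmM => h1.
  have h2 : nm (\prod_(p <- s) (rc (L + 1) - p)) <= D ^+ n.
    by apply: prod_le => p /hs hp; have := nmB (rc (L + 1)) p; rewrite z0n /D; lra.
  have h3 : nm (u (rc (L + 1))) <= B / (2 * D) ^+ n.
    by apply: ub; rewrite subr0 z0n /r /D; lra.
  have h4 : nm (\prod_(p <- s) (rc (L + 1) - p)) * nm (u (rc (L + 1))) <= D ^+ n * (B / (2 * D) ^+ n).
    by rewrite ler_pM.
  have h5 : D ^+ n * (B / (2 * D) ^+ n) = B / 2 ^+ n.
    by rewrite exprMn; field; rewrite !expf_neq0 ?gt_eqF.
  move: hn; rewrite ltr_pdivrMr // mulrC -ltr_pdivrMr ?exprn_gt0 //; lra.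
have ex : exists n, `[< ~ fact n >] by exists n0; apply/asboolP.
case: (ex_minnP ex) => -[|n] /asboolP nfn min; first by [].
have [s [u [sn hs eu gu]]] : fact n.
  apply: contrapT => nf; have := min n; rewrite ltnn => /(_ _)/negP; apply => //.
  exact/asboolP.
have u0 z : u z != 0.
  apply/negP => /eqP uz; have [zL|zL] := lerP (nm z) L; last first.
    by have := far z zL; rewrite gu uz mulr0 nm0; lra.
  have [q eq uq] := ent_div z eu; apply: nfn; exists (z :: s), q; split => //.
  - by rewrite /= sn.
  - by move=> p; rewrite in_cons => /orP[/eqP ->|/hs].
  - by move=> z'; rewrite gu big_cons uq uz add0r; ring.
have [||p hp] := @growth_polynomial n (fun z => (u z)^-1) (2 ^+ n / e).
- by move=> z; apply: cdiffV.
(* On the annulus r/5 <= |z| <= r, which lies beyond L, 1/u is the product of the factors divided by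
   g, with |g| >= e; [layer_est] extends the bound inwards. *)
- move=> K; pose r := 5 * (L + 1) + `|K| + 1.
  exists r; first by rewrite /r; have := ler_norm K; lra.
  have r0 : 0 < r by rewrite /r; have := normr_ge0 K; lra.
  move=> z zr; apply: (@layer_est R (fun z => (u z)^-1) 0 r _ r0); last by rewrite subr0.
    by move=> z' _; apply: cdiffV.
  move=> z'; rewrite subr0 => /andP[z1 z2].
  have gz : e <= nm (g z') by apply: far; move: z1; rewrite /r; have := normr_ge0 K; lra.
  have g0 : 0 < nm (g z') by lra.
  have P0 : nm (\prod_(p <- s) (z' - p)) <= (2 * r) ^+ n.
    rewrite -sn; elim: (s) (hs) => [|p t IH] hm; first by rewrite big_nil nm1.
    rewrite big_cons nmM exprS ler_pM //.
      have := hm p (mem_head _ _); have := nmB z' p; rewrite /r in z2 *.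
      by have := normr_ge0 K; lra.
    by apply: IH => p' hp'; apply: hm; rewrite in_cons hp' orbT.
  have -> : nm (u z')^-1 = nm (\prod_(p <- s) (z' - p)) / nm (g z').
    rewrite gu nmM nmV invfM mulrA divff ?mul1r //.
    by apply: contraTneq g0 => h; rewrite gu nmM h mul0r ltxx.
  rewrite ler_pdivrMr //.
  have -> : 2 ^+ n / e * r ^+ n * nm (g z') = (2 * r) ^+ n * (nm (g z') / e).
    by rewrite exprMn; ring.
  apply: (le_trans P0); rewrite ler_peMr //; first by rewrite exprn_ge0 //; lra.
  by rewrite ler_pdivlMr // mul1r.
have [|c c0 pc] := @zerofree_polynomial_cst p; first by move=> z; rewrite -hp invr_eq0.
exists (w%:P + \prod_(p <- s) ('X - p%:P) * (c^-1)%:P) => z.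
have -> : f z = w + g z by rewrite /g addrC subrK.
rewrite hornerD hornerM !hornerC gu horner_prod; congr (_ + _ * _).
  by apply: eq_bigr => p' _; rewrite hornerXsubC.
by rewrite -[u z]invrK hp pc hornerC.
Qed.

Lemma dense_comp f g : cdiff_everywhere f -> dense_at_infty f -> dense_at_infty g ->
  dense_at_infty (f \o g).
Proof.
move=> ef df dg w e L e0.
have [|y _ hy] := df w (e / 2) 0; first by lra.
have [|d d0 hd] := cdiff_cont (ef y) (e := e / 2); first by lra.
have [z Lz hz] := dg y d L d0; exists z => //=.
have := hd _ hz; have := nm_tri (f y) (f (g z)) w; lra.
Qed.

End Entire.

(** * Harnack's inequality for moduli *)

Section Harnack.
Variable R : realType.
Local Notation C := (CC R).
Implicit Types (f g q h u : C -> C) (z w a b v : C) (x y r s t e M L : R).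

Lemma principal_sqrt : exists S : C -> C, forall w, 0 < re w -> S w ^+ 2 = w /\ 0 < re (S w).
Proof.
suff /choice [S hS] : forall w : C, exists s : C, 0 < re w -> s ^+ 2 = w /\ 0 < re s.
  by exists S.
move=> w.
pose s : C := sqrtC w.
have s2 : s ^+ 2 = w by exact: sqrtCK.
have [s0|s0] := lerP (re s) 0; last by exists s.
exists (- s) => w0; split; first by rewrite sqrrN.
rewrite reN oppr_gt0 lt_neqAle s0 andbT; apply/eqP => h; move: w0.
by rewrite -s2 expr2 reM h; nra.
Qed.

Lemma sqrt_cdiff S w : (forall w, 0 < re w -> S w ^+ 2 = w /\ 0 < re (S w)) ->
  0 < re w -> cdiff S w.
Proof.
move=> hS w0; have [Sw2 Sw0] := hS w w0.
have near v : nm (v - w) < re w -> 0 < re v.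
  by have := nm_re (v - w); rewrite reD reN ler_norml => /andP[h1 h2] h3; lra.
have sumn0 v : 0 < re v -> re (S w) <= nm (S v + S w).
  move=> /hS [_ h]; apply: (le_trans _ (nm_re _)); rewrite reD.
  by apply: (le_trans _ (ler_norm _)); lra.
have E v : 0 < re v -> S v - S w = (v - w) / (S v + S w).
  move=> v0; have [Sv2 _] := hS v v0.
  have n0 : S v + S w != 0 by rewrite -nm_gt0; have := sumn0 v v0; lra.
  have -> : v - w = S v ^+ 2 - S w ^+ 2 by rewrite Sv2 Sw2.
  by field.
have cS : cont_at S w.
  move=> e e0; exists (Num.min (re w) (e * re (S w))); first by rewrite lt_min w0 mulr_gt0.
  move=> v; rewrite lt_min => /andP[/near v0 hv].
  have h := sumn0 v v0.
  rewrite E // nmM nmV ltr_pdivrMr; last by lra.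
  by apply: (lt_le_trans hv); rewrite ler_wpM2l // ltW.
apply: (@cdiff_eq R (fun v => S w + (S v + S w)^-1 * (v - w)) S w (re w)) => //.
  by move=> v /near v0; rewrite mulrC -E // addrC subrK.
exists (fun v => (S v + S w)^-1).
  apply: (@contV R (fun v => S v + S w)).
    by rewrite -nm_gt0; have := sumn0 w w0; lra.
  by apply: contD => //; exact: cont_cst.
by move=> v; rewrite subrr mulr0 addr0.
Qed.

Lemma iter_sqrt S k w : (forall w, 0 < re w -> S w ^+ 2 = w /\ 0 < re (S w)) ->
  0 < re w -> [/\ iter k S w ^+ (2 ^ k) = w, 0 < re (iter k S w) & cdiff (iter k S) w].
Proof.
move=> hS w0; elim: k => [|k [h1 h2 h3]]; first by split => //; exact: cdiff_id.
have [h4 h5] := hS _ h2; split => //=.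
  by rewrite expnS exprM h4.
by apply: (@cdiff_comp R (iter k S) S) => //; exact: sqrt_cdiff.
Qed.

Lemma telescope_quot (F : nat -> C) N : (forall j, (j <= N)%N -> F j != 0) ->
  F 0%N * \prod_(j <- iota 0 N) (F j.+1 / F j) = F N.
Proof.
elim: N => [|N IH] F0; first by rewrite big_nil mulr1.
rewrite -addn1 iotaD big_cat /= big_seq1 mulrA IH; last by move=> j hj; apply: F0; lia.
by rewrite add0n addn1 mulrC divfK // F0.
Qed.

(* The roots of order 2^k of f on the ball are the products of the principal roots of
   the ratios of the values of f at consecutive points of the radius. *)
Lemma power_roots f a r : 0 < r -> cdiff_everywhere f -> (forall z, nm (z - a) <= r -> 1 < nm (f z)) ->
  forall k, exists2 g, (forall z, nm (z - a) <= r / 2 -> cdiff g z) &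
    forall z, nm (z - a) <= r / 2 -> g z ^+ (2 ^ k) = f z.
Proof.
move=> r0 ef f1 k.
have [M M0 hM] := @cball_bounded R f a r (fun z _ => cdiff_cont (ef z)).
(* With N > 10 M, consecutive values of f along the radius differ by less than 1. As |f| > 1, their
   ratio is within 1 of 1 and lies in the right half-plane, where the principal root is
   available. *)
have [N0 hN0] := nat_above (10 * M); pose N := N0.+1.
have NM : 10 * M < N%:R by apply: (le_lt_trans hN0); rewrite ltr_nat.
have Np : 0 < N%:R :> R by rewrite ltr0n.
pose Z j w := a + rc (j%:R / N%:R) * (w - a).
have Zball j w : (j <= N)%N -> nm (w - a) <= r / 2 -> nm (Z j w - a) <= r / 2.
  move=> jN wr; rewrite /Z addrC addKr nmM nm_rc ger0_norm ?divr_ge0 //.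
  apply: (le_trans _ wr); rewrite ler_piMl // ler_pdivrMr // mul1r ler_nat //.
have Zf j w : (j <= N)%N -> nm (w - a) <= r / 2 -> 1 < nm (f (Z j w)).
  by move=> jN wr; apply: f1; have := Zball j w jN wr; lra.
have Zf0 j w : (j <= N)%N -> nm (w - a) <= r / 2 -> f (Z j w) != 0.
  by move=> jN wr; rewrite -nm_gt0; have := Zf j w jN wr; lra.
pose rho j w := f (Z j.+1 w) / f (Z j w).
have rho0 j w : (j < N)%N -> nm (w - a) <= r / 2 -> 0 < re (rho j w).
  move=> jN wr.
  have step : nm (Z j.+1 w - Z j w) <= r / 2 / N%:R.
    have -> : Z j.+1 w - Z j w = rc (N%:R^-1) * (w - a).
      rewrite /Z -natr1 mulrDl rcD mul1r; ring.
    rewrite nmM nm_rc ger0_norm ?invr_ge0 // mulrC ler_wpM2r ?invr_ge0 //.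
  have step2 : nm (Z j.+1 w - Z j w) <= r / 2.
    apply: (le_trans step); rewrite ler_pdivrMr // ler_peMr //; first by lra.
    by rewrite ler1n.
  have hl : nm (f (Z j.+1 w) - f (Z j w)) < 1.
    have r2 : 0 < r / 2 by lra.
    have := @cdiff_lipschitz R f (Z j w) (r / 2) M r2 (fun z _ => ef z) _ (Z j.+1 w) step2.
    have h z : nm (z - Z j w) <= r / 2 -> nm (f z) <= M.
      move=> hz; apply: hM; have := nm_tri (Z j w) z a.
      by have := Zball j w (ltnW jN) wr; lra.
    move=> /(_ h) /le_lt_trans; apply.
    apply: (@le_lt_trans _ _ (10 * M / N%:R)); last by rewrite ltr_pdivrMr // mul1r.
    have -> : 10 * M / N%:R = 10 * M / (r / 2) * (r / 2 / N%:R).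
      by field; rewrite !gt_eqF.
    by rewrite ler_wpM2l // divr_ge0 //; lra.
  have h1 : nm (rho j w - 1) < 1.
    have -> : rho j w - 1 = (f (Z j.+1 w) - f (Z j w)) / f (Z j w).
      by rewrite /rho mulrBl divff // Zf0 // ltnW.
    have h := Zf j w (ltnW jN) wr.
    by rewrite nmM nmV ltr_pdivrMr; lra.
  by have := nm_re (rho j w - 1); rewrite reD reN /= ler_norml => /andP[]; lra.
have [S hS] := principal_sqrt.
have k0 : (0 < 2 ^ k)%N by rewrite expn_gt0.
pose c : C := (2 ^ k).-root (f a).
have hc : c ^+ (2 ^ k) = f a by exact: rootCK.
exists (fun w => c * \prod_(j <- iota 0 N) iter k S (rho j w)).
  move=> z zr; apply: cdiffM; first exact: cdiff_cst.
  have : all (fun j => j < N)%N (iota 0 N) by apply/allP => j; rewrite mem_iota add0n.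
  elim: (iota 0 N) => [|j s IH] /=.
    move=> _; rewrite (_ : (fun w => _) = (fun=> 1)); first exact: cdiff_cst.
    by apply/funext => w; rewrite big_nil.
  move=> /andP[jN /IH ds].
  rewrite (_ : (fun w => _) = (fun w => iter k S (rho j w) * \prod_(j0 <- s) iter k S (rho j0 w))).
    apply: cdiffM => //; apply: (@cdiff_comp R (rho j) (iter k S)); last first.
      by have [] := @iter_sqrt S k (rho j z) hS (rho0 j z jN zr).
    have dZ i : cdiff (Z i) z.
      apply: cdiffD; first exact: cdiff_cst.
      by apply: cdiffM; [exact: cdiff_cst|exact: cdiff_sub].
    apply: cdiffM; first by apply: (@cdiff_comp R (Z j.+1) f).
    by apply: cdiffV; [exact: (@cdiff_comp R (Z j) f)|apply: Zf0; rewrite // ltnW].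
  by apply/funext => w; rewrite big_cons.
move=> z zr; rewrite exprMn hc -prodrXl.
have Z0 : Z 0%N z = a by rewrite /Z mul0r mul0r addr0.
have ZN : Z N z = z by rewrite /Z divff ?gt_eqF // mul1r addrC subrK.
rewrite -{2}ZN -(@telescope_quot (fun j => f (Z j z)) N); last by move=> j jN; exact: Zf0.
rewrite Z0; congr (_ * _); apply: eq_big_seq => j; rewrite mem_iota add0n => jN.
by have [] := @iter_sqrt S k (rho j z) hS (rho0 j z jN zr).
Qed.

(** For the least k with |f a| <= 2^(2^k), a root g of order 2^k satisfies |g| > 1 and |g a| <= 2.
    The Lipschitz bound for 1/g gives |1/g| >= 1/2 - 1/5 >= 1/4 near a, so |f w| <= 4^(2^k), which
    the minimality of k bounds by the fourth power of |f a|. *)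
Lemma harnack_power f a r : 0 < r -> cdiff_everywhere f -> (forall z, nm (z - a) <= r -> 1 < nm (f z)) ->
  2 <= nm (f a) -> forall w, nm (w - a) <= r / 100 -> nm (f w) <= nm (f a) ^+ 4.
Proof.
move=> r0 ef f1 fa2 w wr.
have ex : exists k : nat, nm (f a) <= 2 ^+ (2 ^ k).
  have [n hn] := @pow_unbounded R 2 (nm (f a)) ltac:(lra).
  exists n; apply: (le_trans (ltW hn)); rewrite ler_eXn2l ?ltr1n //.
  exact/ltnW/ltn_expl.
case: (ex_minnP ex) => k hk kmin.
have [g dg gf] := power_roots r0 ef f1 k.
have r2 : 0 < r / 2 by lra.
have a0 : nm (a - a) <= r / 2 by rewrite subrr nm0; lra.
have k0 : (0 < 2 ^ k)%N by rewrite expn_gt0.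
have g1 z : nm (z - a) <= r / 2 -> 1 < nm (g z).
  move=> zr; rewrite ltNge; apply/negP => h.
  have := f1 z ltac:(lra); rewrite -gf // nmX ltNge => /negP; apply.
  by rewrite exprn_ile1.
have ga : nm (g a) <= 2.
  by rewrite -(@ler_pXn2r _ (2 ^ k)) ?nnegrE // -nmX gf.
have gn z : nm (z - a) <= r / 2 -> g z != 0 by move=> /g1 h; rewrite -nm_gt0; lra.
have wr2 : nm (w - a) <= r / 2 by lra.
have := @cdiff_lipschitz R (fun z => (g z)^-1) a (r / 2) 1 r2 _ _ w wr2.
have d1 z : nm (z - a) <= r / 2 -> cdiff (fun z => (g z)^-1) z.
  by move=> zr; apply: cdiffV; [exact: dg|exact: gn].
have d2 z : nm (z - a) <= r / 2 -> nm (g z)^-1 <= 1.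
  by move=> zr; rewrite nmV invf_le1; have := g1 z zr; lra.
move=> /(_ d1 d2) h1.
have h2 : 10 * 1 / (r / 2) * nm (w - a) <= 1 / 5.
  have -> : 1 / 5 = 10 * 1 / (r / 2) * (r / 100) :> R by field; rewrite gt_eqF.
  by rewrite ler_wpM2l // divr_ge0 //; lra.
have h3 : 1 / 2 <= nm (g a)^-1.
  by rewrite nmV mul1r lef_pV2 ?posrE //; have := g1 a a0; lra.
have h4 : 1 / 4 <= nm (g w)^-1.
  have := nm_lesub (g a)^-1 (g w)^-1; rewrite nm_sub; lra.
have h5 : nm (g w) <= 4.
  move: h4; rewrite nmV mul1r lef_pV2 ?posrE //; have := g1 w wr2; lra.
have h6 : nm (f w) <= 4 ^+ (2 ^ k) by rewrite -gf // nmX lerXn2r ?nnegrE.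
apply: (le_trans h6); case: k hk kmin {gf k0 g1 ga dg gn h1 h2 h3 h4 h5 h6 d1 d2} => [|k] hk kmin.
  have -> : 4 ^+ (2 ^ 0) = 2 ^+ 2 :> R by rewrite expn0 expr1; ring.
  apply: (@le_trans _ _ (nm (f a) ^+ 2)); first by rewrite lerXn2r ?nnegrE.
  by rewrite ler_weXn2l //; lra.
have hlt : 2 ^+ (2 ^ k) < nm (f a).
  by rewrite ltNge; apply/negP => /kmin; rewrite ltnn.
have -> : 4 ^+ (2 ^ k.+1) = (2 ^+ (2 ^ k)) ^+ 4 :> R.
  have -> : 4 = 2 ^+ 2 :> R by ring.
  by rewrite -!exprM expnS; congr (_ ^+ _); lia.
by rewrite lerXn2r ?nnegrE ?exprn_ge0 // ltW.
Qed.

End Harnack.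

(** * Separation of the plane by a component of an open set *)

Section SegmentConnected.
Variable R : realType.
Local Notation C := (CC R).
Implicit Types (z w a b v : C) (x y r s t e : R).

Lemma segment_connected z w : connected [set z + rc t * (w - z) | t in `[(0:R), 1]].
Proof.
apply: connected_continuous_connected.
  by apply/connected_intervalP; exact: interval_is_interval.
apply: continuous_subspaceT => t A /nbhsCP [e e0 he].
have n0 := nm_ge0 (w - z).
have d0 : 0 < e / (nm (w - z) + 1) by rewrite divr_gt0 //; lra.
apply/(@nbhs_ballP R R); exists (e / (nm (w - z) + 1)) => //= u; rewrite /ball /= => hu.
apply: he; have -> : z + rc u * (w - z) - (z + rc t * (w - z)) = rc (u - t) * (w - z).
  by rewrite rcD rcN; ring.
rewrite nmM nm_rc; move: hu; rewrite distrC ltr_pdivlMr; last by lra.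
have := normr_ge0 (u - t); nra.
Qed.

Lemma ball_component (F : set C) z w r : (forall v, nm (v - z) < r -> F v) ->
  nm (w - z) < r -> connected_component F z w.
Proof.
move=> hF wr; pose S := [set z + rc t * (w - z) | t in `[(0:R), 1]].
apply: (@connected_component_max _ F S z).
- by exists 0; rewrite /= ?in_itv /= ?lexx ?ler01 // (_ : rc 0 = 0) // mul0r addr0.
- move=> v [t /= ht <-]; move: ht; rewrite in_itv /= => /andP[t0 t1]; apply: hF.
  rewrite addrC addKr nmM nm_rc ger0_norm //.
  by apply: (le_lt_trans _ wr); rewrite ler_piMl.
- exact: segment_connected.
- by exists 1; rewrite /= ?in_itv /= ?lexx ?ler01 // (_ : rc 1 = 1) // mul1r addrC subrK.
Qed.

End SegmentConnected.

Definition is_integer (R : realType) (x : R) := exists m : int, x = m%:~R.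

Lemma is_integerD (R : realType) (x y : R) : is_integer x -> is_integer y -> is_integer (x + y).
Proof. by move=> [m ->] [n ->]; exists (m + n); rewrite intrD. Qed.
Lemma is_integer_ge1 (R : realType) (x : R) : is_integer x -> x != 0 -> 1 <= `|x|.
Proof.
by move=> [m ->]; rewrite intr_eq0 -intr_norm (ler_int _ 1) => m0; rewrite -gtz0_ge1 normr_gt0.
Qed.

Section Separation.
Variable R : realType.
Local Notation C := (CC R).
Implicit Types (z w v : C) (x y s e : R).
Variables (F O : set C) (chi : C -> R) (eta Lam L T : R) (N : nat).
Hypothesis eta0 : 0 < eta.
Hypothesis chiF : forall z, (forall w, nm (w - z) < eta -> F w) \/
  exists2 k, (k = 0 \/ k = 1) & forall w, nm (w - z) < eta -> chi w = k.
Hypothesis chi_far : forall z, L <= nm z -> chi z = 0.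
Hypothesis chi_lip : forall z w, `|chi w - chi z| <= Lam * nm (w - z).
Hypothesis compO : forall z, (forall w, nm (w - z) < eta -> F w) ->
  forall w, nm (w - z) < eta -> O w <-> O z.
Hypothesis (etaL : eta <= L) (TL : T = 4 * L) (NT : T / N%:R < eta / 2) (N0 : (0 < N)%N).

(* The increment of chi from z to w counted only inside the component O: it is
   locally additive although O has a boundary, because chi is locally constant off F.
   Summing it along horizontal segments gives a function [cutoff_lift] which is continuous,
   varies only inside O, and agrees with chi up to integers. *)
Definition incr z w : R := if `[< O z >] then chi w - chi z else 0.
Definition part z : R := if `[< O z >] then chi z else 0.

Lemma L_gt0 : 0 < L. Proof. exact: lt_le_trans eta0 etaL. Qed.

Lemma incrD z w v : nm (w - z) < eta -> nm (v - z) < eta ->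
  incr z w + incr w v = incr z v.
Proof.
move=> hw hv; case: (chiF z) => [hF|[k _ hk]].
  have Owz : `[< O w >] = `[< O z >] by apply: asbool_equiv_eq; exact: compO.
  by rewrite /incr Owz; case: ifP => _; lra.
rewrite /incr !hk ?subrr ?nm0 //; first by case: ifP; case: ifP; lra.
Qed.

(** A small disc inside F does not cross the boundary of O, and the difference is 0. Elsewhere chi
    is constantly 0 or 1, and entering or leaving O changes [part] by that integer. *)
Lemma incr_part z w : nm (w - z) < eta -> is_integer (incr z w - (part w - part z)).
Proof.
move=> hw; case: (chiF z) => [hF|[k k01 hk]].
  have Owz : `[< O w >] = `[< O z >] by apply: asbool_equiv_eq; exact: compO.
  exists 0; rewrite /incr /part Owz mulr0z; case: ifP => _; lra.
rewrite /incr /part !hk ?subrr ?nm0 //.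
case: k01 => ->; do 2 case: ifP => _;
  first [by exists 0; rewrite mulr0z; lra|by exists 1; rewrite mulr1z; lra
        |by exists (-1); rewrite mulrN1z; lra].
Qed.

Lemma incr_lip z w : `|incr z w| <= Lam * nm (w - z).
Proof.
rewrite /incr; case: ifP => _; first exact: chi_lip.
by rewrite normr0; apply: le_trans (chi_lip z w).
Qed.

(** The path to z is horizontal and starts at z - T. Since T = 4 L, the bound [re z <= 2 * L] places
    its start where chi vanishes. *)
Definition node z k : C := z - rc T + rc (T * k%:R / N%:R).
Fixpoint path_sum z k : R := if k is k'.+1 then path_sum z k' + incr (node z k') (node z k'.+1) else 0.
Definition cutoff_lift z := path_sum z N.

Lemma node0 z : node z 0 = z - rc T.
Proof. by rewrite /node mulr0 mul0r (_ : rc 0 = 0) // addr0. Qed.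
Lemma nodeN z : node z N = z.
Proof. by rewrite /node mulfK ?pnatr_eq0 -?lt0n // subrK. Qed.
Lemma node_step z k : nm (node z k.+1 - node z k) < eta / 2.
Proof.
have -> : node z k.+1 - node z k = rc (T / N%:R).
  rewrite /node (_ : T * k.+1%:R / N%:R = T * k%:R / N%:R + T / N%:R) ?rcD; first by ring.
  by rewrite -natr1; ring.
rewrite nm_rc ger0_norm // divr_ge0 // TL; have := L_gt0; lra.
Qed.
Lemma node_shift z w k : node w k - node z k = w - z.
Proof. by rewrite /node; ring. Qed.

(** Discrete path independence: the parallel paths to z and w form a ladder of small quadrilaterals
    on which [incr] is additive, and the rung at the left end contributes 0. *)
Lemma lift_incr z w : re z <= 2 * L -> re w <= 2 * L -> nm (w - z) < eta / 2 ->
  cutoff_lift w - cutoff_lift z = incr z w.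
Proof.
move=> z2 w2 hzw; have e0 := eta0.
have H k : path_sum w k - path_sum z k = incr (node z k) (node w k) - incr (node z 0) (node w 0).
  elim: k => [|k IH] /=; first by rewrite !subrr.
  have n1 : nm (node w k - node z k) < eta by rewrite node_shift; lra.
  have n2 : nm (node w k.+1 - node z k) < eta.
    have := nm_tri (node z k.+1) (node w k.+1) (node z k); rewrite node_shift.
    have := node_step z k; lra.
  have n3 : nm (node z k.+1 - node z k) < eta by have := node_step z k; lra.
  have := incrD n1 n2; have := incrD n3 n2; lra.
have far v : re v <= 2 * L -> chi (v - rc T) = 0.
  move=> v2; apply: chi_far; apply: (le_trans _ (nm_re _)).
  have := ler_norm (- re (v - rc T)); rewrite normrN reD reN re_rc TL; have := L_gt0; lra.
rewrite /cutoff_lift H !nodeN !node0 /incr !far // !subrr if_same subr0 //.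
Qed.

Lemma lift_part z : re z <= 2 * L -> is_integer (cutoff_lift z - part z).
Proof.
move=> z2.
have H k : is_integer (path_sum z k - (part (node z k) - part (node z 0))).
  elim: k => [|k IH] /=; first by exists 0; rewrite !subrr.
  have n3 : nm (node z k.+1 - node z k) < eta by have := node_step z k; have := eta0; lra.
  have := is_integerD IH (incr_part n3).
  set A := path_sum z k; set B := incr _ _; set p := part _; set q := part _; set q' := part _.
  by rewrite (_ : A - _ + _ = A + B - (q' - q)) //; ring.
have c0 : chi (z - rc T) = 0.
  apply: chi_far; apply: (le_trans _ (nm_re _)).
  have := ler_norm (- re (z - rc T)); rewrite normrN reD reN re_rc TL; have := L_gt0; lra.
by have := H N; rewrite nodeN node0 /cutoff_lift [part (z - _)]/part c0 if_same subr0.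
Qed.

Lemma lift_far_aux z : (forall k, L <= nm (node z k)) -> cutoff_lift z = 0.
Proof.
move=> h; rewrite /cutoff_lift; elim: N => [//|k IH] /=.
by rewrite IH /incr !chi_far // subrr if_same addr0.
Qed.

(** If |im z| >= L or re z <= 0, the path stays where chi vanishes. To the right of the disc it
    crosses the support of chi, so z is first moved vertically, away from the real axis and outside
    the disc, until the horizontal path clears the disc; the lift does not change on the way. *)
Lemma lift_far z : re z <= 2 * L -> L <= nm z -> cutoff_lift z = 0.
Proof.
move=> z2 zL; have L0 := L_gt0.
have [L_im|L_im] := lerP L `|im z|.
  apply: lift_far_aux => k; apply: (le_trans _ (nm_im _)).
  by rewrite /node !imD imN !im_rc; rewrite oppr0 !addr0.
have [rz|rz] := lerP (re z) 0.
  pose P k := (k <= N)%N -> L <= nm (node z k).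
  have HP k : P k.
    move=> kN; rewrite -(@ler_pXn2r _ 2) ?nnegrE ?(ltW L0) // nm_sqr.
    have : L ^+ 2 <= nm z ^+ 2 by rewrite ler_pXn2r ?nnegrE ?(ltW L0).
    rewrite nm_sqr /node !reD !reN !re_rc !imD imN !im_rc oppr0 !addr0.
    have : T * k%:R / N%:R <= T.
      rewrite ler_pdivrMr ?ltr0n // ler_wpM2l ?ler_nat // TL; lra.
    move: (T * k%:R / N%:R) => Y hY; nra.
  rewrite /cutoff_lift; have : (N <= N)%N by [].
  elim: {1 3}N => [//|k IH] kN /=.
  by rewrite IH ?(ltnW kN) // /incr !chi_far ?subrr ?if_same ?addr0 //; apply: HP; rewrite // ltnW.
pose sg : R := if 0 <= im z then 1 else -1.
have sgim : sg * im z = `|im z|.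
  by rewrite /sg; case: ifP => h; [rewrite mul1r ger0_norm|rewrite mulN1r ltr0_norm // ltNge h].
have sg1 : `|sg| = 1 by rewrite /sg; case: ifP; rewrite ?normrN normr1.
have sg2 : sg * sg = 1 by rewrite /sg; case: ifP; lra.
pose up (m : nat) := z + pt 0 (sg * (m%:R * (eta / 4))).
have reup m : re (up m) = re z by rewrite /up reD /= addr0.
have imup m : im (up m) = sg * (`|im z| + m%:R * (eta / 4)).
  by rewrite /up imD /= -sgim mulrDr [sg * (sg * _)]mulrA sg2 mul1r.
clearbody up.
have m0 (m : nat) : 0 <= m%:R * (eta / 4) by rewrite mulr_ge0 //; have := eta0; lra.
have upL m : L <= nm (up m).
  rewrite -(@ler_pXn2r _ 2) ?nnegrE ?(ltW L0) // nm_sqr reup imup exprMn.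
  have -> : sg ^+ 2 = 1 by rewrite expr2.
  have : L ^+ 2 <= nm z ^+ 2 by rewrite ler_pXn2r ?nnegrE ?(ltW L0).
  rewrite nm_sqr -(real_normK (num_real (im z))).
  have := m0 m; have := normr_ge0 (im z); nra.
have stp m : cutoff_lift (up m.+1) = cutoff_lift (up m).
  have := @lift_incr (up m) (up m.+1); rewrite !reup => /(_ z2 z2) h.
  have {}h := h _; apply/eqP; rewrite -subr_eq0; apply/eqP; rewrite h.
    by rewrite /incr !chi_far // subrr if_same.
  have -> : up m.+1 - up m = pt 0 1 * rc (sg * (eta / 4)).
    apply: cC_eq; rewrite ?(reD, imD, reN, imN, reM, imM) ?reup ?imup /=; first by ring.
    by rewrite -natr1; ring.
  rewrite nmM nm_rc normrM sg1 mul1r (_ : nm (pt 0 1) = 1) ?mul1r.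
    by rewrite ger0_norm; have := eta0; lra.
  by rewrite /nm /= expr0n expr1n add0r sqrtr1.
have all0 m : cutoff_lift (up m) = cutoff_lift z.
  elim: m => [|m IH]; last by rewrite stp.
  by congr cutoff_lift; apply: cC_eq; rewrite ?reup // imup mul0r addr0 -sgim mulrA sg2 mul1r.
have [m hm] := nat_above (L / (eta / 4)).
rewrite -(all0 m); apply: lift_far_aux => k; apply: (le_trans _ (nm_im _)).
rewrite /node !imD imN !im_rc oppr0 !addr0 imup normrM sg1 mul1r.
apply: (le_trans _ (ler_norm _)); have e0 := eta0.
move: hm; rewrite ler_pdivrMr; last by lra.
have := normr_ge0 (im z); lra.
Qed.

(** Off O the lift is an integer. It is thus at least 1 in modulus at a, and a frontier point, where
    it is 1/2 up to sign, must lie in O. The rim of the disc of radius L is excluded because the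
    lift vanishes there. *)
Lemma domain_of_lift a : ~ O a -> chi a != 0 -> cutoff_lift a != 0 ->
  exists V, [/\ open V, nbounded V, V a & frontier V `<=` O].
Proof.
move=> Oa chia la; have L0 := L_gt0; have e0 := eta0; have eL := etaL.
have aL : nm a < L by rewrite ltNge; apply/negP => /chi_far h; rewrite h eqxx in chia.
have reL z : nm z <= L + L -> re z <= 2 * L.
  by move=> h; have := ler_norm (re z); have := nm_re z; lra.
pose sg : R := if 0 <= cutoff_lift a then 1 else -1.
have sg1 : `|sg| = 1 by rewrite /sg; case: ifP; rewrite ?normrN normr1.
have lsg x : sg * x <= `|x| by apply: (le_trans (ler_norm _)); rewrite normrM sg1 mul1r.
have sga : 1 <= sg * cutoff_lift a.
  have -> : sg * cutoff_lift a = `|cutoff_lift a|.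
    by rewrite /sg; case: ifP => h; [rewrite mul1r ger0_norm|rewrite mulN1r ltr0_norm // ltNge h].
  apply: is_integer_ge1 => //; have := @lift_part a (reL a ltac:(lra)).
  by rewrite /part asboolF // subr0.
have Lam0 : 0 <= Lam.
  by have := chi_lip 0 1; have := normr_ge0 (chi 1 - chi 0); rewrite subr0 nm1; lra.
have lift_cts z e : nm z <= L -> 0 < e -> exists2 d, 0 < d & forall w, nm (w - z) < d ->
    `|cutoff_lift w - cutoff_lift z| < e.
  move=> zL ee; exists (Num.min (eta / 2) (e / (Lam + 1))).
    by rewrite lt_min !divr_gt0 //; lra.
  move=> w; rewrite lt_min => /andP[h1 h2].
  have zr : re z <= 2 * L by apply: reL; lra.
  have wr : re w <= 2 * L by apply: reL; have := nm_lesub w z; lra.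
  rewrite lift_incr //.
  apply: (le_lt_trans (incr_lip _ _)).
  move: h2; rewrite ltr_pdivlMr; last by lra.
  have := nm_ge0 (w - z); nra.
exists [set z | nm z < L /\ 1 / 2 < sg * cutoff_lift z]; split.
- apply/openCP => z [zL hz].
  have [|d d0 hd] := lift_cts z (sg * cutoff_lift z - 1 / 2) (ltW zL); first by lra.
  exists (Num.min d (L - nm z)); first by rewrite lt_min d0; lra.
  move=> w; rewrite lt_min => /andP[/hd h1 h2]; split; first by have := nm_lesub w z; lra.
  have := lsg (cutoff_lift z - cutoff_lift w); rewrite distrC; lra.
- by exists L => z [zL _]; exact: ltW.
- by split => //; lra.
- move=> z [/closureCP clz nVz].
  have zL : nm z <= L.
    rewrite leNgt; apply/negP => lt.
    have [|w [wL _]] := clz (nm z - L); first by lra.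
    by have := nm_lesub z w; rewrite nm_sub; lra.
  have ge : sg * cutoff_lift z < 1 / 2 -> False.
    move=> lt; have [|d d0 hd] := lift_cts z (1 / 2 - sg * cutoff_lift z) zL; first by lra.
    have [w [_ w2] /hd] := clz d d0.
    have := lsg (cutoff_lift w - cutoff_lift z); lra.
  have zL' : nm z < L.
    rewrite lt_neqAle zL andbT; apply/eqP => zz.
    have lz : cutoff_lift z = 0 by apply: lift_far; [apply: reL; lra|lra].
    by apply: ge; rewrite lz mulr0; lra.
  have half : sg * cutoff_lift z = 1 / 2.
    apply/eqP; rewrite eq_le; apply/andP; split.
      by rewrite leNgt; apply/negP => h; apply: nVz.
    by rewrite leNgt; apply/negP => h; exact: ge.
  apply: contrapT => nO; have := @lift_part z (reL z ltac:(lra)).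
  rewrite /part asboolF // subr0 => lz.
  have [lz0|/(is_integer_ge1 lz)] := eqVneq (cutoff_lift z) 0; first by move: half; rewrite lz0; lra.
  have : `|sg * cutoff_lift z| = 1 / 2 by rewrite half ger0_norm //; lra.
  by rewrite normrM sg1 mul1r; lra.
Qed.

End Separation.

(** * Cutoff functions for a compact piece of the complement *)

Section Cutoff.
Variable R : realType.
Local Notation C := (CC R).
Implicit Types (z w v x : C) (y s e : R) (A B F : set C).

Lemma distance_function A : A !=set0 -> exists rho : C -> R,
  [/\ forall z w, `|rho w - rho z| <= nm (w - z),
      forall z x, A x -> rho z <= nm (z - x) &
      forall z e, (forall x, A x -> e <= nm (z - x)) -> e <= rho z].
Proof.
move=> [x0 Ax0]; pose D z := [set nm (z - x) | x in A].
have D0 z : D z !=set0 by exists (nm (z - x0)), x0.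
have lb z : has_inf (D z) by split => //; exists 0 => _ [x _ <-].
have le z x : A x -> inf (D z) <= nm (z - x).
  by move=> Ax; apply: inf_lbound; [by exists 0 => _ [? _ <-]|exists x].
have ge z e : (forall x, A x -> e <= nm (z - x)) -> e <= inf (D z).
  by move=> h; apply: lb_le_inf => // _ [x Ax <-]; exact: h.
exists (fun z => inf (D z)); split => // z w.
have H u v : inf (D u) - nm (u - v) <= inf (D v).
  by apply: ge => x Ax; have := le u x Ax; have := nm_tri v u x; lra.
by rewrite ler_norml; have := H z w; have := H w z; rewrite (nm_sub z w); lra.
Qed.

Lemma compact_closed_gap A B : compact A -> closed B -> (forall z, A z -> ~ B z) ->
  exists2 d, 0 < d & forall z w, A z -> B w -> d <= nm (z - w).
Proof.
move=> cA cB AB.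
have [|N hN] := @compact_unif R A (fun n z => forall w, B w -> n.+1%:R^-1 <= nm (z - w)) cA.
  move=> z Az; have nBz := AB z Az.
  have oB := (openCP (~` B)).1 (closed_openC cB) z nBz; case: oB => e e0 he.
  have e2 : 0 < e / 2 by lra.
  have [N hN] := inv_small e2; exists N, (e / 2) => // n w nN hw v Bv.
  have : e <= nm (v - z) by rewrite leNgt; apply/negP => /he.
  have := hN n nN; have := nm_tri w v z; rewrite (nm_sub v w).
  by move: (n.+1%:R^-1) => i; lra.
by exists N.+1%:R^-1 => [|z w Az]; [rewrite invr_gt0|exact: hN].
Qed.

Lemma compact_nbounded A : compact A -> nbounded A.
Proof.
move=> cA; have [M _ hM] := @compact_bounded_fun R A (fun z => z) cA (fun z _ => @cont_id R z).
by exists M.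
Qed.

Lemma clamp_lip (p q m : R) : `|p - q| <= m ->
  `|Num.max 0 (Num.min 1 (2 - p)) - Num.max 0 (Num.min 1 (2 - q))| <= m.
Proof.
rewrite !ler_norml => /andP[h1 h2].
have H (u v : R) : v - u <= m -> 0 <= m ->
    Num.max 0 (Num.min 1 (2 - u)) <= Num.max 0 (Num.min 1 (2 - v)) + m.
  move=> h m0.
  have f0 : 0 <= Num.max 0 (Num.min 1 (2 - v)) by rewrite le_max lexx.
  have f1 : Num.min 1 (2 - v) <= Num.max 0 (Num.min 1 (2 - v)) by rewrite le_max lexx orbT.
  rewrite ge_max; apply/andP; split; first by lra.
  have g1 : Num.min 1 (2 - u) <= 1 by rewrite ge_min lexx.
  have g2 : Num.min 1 (2 - u) <= 2 - u by rewrite ge_min lexx orbT.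
  by move: f1; case: (lerP 1 (2 - v)) => hv f1; lra.
have m0 : 0 <= m by lra.
have := H p q ltac:(lra) m0; have := H q p ltac:(lra) m0 => k1 k2.
by apply/andP; split; lra.
Qed.

Lemma cutoff A B F : compact A -> A !=set0 -> closed B -> (forall z, A z -> ~ B z) ->
  (forall z, F z <-> ~ A z /\ ~ B z) ->
  exists (chi : C -> R) (eta Lam L : R), [/\ 0 < eta,
    forall z, (forall w, nm (w - z) < eta -> F w) \/
      exists2 k, (k = 0 \/ k = 1) & forall w, nm (w - z) < eta -> chi w = k,
    forall z, L <= nm z -> chi z = 0,
    forall z w, `|chi w - chi z| <= Lam * nm (w - z) &
    forall z, A z -> chi z = 1].
Proof.
move=> cA A0 cB AB FAB.
have [rho [rho_lip rho_le rho_ge]] := distance_function A0.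
have [d d0 hd] := compact_closed_gap cA cB AB.
have [M hM] := compact_nbounded cA.
pose chi z := Num.max 0 (Num.min 1 (2 - 3 * rho z / d)).
have chi1 z : rho z <= d / 3 -> chi z = 1.
  move=> h; have : 3 * rho z / d <= 1 by rewrite ler_pdivrMr //; lra.
  by move=> h1; rewrite /chi min_l ?max_r //; lra.
have chi0 z : 2 * d / 3 <= rho z -> chi z = 0.
  move=> h; have : 2 <= 3 * rho z / d by rewrite ler_pdivlMr //; lra.
  by move=> h1; rewrite /chi min_r ?max_l //; lra.
(* chi is 1 up to distance d/3 from A and 0 from distance 2d/3 on. A disc of radius d/12 centred at
   distance between d/4 and 3d/4 from A misses A and B; any other sees a constant chi. *)
exists chi, (d / 12), (3 / d), (M + d); split.
- by lra.
- move=> z; have near w : nm (w - z) < d / 12 -> `|rho w - rho z| < d / 12.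
    exact: le_lt_trans (rho_lip z w).
  have [h1|h1] := lerP (rho z) (d / 4).
    by right; exists 1 => [|w /near]; [right|rewrite ltr_norml => h; apply: chi1; lra].
  have [h2|h2] := lerP (3 * d / 4) (rho z).
    by right; exists 0 => [|w /near]; [left|rewrite ltr_norml => h; apply: chi0; lra].
  left => w /near; rewrite ltr_norml => h; apply/FAB; split => hw.
    by have := rho_le w w hw; rewrite subrr nm0; lra.
  have : d <= rho w by apply: rho_ge => x Ax; rewrite nm_sub; exact: hd.
  lra.
- move=> z hz; apply: chi0; have : d <= rho z; last by lra.
  by apply: rho_ge => x /hM hx; have := nm_lesub z x; lra.
- move=> z w.
  have h : `|3 * rho w / d - 3 * rho z / d| <= 3 / d * nm (w - z).
    rewrite (_ : _ - _ = 3 / d * (rho w - rho z)); last by field; rewrite gt_eqF.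
    by rewrite normrM ger0_norm ?ler_wpM2l // divr_ge0 // ltW.
  exact: clamp_lip.
- move=> z Az; apply: chi1; have := rho_le z z Az; rewrite subrr nm0; lra.
Qed.

End Cutoff.

(** * Choice of the separating component *)

Section ComponentChoice.
Variable R : realType.
Local Notation C := (CC R).
Implicit Types (z w v x : C) (y s e : R) (A B F : set C).

Lemma psum_sum (O : set C) (chi : C -> R) T N z k :
  path_sum O chi T N z k = \sum_(i < k) incr O chi (node T N z i) (node T N z i.+1).
Proof. by elim: k => [|k IH] /=; rewrite ?big_ord0 // big_ord_recr /= IH. Qed.

(* The increments along the path to a add up to chi a; grouping them by component of F,
   some component contributes a nonzero amount. *)
Lemma lift_component_neq0 F (chi : C -> R) eta T N a : 0 < eta -> (0 < N)%N ->
  (forall z, (forall w, nm (w - z) < eta -> F w) \/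
    exists2 k, (k = 0 \/ k = 1) & forall w, nm (w - z) < eta -> chi w = k) ->
  (forall k, nm (node T N a k.+1 - node T N a k) < eta) ->
  chi (node T N a 0) = 0 -> chi (node T N a N) = 1 ->
  exists z0, cutoff_lift (connected_component F z0) chi T N a != 0.
Proof.
move=> eta0 N0 chiF step c0 c1; apply: contrapT => no.
have all0 z0 : cutoff_lift (connected_component F z0) chi T N a = 0.
  by apply/eqP/negPn/negP => h; apply: no; exists z0.
pose nd (k : 'I_N) := node T N a k.
pose d (k : 'I_N) := chi (node T N a k.+1) - chi (node T N a k).
have dF k : d k != 0 -> F (nd k).
  move=> dk; case: (chiF (nd k)) => [hF|[c _ hc]]; first by apply: hF; rewrite subrr nm0.
  by move: dk; rewrite /d !hc ?subrr ?nm0 ?eqxx //; exact: step.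
have tel m : \sum_(k < m) (chi (node T N a k.+1) - chi (node T N a k)) =
    chi (node T N a m) - chi (node T N a 0).
  elim: m => [|m IH]; first by rewrite big_ord0 subrr.
  by rewrite big_ord_recr /= IH addrC addrA subrK.
have sumd : \sum_k d k = 1 by rewrite /d tel c0 c1 subr0.
pose CCk k := connected_component F (nd k).
(* A common representative for all nodes in one component. The sum is partitioned along [p], and
   each nonempty fibre adds up to the lift of one component at a. *)
pose p (k : 'I_N) := odflt k [pick j | `[< CCk j = CCk k >]].
have pC k : CCk (p k) = CCk k.
  by rewrite /p; case: pickP => [j /asboolP|/(_ k)] //=; rewrite asboolT.
have pp j k : CCk j = CCk k -> p j = p k.
  move=> jk; rewrite /p jk; case: pickP => [//|/(_ k)]; by rewrite asboolT.
move: sumd; rewrite (partition_big p predT) //=.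
rewrite big1; first by move=> /esym/eqP; rewrite oner_eq0.
move=> j _; have [[k0 pk0]|nj] := pselect (exists k0, p k0 = j); last first.
  by rewrite big1 // => k /eqP pk; case: nj; exists k.
have := all0 (nd j); rewrite /cutoff_lift psum_sum => H; rewrite -[RHS]H big_mkcond /=.
apply: eq_bigr => k _; rewrite /incr -/(d k).
have [dk0|/dF Fk] := eqVneq (d k) 0; first by rewrite dk0 !if_same.
congr (if _ then _ else _); apply/idP/asboolP => [/eqP pk|jk].
  have := connected_component_refl Fk; rewrite -/(CCk k) -/(CCk j) -pC pk.
  by [].
apply/eqP; rewrite -pk0; apply: pp; rewrite -(pC k0) pk0.
by apply/esym/same_connected_component.
Qed.

Lemma separating_domain A B F a : compact A -> closed B -> (forall z, A z -> ~ B z) ->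
  (forall z, F z <-> ~ A z /\ ~ B z) -> A a ->
  exists V z0, [/\ open V, nbounded V, V a & frontier V `<=` connected_component F z0].
Proof.
move=> cA cB AB FAB Aa.
have [chi [eta [Lam [L0 [eta0 chiF far lip one]]]]] := cutoff cA (ex_intro _ a Aa) cB AB FAB.
pose L := Num.max L0 eta.
have etaL : eta <= L by rewrite le_max lexx orbT.
have L00 : L0 <= L by rewrite le_max lexx.
clearbody L.
have farL z : L <= nm z -> chi z = 0 by move=> h; apply: far; lra.
pose T := 4 * L; have T0 : 0 < T by rewrite /T; lra.
have [m hm] := nat_above (T / (eta / 2)).
pose N := m.+1; have N0 : (0 < N)%N by [].
have NT : T / N%:R < eta / 2.
  rewrite ltr_pdivrMr ?ltr0n // mulrC -ltr_pdivrMr; last by lra.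
  by apply: (le_lt_trans hm); rewrite ltr_nat.
clearbody N.
have aL : nm a < L.
  by rewrite ltNge; apply/negP => /farL; rewrite one // => /eqP; rewrite oner_eq0.
have step k : nm (node T N a k.+1 - node T N a k) < eta.
  by have := @node_step R eta L T N eta0 etaL erefl NT a k; lra.
have [||z0 hz0] := @lift_component_neq0 F chi eta T N a eta0 N0 chiF step.
- rewrite node0; apply: farL; apply: (le_trans _ (nm_re _)).
  have := ler_norm (- re (a - rc T)); rewrite normrN reD reN re_rc /T.
  by have := nm_re a; have := ler_norm (re a); lra.
- by rewrite nodeN // one.
have compO z : (forall w, nm (w - z) < eta -> F w) ->
    forall w, nm (w - z) < eta -> connected_component F z0 w <-> connected_component F z0 z.
  move=> hF w hw; have zw := ball_component hF hw; split => h.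
    by apply: (connected_component_trans h); exact: connected_component_sym.
  exact: connected_component_trans h zw.
have [||V [oV bV Va frV]] := @domain_of_lift R F (connected_component F z0) chi eta Lam L T N
   eta0 chiF farL lip compO etaL erefl NT N0 a _ _ hz0.
- by move=> /connected_component_sub /FAB [].
- by rewrite one // oner_eq0.
by exists V, z0.
Qed.

End ComponentChoice.

(** * From a disconnection on the sphere to closed sets in the plane *)

Section Sphere.
Variable R : realType.
Local Notation C := (CC R).
Implicit Types (F : set C).

(** P is the relatively clopen piece containing infinity. The open set [C1] is then a neighbourhood
    of infinity, so the part of the complement of F outside [C1] is compact: it is A, and B is the
    finite part of P. *)
Lemma sphere_separation_aux F (P C1 D1 : set (sphere R)) :
  let X := ~` (Some @` F) `|` [set None] in
  open F -> open C1 -> closed D1 -> P = X `&` C1 -> P = X `&` D1 -> P None -> P <> X ->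
  exists A B : set C, [/\ compact A, A !=set0, closed B, (forall z, A z -> ~ B z) &
    forall z, F z <-> ~ A z /\ ~ B z].
Proof.
move=> X oF oC1 cD1 PC PD Pn PX.
have XS z : X (Some z) <-> ~ F z.
  split => [[h Fz|//]|nF]; first by apply: h; exists z.
  by left => -[w Fw [wz]]; apply: nF; rewrite -wz.
have someC : continuous (Some : C -> sphere R) by exact: one_point_compactification_some_continuous.
exists (~` F `&` (Some @^-1` (~` C1))), (~` F `&` (Some @^-1` D1)).
have clS (D : set (sphere R)) : closed D -> closed ((Some : C -> sphere R) @^-1` D).
  by move=> cD; apply: closed_comp cD => x _; exact: someC.
have cF : closed (~` F) by exact: open_closedC.
have cl1 : closed (~` F `&` (Some @^-1` (~` C1))).
  by apply: closedI; [exact: cF|exact: (clS _ (open_closedC oC1))].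
have C1n : C1 None by move: Pn; rewrite PC => -[].
split.
- have : nbhs (None : sphere R) C1 by exact: open_nbhs_nbhs.
  move=> [K [cK _] KC]; apply: (subclosed_compact cl1 cK).
  move=> z [_ nC]; apply: contrapT => nK; apply: nC; apply: KC; left; by exists z.
- apply: contrapT => nA; apply: PX; rewrite PC; apply/seteqP; split => [x []//|x Xx].
  split => //; case: x Xx => [z /XS nF|//]; apply: contrapT => nC; apply: nA; by exists z.
- by apply: closedI; [exact: cF|exact: clS].
- move=> z [nF nC] [_ Dz]; apply: nC; have : P (Some z) by rewrite PD; split => //; apply/XS.
  by rewrite PC => -[].
- move=> z; split => [Fz|[nA nB]]; first by split => -[].
  apply: contrapT => nF; have Xz : X (Some z) by apply/XS.
  have nC : ~ C1 (Some z).
    move=> Cz; apply: nB; split => //; have : P (Some z) by rewrite PC.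
    by rewrite PD => -[].
  by apply: nA; split.
Qed.

Lemma sphere_separation F : open F ->
  ~ connected (~` (Some @` F) `|` [set None] : set (sphere R)) ->
  exists A B : set C, [/\ compact A, A !=set0, closed B, (forall z, A z -> ~ B z) &
    forall z, F z <-> ~ A z /\ ~ B z].
Proof.
move=> oF; set X := _ `|` _ => nc; apply: contrapT => h; apply: nc => P P0 [C1 oC PC] [D1 cD PD].
apply: contrapT => PX; apply: h.
have [Pn|nPn] := pselect (P None).
  exact: (@sphere_separation_aux F P C1 D1).
apply: (@sphere_separation_aux F (X `\` P) (~` D1) (~` C1)) => //.
- exact: closed_openC.
- exact: open_closedC.
- by rewrite PD; apply/seteqP; split => x [Xx h]; split => //; [move=> Dx; exact: h|move=> [_ Dx]].
- by rewrite PC; apply/seteqP; split => x [Xx h]; split => //; [move=> Dx; exact: h|move=> [_ Dx]].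
- by split => //; right.
- case: P0 => x Px XP; have : (X `\` P) x; last by case.
  by rewrite XP; move: Px; rewrite PC => -[].
Qed.

End Sphere.

(** * Normal families *)

Section Normality.
Variable R : realType.
Local Notation C := (CC R).
Implicit Types (f g h : C -> C) (z w a b v : C) (x y r s t e M L : R) (A K U V : set C).
Variable G : set (C -> C).
Hypothesis Gent : forall f, G f -> cdiff_everywhere f.

Lemma uniform_cvgCP V (f : nat -> C -> C) h : {uniform V, f @ \oo --> h} <->
  forall e, 0 < e -> exists N, forall n, (N <= n)%N -> forall w, V w -> nm (f n w - h w) < e.
Proof.
split.
  move=> fh e e0.
  have /fh : nbhs (h : {uniform` V -> C}) [set g | forall w, V w -> nm (g w - h w) < e].
    apply/uniform_nbhs; exists [set xy | nm (xy.2 - xy.1) < e]; split => //.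
    rewrite -(@entourage_ballE C C); exists (e%:C) => /=; first by rewrite ltcR.
    by move=> [u v] /=; rewrite -ball_normE /= nm_norm ltcR nm_sub.
  by rewrite /= nbhs_simpl /= => -[N _ hN]; exists N => n; exact: hN.
move=> H P /uniform_nbhs [E [entE EP]].
move: entE; rewrite -(@entourage_ballE C C) => -[e /= e0 he].
have eR : e = (re e)%:C by rewrite /re RRe_real // gtr0_real.
have [|N hN] := H (re e); first by rewrite -ltcR -eR.
exists N => // n /= /hN h1; apply: EP => w /h1 hw; apply: he => /=.
by rewrite -ball_normE /= nm_norm eR ltcR nm_sub.
Qed.

Definition increasing (phi : nat -> nat) := forall m n, (m < n)%N -> (phi m < phi n)%N.

Lemma increasing_ge phi : increasing phi -> forall n, (n <= phi n)%N.
Proof.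
move=> hp; elim=> [//|n IH]; exact: (leq_ltn_trans IH (hp n n.+1 (ltnSn n))).
Qed.

Lemma subsequence_such (P : nat -> Prop) : (forall N, exists2 n, (N <= n)%N & P n) ->
  exists2 phi, increasing phi & forall n, P (phi n).
Proof.
move=> h; have /choice [nx hnx] N : exists n, (N <= n)%N /\ P n by have [n] := h N; exists n.
pose phi := fix phi n := if n is n'.+1 then nx (phi n').+1 else nx 0%N.
exists phi => [m n|[|n]]; [|by case: (hnx 0%N)|by case: (hnx (phi n).+1)].
elim: n => [//|n IH]; rewrite ltnS leq_eqVlt => /orP[/eqP ->|/IH /ltn_trans]; last apply.
  by have [] := hnx (phi n).+1.
by have [] := hnx (phi n).+1.
Qed.

Lemma normal_dichotomy U z0 r (f : nat -> C -> C) : normal_on G U ->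
  (forall z, nm (z - z0) <= r -> U z) -> (forall n, G (f n)) ->
  exists2 phi, increasing phi &
  (exists h, (exists B, forall z, nm (z - z0) <= r -> nm (h z) <= B) /\
     forall e, 0 < e -> exists N, forall n, (N <= n)%N ->
       forall z, nm (z - z0) <= r -> nm (f (phi n) z - h z) < e) \/
  forall M, exists N, forall n, (N <= n)%N -> forall z, nm (z - z0) <= r -> M <= nm (f (phi n) z).
Proof.
move=> nU ballU Gf; have [phi phi_homo H] := nU f Gf.
exists phi; first by move=> m n; exact: phi_homo.
have cK := @compact_cball R z0 r.
case: H => [[h hol fh]|finf].
  left; exists h; split.
    have [M M0 hM] := @compact_bounded_fun R _ h cK (fun z zr => cdiff_cont
      ((derivable_cdiff h z).1 (hol z (ballU z zr)))).
    by exists M.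
  move=> e e0.
  have [|N hN] := @compact_unif R _ (fun n z => nm (f (phi n) z - h z) < e) cK.
    move=> z /ballU /fh [W /nbhsCP [d d0 hd] /uniform_cvgCP /(_ e e0) [N hN]].
    by exists N, d => // n w nN /hd; exact: hN.
  by exists N => n nN z zr; exact: hN.
right=> M.
have [|N hN] := @compact_unif R _ (fun n z => M <= nm (f (phi n) z)) cK.
  move=> z /ballU /finf [W /nbhsCP [d d0 hd] /(_ M) [N _ hN]].
  exists N, d => // n w nN /hd Ww; have := hN n nN w Ww.
  by rewrite /= nm_norm lecR.
by exists N => n nN z zr; exact: hN.
Qed.

Definition comparable_on A := forall M, exists M', forall f z w, G f -> A z -> A w ->
  nm (f z) <= M -> nm (f w) <= M'.
Definition power_comparable_on A := exists c : nat, exists L, forall f z w, G f -> A z -> A w ->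
  L <= nm (f z) -> nm (f w) <= nm (f z) ^+ c.
Definition montel_on A := forall f : nat -> C -> C, (forall n, G (f n)) ->
  (exists B, forall n z, A z -> nm (f n z) <= B) ->
  exists2 phi, increasing phi & forall e, 0 < e -> exists N, forall m n, (N <= m)%N -> (N <= n)%N ->
    forall z, A z -> nm (f (phi m) z - f (phi n) z) <= e.
(** The three consequences of normality on a small disc that survive unions of sets with a common
    point, and so spread along a component. The family itself need not be normal on the union in the
    sense of [normal_on]. *)
Definition harnack_set A := [/\ comparable_on A, power_comparable_on A & montel_on A].

Lemma comparable_onU A B b : comparable_on A -> comparable_on B -> A b -> B b ->
  comparable_on (A `|` B).
Proof.
move=> cA cB Ab Bb M.
have [MA hA] := cA M; have [MB hB] := cB M.
have [NA hNA] := cA MB; have [NB hNB] := cB MA.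
have bnd x : x \in [:: MA; MB; NA; NB] -> x <= `|MA| + `|MB| + `|NA| + `|NB|.
  move=> hx; have := ler_norm MA; have := ler_norm MB; have := ler_norm NA; have := ler_norm NB.
  have := normr_ge0 MA; have := normr_ge0 MB; have := normr_ge0 NA; have := normr_ge0 NB.
  by move: hx; rewrite !inE => /or4P[] /eqP ->; lra.
exists (`|MA| + `|MB| + `|NA| + `|NB|) => f z w Gf [Az|Bz] [Aw|Bw] h.
- by apply: (le_trans (hA f z w Gf Az Aw h)); apply: bnd; rewrite !inE eqxx.
- apply: (le_trans (hNB f b w Gf Bb Bw (hA f z b Gf Az Ab h))).
  by apply: bnd; rewrite !inE eqxx !orbT.
- apply: (le_trans (hNA f b w Gf Ab Aw (hB f z b Gf Bz Bb h))).
  by apply: bnd; rewrite !inE eqxx !orbT.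
- by apply: (le_trans (hB f z w Gf Bz Bw h)); apply: bnd; rewrite !inE eqxx !orbT.
Qed.

Lemma power_comparable_onU A B b : comparable_on A -> comparable_on B ->
  power_comparable_on A -> power_comparable_on B -> A b -> B b ->
  power_comparable_on (A `|` B).
Proof.
move=> cA cB [p [LA hA]] [q [LB hB]] Ab Bb.
have [MA hMA] := cA LB; have [MB hMB] := cB LA.
(* Above this threshold |f z| exceeds [MA] and [MB], which forces |f b| above [LB] or [LA], so the
   two power bounds can be composed at b. *)
exists (p + q + p * q)%N, (`|LA| + `|LB| + `|MA| + `|MB| + 1) => f z w Gf.
have := ler_norm LA; have := ler_norm LB; have := ler_norm MA; have := ler_norm MB.
have := normr_ge0 LA; have := normr_ge0 LB; have := normr_ge0 MA; have := normr_ge0 MB.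
move=> n1 n2 n3 n4 n5 n6 n7 n8 hz hw hL.
have f1 : 1 <= nm (f z) by lra.
have up k : (k <= p + q + p * q)%N -> nm (f z) ^+ k <= nm (f z) ^+ (p + q + p * q).
  by move=> hk; rewrite ler_weXn2l.
case: hz hw => [Az|Bz] [Aw|Bw].
- by apply: (le_trans (hA f z w Gf Az Aw _) (up p _)); [lra|rewrite -addnA leq_addr].
- have LBb : LB <= nm (f b).
    rewrite leNgt; apply/negP => /ltW h; have := hMA f b z Gf Ab Az h; lra.
  apply: (le_trans (hB f b w Gf Bb Bw LBb)).
  apply: (@le_trans _ _ ((nm (f z) ^+ p) ^+ q)); last by rewrite -exprM; apply: up; rewrite leq_addl.
  by rewrite lerXn2r ?nnegrE ?exprn_ge0 //; apply: hA => //; lra.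
- have LAb : LA <= nm (f b).
    rewrite leNgt; apply/negP => /ltW h; have := hMB f b z Gf Bb Bz h; lra.
  apply: (le_trans (hA f b w Gf Ab Aw LAb)).
  apply: (@le_trans _ _ ((nm (f z) ^+ q) ^+ p)).
    by rewrite lerXn2r ?nnegrE ?exprn_ge0 //; apply: hB => //; lra.
  by rewrite -exprM mulnC; apply: up; rewrite leq_addl.
- apply: (le_trans (hB f z w Gf Bz Bw _) (up q _)); first by lra.
  by rewrite addnAC leq_addl.
Qed.

Lemma montel_onU A B : montel_on A -> montel_on B -> montel_on (A `|` B).
Proof.
move=> mA mB f Gf [M hM].
have [|phi phi_inc hphi] := mA f Gf; first by exists M => n z Az; apply: hM; left.
have [||psi psi_inc hpsi] := mB (fun n => f (phi n)).
- by move=> n; exact: Gf.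
- by exists M => n z Bz; apply: hM; right.
exists (fun n => phi (psi n)); first by move=> m n mn; apply/phi_inc/psi_inc.
move=> e e0; have [N hN] := hphi e e0; have [N' hN'] := hpsi e e0.
exists (maxn N N') => m n; rewrite !geq_max => /andP[m1 m2] /andP[n1 n2] z [Az|Bz].
  by apply: hN => //; [exact: (leq_trans m1 (increasing_ge psi_inc _))
    |exact: (leq_trans n1 (increasing_ge psi_inc _))].
exact: hN'.
Qed.

Lemma harnack_setU A B b : harnack_set A -> harnack_set B -> A b -> B b ->
  harnack_set (A `|` B).
Proof.
move=> [a1 a2 a3] [b1 b2 b3] Ab Bb; split.
- exact: (@comparable_onU A B b).
- exact: (@power_comparable_onU A B b).
- exact: montel_onU.
Qed.

Lemma harnack_set_ball z0 : fatou_set G z0 ->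
  exists2 r, 0 < r & harnack_set [set z | nm (z - z0) < r].
Proof.
move=> [U [/openCP oU nU] Uz0]; have [r0 r00 hr0] := oU z0 Uz0.
pose r := r0 / 2; have r_gt0 : 0 < r by rewrite /r; lra.
have ballU z : nm (z - z0) <= r -> U z by move=> h; apply: hr0; move: h; rewrite /r; lra.
have cmp : comparable_on [set z | nm (z - z0) <= r].
  move=> M; apply: contrapT => no.
  have /choice [F hF] (n : nat) : exists p : (C -> C) * (C * C),
      [/\ G p.1, nm (p.2.1 - z0) <= r, nm (p.2.2 - z0) <= r, nm (p.1 p.2.1) <= M &
       n%:R < nm (p.1 p.2.2)].
    apply: contrapT => h; apply: no; exists n%:R => f z w Gf zr wr fz.
    rewrite leNgt; apply/negP => lt; apply: h; by exists (f, (z, w)).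
  have [|phi phi_inc] := @normal_dichotomy U z0 r (fun n => (F n).1) nU ballU.
    by move=> n; case: (hF n).
  case=> [[h [[B hB] cv]]|big].
    have [N hN] := cv 1 ltr01; have [m hm] := nat_above (B + 1).
    pose n := maxn N m; have [_ _ wr _ lt] := hF (phi n).
    have h1 := hN n (leq_maxl _ _) _ wr; have h2 := hB _ wr.
    have h3 : m%:R <= (phi n)%:R :> R.
      by rewrite ler_nat (leq_trans (leq_maxr N m)) // increasing_ge.
    have := nm_lesub ((F (phi n)).1 (F (phi n)).2.2) (h (F (phi n)).2.2); lra.
  have [N hN] := big (M + 1); have [_ zr _ le _] := hF (phi N).
  by have := hN N (leqnn N) _ zr; lra.
have [M1 hM1] := cmp 1.
(* Two points of this disc are less than r/200 apart, within reach of [harnack_power] on a disc of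
   radius r/2 about one of them. *)
exists (r / 400); first by lra.
split.
- by move=> M; have [M' hM'] := cmp M; exists M' => f z w Gf /= zr wr; apply: hM' => //=; lra.
(* If |f z| exceeds [M1], comparability gives |f| > 1 on the whole disc, as [harnack_power]
   requires. *)
- exists 4%N, (`|M1| + 2) => f z w Gf /= zr wr hz.
  have := ler_norm M1; have := normr_ge0 M1 => m0 m1.
  apply: (@harnack_power R f z (r / 2)); first by lra.
  + exact: Gent.
  + move=> v vz; rewrite ltNge; apply/negP => fv.
    have vz0 : nm (v - z0) <= r by have := nm_tri z v z0; lra.
    have zz0 : nm (z - z0) <= r by lra.
    have := hM1 f v z Gf vz0 zz0 fv; lra.
  + by lra.
  + by have := nm_tri z0 w z; rewrite (nm_sub z0 z); lra.
- move=> f Gf [B hB].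
  have [phi phi_inc] := normal_dichotomy nU ballU Gf.
  have z0r : nm (z0 - z0) < r / 400 by rewrite subrr nm0; lra.
  case=> [[h [_ cv]]|big]; last first.
    have [N hN] := big (B + 1); have := hB (phi N) z0 z0r.
    by have := hN N (leqnn N) z0; rewrite subrr nm0 => /(_ (ltW r_gt0)); lra.
  exists phi => // e e0; have [|N hN] := cv (e / 2); first by lra.
  exists N => m n hm hn z /= zr; have zr' : nm (z - z0) <= r by lra.
  have := hN m hm z zr'; have := hN n hn z zr'; rewrite (nm_sub (f (phi n) z)).
  by have := nm_tri (h z) (f (phi m) z) (f (phi n) z); lra.
Qed.

(** The points that share a [harnack_set] with z0 form a relatively open and closed subset of Om, by
    gluing small discs. *)
Lemma harnack_set_pair Om z0 w0 : connected Om -> Om `<=` fatou_set G -> Om z0 -> Om w0 ->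
  exists A, [/\ harnack_set A, A z0 & A w0].
Proof.
move=> cOm OmF Oz Ow.
pose P w := exists A, [/\ harnack_set A, A z0 & A w].
suff E : Om `&` P = Om by have : Om w0 by []; rewrite -E => -[].
have grow w : Om w -> exists2 r, 0 < r & forall w', nm (w' - w) < r ->
    P w' -> forall w'', nm (w'' - w) < r -> P w''.
  move=> /OmF /harnack_set_ball [r r_gt0 hr]; exists r => // w' hw' [A [hA Az Aw']] w'' hw''.
  exists (A `|` [set z | nm (z - w) < r]); split; [|by left|by right].
  exact: (harnack_setU hA hr Aw').
have Pz0 : P z0.
  have [r r_gt0 hr] := harnack_set_ball (OmF _ Oz).
  by exists [set z | nm (z - z0) < r]; split; rewrite //= subrr nm0.
apply: cOm; first by exists z0.
- exists [set w | exists2 r, 0 < r & forall w', nm (w' - w) < r -> P w'].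
    apply/openCP => w [r r_gt0 hr]; exists (r / 2); first by lra.
    move=> w' hw'; exists (r / 2); first by lra.
    by move=> w'' hw''; apply: hr; have := nm_tri w' w'' w; lra.
  apply/seteqP; split => w [Omw hw]; split => //.
    have [r r_gt0 hr] := grow w Omw; exists r => // w' hw'.
    by apply: (hr w _ hw w' hw'); rewrite subrr nm0.
  by case: hw => r r_gt0; apply; rewrite subrr nm0.
- exists (closure P); first exact: closed_closure.
  apply/seteqP; split => w [Omw hw]; split => //; first exact: subset_closure.
  have [r r_gt0 hr] := grow w Omw.
  move/closureCP: hw => /(_ r r_gt0) [w' Pw' hw'].
  by apply: (hr w' hw' Pw'); rewrite subrr nm0.
Qed.

Lemma harnack_set_compact Om K k0 : connected Om -> Om `<=` fatou_set G -> compact K ->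
  K `<=` Om -> K k0 -> exists2 A, harnack_set A & K `<=` A.
Proof.
move=> cOm OmF /compact_near_coveringP cK KO Kk0.
(* The filter of properties that hold for all sufficiently large harnack sets. It is closed under
   intersection because two harnack sets through k0 can be united; compactness then yields one set
   containing K. *)
pose F : set_system (set C) := [set P | exists A0, [/\ harnack_set A0, A0 k0 &
  forall A, A0 `<=` A -> harnack_set A -> P A]].
have FF : Filter F.
  split.
  - have [A [hA Ak _]] := harnack_set_pair cOm OmF (KO _ Kk0) (KO _ Kk0).
    by exists A.
  - move=> P Q [A [hA Ak HA]] [B [hB Bk HB]]; exists (A `|` B); split.
    + exact: (harnack_setU hA hB Ak).
    + by left.
    + move=> D ABD hD; split; [apply: HA => // x Ax|apply: HB => // x Bx]; apply: ABD; by [left|right].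
  - by move=> P Q PQ [A [hA Ak HA]]; exists A; split => // D AD hD; apply/PQ/HA.
have [|A0 [hA0 _ HA0]] := cK (set C) F (fun A w => A w) FF; last first.
  by exists A0 => //; exact: HA0.
move=> x Kx; have [A [hA Ak Ax]] := harnack_set_pair cOm OmF (KO _ Kk0) (KO _ Kx).
have [r r_gt0 hr] := harnack_set_ball (OmF _ (KO _ Kx)).
exists ([set w | nm (w - x) < r], [set D | A `|` [set w | nm (w - x) < r] `<=` D]).
  split; first by apply/nbhsCP; exists r.
  exists (A `|` [set w | nm (w - x) < r]); split => //; last by left.
  by apply: (harnack_setU hA hr Ax); rewrite /= subrr nm0.
by move=> [w D] [/= hw hD]; apply: hD; right.
Qed.

(* If the family is bounded or zero-free wherever it is large on the boundary of V, then it
   is normal on V by the maximum and minimum modulus principles. *)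
Lemma large_with_zero V Om a : open V -> nbounded V -> connected Om -> Om `<=` fatou_set G ->
  frontier V `<=` Om -> V a -> ~ fatou_set G a ->
  forall r, exists2 f, G f & (forall z, frontier V z -> r <= nm (f z)) /\ exists2 v, V v & f v = 0.
Proof.
move=> oV bV cOm OmF frO Va nFa r; apply: contrapT => no; apply: nFa.
have [k0 frk0] := fr_nonempty oV bV Va.
have [A [A1 _ A3] frA] := harnack_set_compact cOm OmF (fr_compact oV bV) frO frk0.
have cl f : cdiff_everywhere f -> forall z, closure V z -> cont_at f z by move=> ef z _; exact/cdiff_cont/ef.
exists V => //; split=> // f Gf.
(* Either infinitely many f n take a value bounded by B on the frontier, or f n tends to infinity
   uniformly there. *)
have [[B hB]|nB] := pselect (exists B, forall N, exists2 n, (N <= n)%N &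
    exists2 z, frontier V z & nm (f n z) <= B); last first.
  exists id => //; right=> z Vz; exists V.
    by apply/nbhsCP; exact: (openCP V).1.
  move=> M; apply: contrapT => nM; apply: nB; exists (`|M| + `|r| + 1) => N.
  apply: contrapT => nN; apply: nM; exists N => // n /= Nn w Vw.
  have big z' : frontier V z' -> `|M| + `|r| + 1 <= nm (f n z').
    by move=> hz'; rewrite leNgt; apply/negP => /ltW lt; apply: nN; exists n => //; exists z'.
  have := ler_norm M; have := normr_ge0 M; have := ler_norm r; have := normr_ge0 r => r1 r2 m1 m2.
  have p0 : 0 < `|M| + `|r| + 1 by lra.
  have f0 v : V v -> f n v != 0.
    move=> Vv; apply/negP => /eqP fv; apply: no; exists (f n) => //; split; last by exists v.
    by move=> z' /big; lra.
  rewrite nm_norm lecR; apply: (@le_trans _ _ (`|M| + `|r| + 1)); first by lra.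
  by apply: (min_modulus p0 oV bV (cl _ (Gent (Gf n))) _ f0 big Vw) => v _; exact: (Gent (Gf _)).
have [phi0 inc0 hphi0] := subsequence_such hB.
have [B' hB'] := A1 B.
have [||phi1 inc1 hphi1] := A3 (fun n => f (phi0 n)).
- by move=> n; exact: Gf.
- by exists B' => n z Az; have [z' /frA Az' h] := hphi0 n; exact: (hB' _ z').
pose F n := f (phi0 (phi1 n)).
have eF n : cdiff_everywhere (F n) by exact: (Gent (Gf _)).
have cau e : 0 < e -> exists N, forall m n, (N <= m)%N -> (N <= n)%N ->
    forall z, V z -> nm (F m z - F n z) <= e.
  move=> /hphi1 [N hN]; exists N => m n hm hn.
  apply: (@max_modulus R V (fun z => F m z - F n z) e oV bV).
  - by move=> z _; apply: cdiff_cont; apply: (cdiffB (eF m z) (eF n z)).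
  - by move=> z _; exact: (cdiffB (eF m z) (eF n z)).
  - by move=> z /frA; exact: hN.
have /choice [h hh] z : exists l, V z -> forall e, 0 < e -> exists N, forall n, (N <= n)%N -> nm (F n z - l) <= e.
  have [Vz|nVz] := pselect (V z); last by exists 0.
  have [|l hl] := @complex_cauchy R (fun n => F n z); last by exists l.
  by move=> e /cau [N hN]; exists N => m n hm hn; exact: hN.
have unif e : 0 < e -> exists N, forall n, (N <= n)%N -> forall z, V z -> nm (F n z - h z) <= e.
  move=> e0; have [|N hN] := cau (e / 2); first by lra.
  exists N => n hn z Vz; have [|N' hN'] := hh z Vz (e / 2); first by lra.
  have h1 := hN n (maxn N N') hn (leq_maxl _ _) z Vz.
  have h2 := hN' (maxn N N') (leq_maxr _ _).
  by have := nm_tri (F (maxn N N') z) (F n z) (h z); lra.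
exists (fun n => phi0 (phi1 n)); first by move=> m n mn; apply/inc0/inc1.
left; exists h.
  move=> z Vz; apply/derivable_cdiff; have [d d0 hd] := (openCP V).1 oV z Vz.
  have d2 : 0 < d / 2 by lra.
  apply: (@uniform_limit_cdiff R F h z (d / 2)) => //.
    by move=> n w _; exact: eF.
  move=> e /unif [N hN]; exists N => n hn w hw; apply: hN => //; apply: hd; lra.
move=> z Vz; exists V; first by apply/nbhsCP; exact: (openCP V).1.
apply/uniform_cvgCP => e e0; have [|N hN] := unif (e / 2); first by lra.
by exists N => n hn w Vw; have := hN n hn w Vw; rewrite /F /=; lra.
Qed.

End Normality.

(** * Transcendental semigroups *)

Section Dynamics.
Variable R : realType.
Local Notation C := (CC R).
Implicit Types (f g h : C -> C) (z w a b v : C) (x y r s t e M L : R) (A K U V Om : set C).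
Variable gens : set (C -> C).
Hypothesis gens_ent : forall g, gens g -> cdiff_everywhere g.
Hypothesis gens_dense : forall g, gens g -> dense_at_infty g.
Local Notation G := (semigroup gens).

Lemma semigroup_ent f : G f -> cdiff_everywhere f.
Proof.
elim=> [g /gens_ent //|g h Gg _ eh z].
by apply: (@cdiff_comp R h g) => //; exact: gens_ent.
Qed.

Lemma semigroup_dense f : G f -> dense_at_infty f.
Proof.
elim=> [g /gens_dense //|g h Gg _ dh].
by apply: dense_comp => //; [exact: gens_ent|exact: gens_dense].
Qed.

Lemma semigroup_composition f g : G f -> G g -> G (f \o g).
Proof.
move=> Gf Gg; elim: Gf => [h gh|h k gh _ IH]; first exact: semigroup_comp.
exact: (semigroup_comp gh IH).
Qed.

Lemma semigroup_iter f m : G f -> G (iter m.+1 f).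
Proof.
move=> Gf; elim: m => [//|m IH].
have -> : iter m.+2 f = f \o iter m.+1 f by [].
exact: semigroup_composition.
Qed.

(** Otherwise [covering] would put S inside f(V), which is bounded. *)
Lemma image_meets_boundary V f (S : set C) v : open V -> nbounded V -> cdiff_everywhere f -> connected S ->
  ~ nbounded S -> V v -> S (f v) -> exists2 z, frontier V z & S (f z).
Proof.
move=> oV bV ef cS nbS Vv Sv; apply: contrapT => no; apply: nbS.
have [|M _ hM] := @compact_bounded_fun R (closure V) f (closure_compact bV).
  by move=> z _; exact/cdiff_cont/ef.
exists M => w Sw.
have [|z Vz <-] := @covering R V f S v oV bV ef cS _ Vv Sv w Sw; last by apply/hM/subset_closure.
by move=> z frz Sz; apply: no; exists z.
Qed.

(** * Contradictions from a domain enclosed by one component *)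

Section Enclosed.
Variables (V Om : set C) (a : C).
Hypothesis (oV : open V) (bV : nbounded V) (cOm : connected Om).
Hypothesis OmF : Om `<=` fatou_set G.
Hypothesis frO : frontier V `<=` Om.
Hypothesis Va : V a.
Hypothesis nFa : ~ fatou_set G a.

Lemma boundary_harnack : exists2 A, harnack_set G A & frontier V `<=` A.
Proof.
have [k0 frk0] := fr_nonempty oV bV Va.
exact: (harnack_set_compact semigroup_ent cOm OmF (fr_compact oV bV) frO frk0).
Qed.

Lemma fill f r : G f -> (forall z, frontier V z -> nm (f z) <= r) -> forall z, V z -> nm (f z) <= r.
Proof.
move=> Gf; apply: max_modulus => // z _; last exact: semigroup_ent.
exact/cdiff_cont/semigroup_ent.
Qed.

Lemma large_covering r : exists2 f, G f & forall w, nm w < r -> exists2 v, V v & f v = w.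
Proof.
have [f Gf [frf [v Vv fv]]] := large_with_zero semigroup_ent oV bV cOm OmF frO Va nFa (2 * r).
exists f => // w wr; exact: (disc_covering oV bV (semigroup_ent Gf) frf Vv fv wr).
Qed.

Lemma no_bounded_curve (Gamma : set C) g : connected Gamma -> ~ nbounded Gamma -> gens g ->
  (exists B, forall z, Gamma z -> nm (g z) <= B) -> False.
Proof.
move=> cG nbG gg [B hB].
have [A [A1 _ _] frA] := boundary_harnack.
have [B' hB'] := A1 B.
have [gam gGam] : exists z, Gamma z by apply: contrapT => h; apply: nbG; exists 0 => z Gz; case: h; exists z.
have bnd w : nm (g w) <= B'.
  (* The radius lets f(V) contain both w and a point of Gamma; the bound B' obtained below does not
     depend on this f. *)
  have [f Gf cov] := large_covering (nm w + nm gam + 1).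
  have [v Vv fv] : exists2 v, V v & f v = gam by apply: cov; have := nm_ge0 w; lra.
  have [z frz Gz] : exists2 z, frontier V z & Gamma (f z).
    by apply: (@image_meets_boundary V f Gamma v) => //; [exact: semigroup_ent|rewrite fv].
  have Ggf : G (g \o f) by exact: semigroup_comp.
  have [w' Vw' <-] : exists2 v, V v & f v = w by apply: cov; have := nm_ge0 gam; lra.
  apply: (fill Ggf) => // z' frz'.
  by apply: (hB' (g \o f) z z' Ggf (frA _ frz) (frA _ frz')); exact: hB.
have [z _] := gens_dense gg (rc (`|B'| + 2)) 0 ltr01.
have := bnd z; have := nm_lesub (rc (`|B'| + 2)) (g z); rewrite nm_sub nm_rc ger0_norm.
  by have := ler_norm B'; lra.
by have := normr_ge0 B'; lra.
Qed.

(* If all iterates were bounded, one almost attaining the supremum would be almost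
   constant on V, although its image contains 0 and 1. *)
Lemma iterates_unbounded f rho : G f -> 1 <= rho -> (forall z, V z -> nm z <= rho) ->
  (forall w, nm w < 50 * rho -> exists2 v, V v & f v = w) ->
  (forall m w, nm w < 50 * rho -> exists2 v, V v & iter m.+1 f v = w) ->
  forall M, exists m, exists2 z, frontier V z & M < nm (iter m.+1 f z).
Proof.
move=> Gf rho1 Vrho cov covm M; apply: contrapT => no.
have bM m z : V z -> nm (iter m.+1 f z) <= M.
  apply: fill; first exact: semigroup_iter.
  by move=> z' frz'; rewrite leNgt; apply/negP => lt; apply: no; exists m, z'.
pose D := [set x | exists m, exists2 z, V z & x = nm (iter m.+1 f z)].
have D0 : D !=set0 by exists (nm (iter 1 f a)), 0%N, a.
have Ds : has_sup D by split => //; exists M => _ [m [z Vz ->]]; exact: bM.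
have le m z : V z -> nm (iter m.+1 f z) <= sup D.
  by move=> Vz; apply: sup_upper_bound => //; exists m, z.
(* A gap of 1/16 makes the iterate vary by less than 1/4 from its value at z0, so the values 0 and 1
   cannot both occur on V. *)
have [_ [m [z0 Vz0 ->]] lt] := sup_adherent (ltac:(lra) : 0 < 1 / 16 :> R) Ds.
set s := sup D in le lt.
(* The disc is contained in f(V), so the bound for the next iterate on V bounds this one on a disc
   much larger than V. *)
have leD w : nm w < 50 * rho -> nm (iter m.+1 f w) <= s.
  by move=> /cov [v Vv <-]; rewrite -iterSr; exact: le.
have r0 : 0 < 40 * rho by lra.
have near z : nm (z - z0) <= 40 * rho -> nm z < 50 * rho.
  by have := nm_lesub z z0; have := Vrho z0 Vz0; lra.
have nc z : V z -> nm (iter m.+1 f z - iter m.+1 f z0) <= 4 * (s - nm (iter m.+1 f z0)).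
  move=> Vz; apply: (@near_const R (iter m.+1 f) z0 (40 * rho) s r0).
  - by move=> w _; exact: (semigroup_ent (semigroup_iter m Gf)).
  - by move=> w /near; exact: leD.
  - by have := nmB z z0; have := Vrho z Vz; have := Vrho z0 Vz0; lra.
have [|z1 Vz1 E1] := covm m 0; first by rewrite nm0; lra.
have [|z2 Vz2 E2] := covm m 1; first by rewrite nm1; lra.
have h1 := nc z1 Vz1; have h2 := nc z2 Vz2; rewrite E1 in h1; rewrite E2 in h2.
have := nm_tri (iter m.+1 f z0) 0 1; rewrite sub0r nmN nm1 sub0r nmN.
rewrite sub0r nmN in h1; rewrite (nm_sub _ 1); lra.
Qed.

Lemma no_unbounded_component (U0 : set C) u0 : connected U0 -> U0 `<=` fatou_set G -> U0 u0 ->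
  ~ nbounded U0 -> False.
Proof.
move=> cU U0F Uu nbU.
have [A [A1 [c1 [L1 A2]] _] frA] := boundary_harnack.
have [k0 frk0] := fr_nonempty oV bV Va.
have [B0 hB0] := bV; pose rho := `|B0| + 1.
have rho1 : 1 <= rho by rewrite /rho; have := normr_ge0 B0; lra.
have Vrho z : V z -> nm z <= rho by move=> /hB0; rewrite /rho; have := ler_norm B0; lra.
clearbody rho.
(* The radius is chosen so that f(V) contains u0 and V itself; hence every iterate covers the same
   disc. *)
have [f Gf cov0] := large_covering (50 * rho + nm u0 + 1).
have ef := semigroup_ent Gf.
have covm m w : nm w < 50 * rho + nm u0 + 1 -> exists2 v, V v & iter m.+1 f v = w.
  elim: m w => [|m IH] w hw; first exact: cov0.
  have [v Vv <-] := IH w hw; have [|v' Vv' fv'] := cov0 v.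
    by have := Vrho v Vv; have := nm_ge0 u0; lra.
  by exists v' => //; rewrite iterSr fv'.
have unb := iterates_unbounded Gf rho1 Vrho
  (fun w hw => cov0 w ltac:(have := nm_ge0 u0; lra))
  (fun m w hw => covm m w ltac:(have := nm_ge0 u0; lra)).
have meet m : exists2 z, frontier V z & U0 (iter m.+1 f z).
  have [|v Vv fv] := covm m u0; first by lra.
  apply: (@image_meets_boundary V (iter m.+1 f) U0 v) => //; last by rewrite fv.
  exact: (semigroup_ent (semigroup_iter m Gf)).
(* The points f z1 and f (f z2) both lie in U0. Applying one further iterate to both compares
   consecutive iterates of f at frontier points of V. *)
have [z1 frz1 Uz1] := meet 0%N; have [z2 frz2 Uz2] := meet 1%N.
have [A0 [[_ [c0 [L0 A02]] _] A0z1 A0z2]] := harnack_set_pair semigroup_ent cU U0F Uz1 Uz2.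
have [Q hQ] := A1 L1.
have [Mf _ hMf] := @compact_bounded_fun R (frontier V) f (fr_compact oV bV) (fun z _ => cdiff_cont (ef z)).
apply: (dense_not_polynomial (semigroup_dense Gf)).
(* The exponent composes three comparisons: c1 from [zm] to z1, c0 inside U0, c1 from z2 to the
   whole frontier; one more factor t absorbs the bounded case. The constant compensates for passing
   from t to t / 3. *)
apply: (@growth_polynomial R (c1 * (c0 * c1)).+1 f (3 ^+ (c1 * (c0 * c1)).+1) ef) => L.
pose t0 := `|L0| + `|L1| + `|Q| + 3 * `|L| + 1.
have t0L0 : L0 < t0 by rewrite /t0; have := ler_norm L0; have := normr_ge0 L1; have := normr_ge0 Q; have := normr_ge0 L; lra.
have t0L1 : L1 < t0 by rewrite /t0; have := normr_ge0 L0; have := ler_norm L1; have := normr_ge0 Q; have := normr_ge0 L; lra.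
have t0Q : `|Q| + 1 <= t0 by rewrite /t0; have := normr_ge0 L0; have := normr_ge0 L1; have := normr_ge0 L; lra.
have t0L : L < t0 / 3 by rewrite /t0; have := normr_ge0 L0; have := normr_ge0 L1; have := normr_ge0 Q; have := ler_norm L; lra.
clearbody t0.
have [Mt hMt] := A1 t0.
(* Exceeding [Mt] at one frontier point forces the iterate above t0 on the whole frontier; exceeding
   [Mf] rules out f itself, so that [H] is at least the second iterate. *)
have [m [z frz lt]] := unb (`|Mt| + `|Mf|).
have Mt_lt : Mt < nm (iter m.+1 f z) by have := ler_norm Mt; have := normr_ge0 Mf; lra.
have Mf_lt : Mf < nm (iter m.+1 f z) by have := ler_norm Mf; have := normr_ge0 Mt; lra.
case: m lt Mt_lt Mf_lt => [|m] _ Mt_lt Mf_lt; first by have := hMf z frz; rewrite /= in Mf_lt; lra.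
pose H := iter m.+2 f; have GH : G H by exact: semigroup_iter.
have big z' : frontier V z' -> t0 < nm (H z').
  move=> frz'; rewrite ltNge; apply/negP => le.
  by have := hMt H z' z GH (frA _ frz') (frA _ frz) le; rewrite /H; lra.
(* The minimum t of |H| on the frontier both starts the chain of upper bounds and gives the radius
   of the disc covered by H(V). *)
have [zm frzm hzm] : exists2 zm, frontier V zm & forall z', frontier V z' -> nm (H zm) <= nm (H z').
  have Hn z' : frontier V z' -> H z' != 0.
    by move=> /big h; rewrite -nm_gt0; have := normr_ge0 Q; lra.
  have [||zm frzm h] := @compact_max_modulus R (frontier V) (fun z => (H z)^-1) (fr_compact oV bV).
  - by exists k0.
  - by move=> z' frz'; apply: contV; [exact: Hn|exact/cdiff_cont/semigroup_ent].
  exists zm => // z' frz'; have := h z' frz'.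
  by rewrite !nmV lef_pV2 // posrE nm_gt0 Hn.
set t := nm (H zm) in hzm.
have tt0 : t0 < t by exact: big.
have t1 : 1 <= t by have := normr_ge0 Q; lra.
have Hz1 : nm (H z1) <= t ^+ c1.
  by apply: (A2 H zm z1 GH (frA _ frzm) (frA _ frz1)); rewrite -/t; lra.
have Hf z' : iter m.+3 f z' = f (H z') by [].
have GfH : G (iter m.+3 f) by exact: semigroup_iter.
have Hz2 : nm (iter m.+3 f z2) <= t ^+ (c1 * c0).
  have E1 : iter m.+1 f (iter 1 f z1) = H z1 by rewrite /H [in RHS]iterSr.
  have E2 : iter m.+1 f (iter 2 f z2) = iter m.+3 f z2 by rewrite -iterD addn2.
  have := A02 (iter m.+1 f) (iter 1 f z1) (iter 2 f z2) (semigroup_iter m Gf) A0z1 A0z2.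
  rewrite E1 E2 => h; apply: (le_trans (h _)); first by have := big z1 frz1; lra.
  by rewrite exprM lerXn2r ?nnegrE ?exprn_ge0 //; lra.
pose c := (c1 * (c0 * c1))%N.
have tc1 : 1 <= t ^+ c by rewrite exprn_ege1.
have up z' : frontier V z' -> nm (iter m.+3 f z') <= t ^+ c.+1.
  move=> frz'; have [le|lt] := lerP L1 (nm (iter m.+3 f z2)).
    apply: (le_trans (A2 _ z2 z' GfH (frA _ frz2) (frA _ frz') le)).
    apply: (@le_trans _ _ ((t ^+ (c1 * c0)) ^+ c1)).
      by rewrite lerXn2r ?nnegrE ?exprn_ge0 //; lra.
    by rewrite -exprM -mulnA ler_weXn2l.
  apply: (le_trans (hQ _ z2 z' GfH (frA _ frz2) (frA _ frz') (ltW lt))).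
  have := ler_norm Q; rewrite exprS; nra.
exists (t / 3); first by lra.
move=> w wt.
have [v0 Vv0 Hv0] : exists2 v, V v & H v = 0.
  by apply: covm; rewrite nm0; have := nm_ge0 u0; lra.
have [v Vv <-] : exists2 v, V v & H v = w.
  apply: (@disc_covering R V H (t / 2) v0 oV bV (semigroup_ent GH)) => //; last by lra.
  by move=> z' /hzm; lra.
rewrite -Hf -exprMn (_ : 3 * (t / 3) = t); last by field.
exact: (fill GfH up).
Qed.

End Enclosed.

Lemma julia_connected :
  (exists2 Gamma : set C, curve_to_infty Gamma &
     forall g, gens g -> [bounded g z | z in Gamma]) \/
  (exists2 z : C, fatou_set G z & ~ bounded_set (connected_component (fatou_set G) z)) \/
  (exists D : set C, [/\ D !=set0, open D, connected D, D `<=` fatou_set G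
       & exists2 g0, G g0 & completely_invariant g0 D]) ->
  gens !=set0 ->
  connected (julia_set G `|` [set None]).
Proof.
move=> hyp [g gg]; apply: contrapT => nc.
have oF : open (fatou_set G) by apply: bigcup_open => U [].
have [A [B [cA [a Aa] cB AB FAB]]] := sphere_separation oF nc.
have [V [z0 [oV bV Va frV]]] := separating_domain cA cB AB FAB Aa.
have nFa : ~ fatou_set G a by move=> /FAB [].
have cOm : connected (connected_component (fatou_set G) z0) by exact: component_connected.
have OmF : connected_component (fatou_set G) z0 `<=` fatou_set G.
  exact: connected_component_sub.
have bounded_setP (S : set C) : nbounded S -> bounded_set S.
  move=> [M hM]; exists (M%:C); split; first by rewrite complex_real.
  move=> x Mx z Sz; rewrite /= (le_trans _ (ltW Mx)) // nm_norm lecR; exact: hM.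
have no_unb (S : set C) u : connected S -> S `<=` fatou_set G -> S u -> ~ nbounded S -> False.
  exact: (no_unbounded_component oV bV cOm OmF frV Va nFa).
case: hyp => [[Gamma [gam [cgam gam_inf ->]] bnd]|[[z Fz nb]|[D [[d Dd] oD cD DF [g0 Gg0 [_ inv]]]]]].
- apply: (no_bounded_curve oV bV cOm OmF frV Va nFa _ _ gg).
  + apply: connected_continuous_connected cgam.
    by apply/connected_intervalP; exact: interval_is_interval.
  + move=> [M hM]; have [T [_ hT]] := gam_inf (M + 1).
    pose t := Num.max T 0 + 1.
    have t0 : 0 <= t by rewrite /t; have : 0 <= Num.max T 0 by [rewrite le_max lexx orbT]; lra.
    have tT : T < t by rewrite /t; have : T <= Num.max T 0 by [rewrite le_max lexx]; lra.
    have := hT t tT; rewrite nm_norm lecR.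
    have := hM (gam t); have h : [set gam x | x in `[(0:R), +oo[] (gam t).
      by exists t => //=; rewrite in_itv /= t0.
    by move=> /(_ h); lra.
  + have [M [Mreal hM]] := bnd g gg.
    exists (re (M + 1)) => z hz.
    have M1 : M < M + 1 by rewrite ltrDl.
    have := hM _ M1 z hz; rewrite /= nm_norm.
    have -> : M + 1 = (re (M + 1))%:C.
      by rewrite /re RRe_real // realD // real1.
    by rewrite lecR.
- apply: (no_unb (connected_component (fatou_set G) z) z).
  + exact: component_connected.
  + exact: connected_component_sub.
  + exact: connected_component_refl.
  + by move=> /bounded_setP.
- apply: (no_unb D d) => // -[M hM].
  have [e e0 he] := (openCP D).1 oD d Dd.
  have [w Mw dw] := semigroup_dense Gg0 d M e0.
  have Dw : D w by apply: inv; exact: he.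
  by have := hM w Dw; lra.
Qed.

End Dynamics.

Theorem corollary2p8 (R : realType) (gens : set (CC R -> CC R))
  (gens_neq0 : gens !=set0) (gens_countable : countable gens)
  (gens_transcendental : forall g, gens g -> transcendental_entire g) :
  let G := semigroup gens in
  (exists2 Gamma : set (CC R), curve_to_infty Gamma &
     forall g, gens g -> [bounded g z | z in Gamma]) \/
  (exists2 z : CC R, fatou_set G z &
     ~ bounded_set (connected_component (fatou_set G) z)) \/
  (exists D : set (CC R),
     [/\ D !=set0, open D, connected D, D `<=` fatou_set G
       & exists2 g0, G g0 & completely_invariant g0 D]) ->
  connected (julia_set G `|` [set None]).
Proof.
have gens_ent g : gens g -> cdiff_everywhere g.
  by move=> /gens_transcendental [eg _] z; apply/derivable_cdiff; exact: eg.
move=> G hyp; apply: julia_connected => // g gg.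
apply: casorati_weierstrass; first exact: gens_ent.
by have [_] := gens_transcendental g gg.
Qed.
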